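(* Suppose that $\sigma_1,\dots,\sigma_d,b:\mathbb R^d\to\mathbb R^d$ are smooth, bounded, with bounded derivatives of all orders. Let $\mathcal A$ be a finite tree and let $f:\mathbb R^d\to\mathbb R$ be smooth and bounded with bounded derivatives of all orders. For $n\in\mathbb N^*$ with $n\ge\max_{u\in\mathcal A}j_u(\mathcal A)$ and $x\in\mathbb R^d$ let $$\Upsilon_{\mathcal A}f(x)=\sum_{\Lambda\subset\mathcal E(\mathcal A)}(-1)^{\mathrm{Card}(\Lambda)}f\big(X_T^{\Pi_0(\mathcal A_\Lambda)}(x)\big),$$ where $X^{\Pi_0(\mathcal A_\Lambda)}(x)$ is the Euler scheme started from $x$ on the random grid $\Pi_0(\mathcal A_\Lambda)$ defined in the context, all the schemes being driven by the same Brownian motion. Then there is a constant $C$, independent of $n$ and $x$, such that $$\mathbb E\big[(\Upsilon_{\mathcal A}f(x))^2\big]\le\frac{C}{n^{2\sum_{u\in\mathcal E(\mathcal A)}|u|}}.$$ In particular, with $c(\mathcal A)=\prod_{u\in\mathcal A}\binom{n}{j_u(\mathcal A)}$, one has $\mathbb E[(c(\mathcal A)\Upsilon_{\mathcal A}f(x))^2]\le C$ and thus $\mathrm{Var}[c(\mathcal A)\Upsilon_{\mathcal A}f(x)]\le C$ (for a constant $C$ independent of $n$ and $x$).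
   Context: Notation: $\mathbb N=\{0,1,\dots\}$, $\mathbb N^*=\mathbb N\setminus\{0\}$; $T>0$ is fixed and $h_l=T/n^l$. $\emptyset$ denotes the root of a tree and $\varnothing$ the void set. Trees: let $\mathcal U=\bigcup_{m\ge0}(\mathbb N^* )^m$, let $\emptyset$ be the empty sequence (root), $|u|$ the length of $u$, and for $u=(u_1,\dots,u_m)$ let $iu=(i,u_1,\dots,u_m)$, $ui=(u_1,\dots,u_m,i)$. A (finite) tree is a finite $\mathcal A\subset\mathcal U$ with $\emptyset\in\mathcal A$; $uj\in\mathcal A\Rightarrow u\in\mathcal A$; and $uj\in\mathcal A\Rightarrow ui\in\mathcal A$ for $1\le i<j$. $j_u(\mathcal A)$ is the number of sons of $u$, i.e. $\max\{i\in\mathbb N^*:ui\in\mathcal A\}$ ($0$ if there is none); $\mathcal A_i'=\{u:iu\in\mathcal A\}$; leaves: $\mathcal E(\mathcal A)=\{u\in\mathcal A:j_u(\mathcal A)=0\}$. Random labels: $\kappa(u)=(\kappa_1(u),\dots,\kappa_{j_u(\mathcal A)}(u))$, $u\in\mathcal A\setminus\mathcal E(\mathcal A)$, are independent random variables, $\kappa(u)$ being uniform on $\{(k_1,\dots,k_{j_u(\mathcal A)}):0\le k_1<\dots<k_{j_u(\mathcal A)}\le n-1\}$. The subtree $\mathcal A_i'$ is labelled by $\kappa^i(v)=\kappa(iv)$. Random grids: for $\Lambda\subset\mathcal E(\mathcal A)$ let $\mathcal A_\Lambda=\mathcal A\setminus\Lambda$ and, when $j_\emptyset(\mathcal A)\ge1$,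 $\Lambda_i=\{u\in\mathcal A_i':iu\in\Lambda\}$ for $1\le i\le j_\emptyset(\mathcal A)$. Define recursively the finite set $G_l(\mathcal A_\Lambda)\subset[0,h_l]$ by $G_l(\mathcal A_\Lambda)=\{0,h_l\}$ if $\mathcal A_\Lambda=\varnothing$ (i.e. $\mathcal A=\Lambda=\{\emptyset\}$), and otherwise $$G_l(\mathcal A_\Lambda)=\{qh_{l+1}:q=0,\dots,n\}\cup\bigcup_{1\le i\le j_\emptyset(\mathcal A),\,i\notin\Lambda}\Big(\kappa_i(\emptyset)h_{l+1}+G_{l+1}\big((\mathcal A_i')_{\Lambda_i}\big)\Big),$$ where $t+G=\{t+s:s\in G\}$. $\Pi_0(\mathcal A_\Lambda)=\{0=s_0<s_1<\dots<s_m=T\}$ is the increasing rearrangement of $G_0(\mathcal A_\Lambda)$. Euler scheme: $W=(W^1,\dots,W^d)$ is a $d$-dimensional Brownian motion independent of the labels $\kappa$. For a grid $\Pi=\{0=s_0<\dots<s_m=T\}$, $X_0^\Pi(x)=x$ and $$X_{s_{i+1}}^\Pi=X_{s_i}^\Pi+\sum_{j=1}^d\sigma_j(X_{s_i}^\Pi)(W^j_{s_{i+1}}-W^j_{s_i})+b(X_{s_i}^\Pi)(s_{i+1}-s_i).$$ *)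

(* Defs.v *)
From HB Require Import structures.
From mathcomp Require Import all_boot all_order all_algebra finmap.
From mathcomp Require Import all_classical all_reals all_analysis.

Set Implicit Arguments.
Unset Strict Implicit.
Unset Printing Implicit Defensive.

Import Order.TTheory GRing.Theory Num.Theory.
Import numFieldNormedType.Exports.

Local Open Scope classical_set_scope.
Local Open Scope ring_scope.

(* Words over nat; that the letters of the words of a tree are positive is part
   of [is_tree]. *)
Definition word := seq nat.

Definition is_tree (A : {fset word}) : Prop :=
  [/\ [::] \in A,
      forall u : word, u \in A -> 0%N \notin u,
      forall (u : word) (j : nat), rcons u j \in A -> u \in A &
      forall (u : word) (i j : nat),
        rcons u j \in A -> (0 < i < j)%N -> rcons u i \in A].

(* max {i | ui \in A}, and 0 if there is none: the test selects the words of A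
   of the form v = ui, for which i = last 0 v. *)
Definition nsons (A : {fset word}) (u : word) : nat :=
  (\max_(v <- A | v == rcons u (last 0 v)) last 0 v)%N.

Definition leaves (A : {fset word}) : {fset word} :=
  [fset u in A | nsons A u == 0%N]%fset.

Definition subtree (i : nat) (A : {fset word}) : {fset word} :=
  [fset behead v | v in A & v == i :: behead v]%fset.

Definition subleaves (i : nat) (A L : {fset word}) : {fset word} :=
  [fset u in subtree i A | i :: u \in L]%fset.

Lemma in_subtree (i : nat) (A : {fset word}) (u : word) :
  (u \in subtree i A) = (i :: u \in A).
Proof.
apply/imfsetP/idP => /= [[v]|iuA].
  by rewrite inE => /andP[vA /eqP vE] ->; rewrite -vE.
by exists (i :: u) => //=; rewrite inE iuA /= eqxx.
Qed.

Lemma card_subtree (i : nat) (A : {fset word}) :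
  [::] \in A -> (#|` subtree i A| < #|` A|)%N.
Proof.
move=> A0.
have -> : #|` subtree i A| = #|` (cons i @` subtree i A)%fset|.
  by rewrite [RHS]card_imfset // => u v [].
have sub : (cons i @` subtree i A `<=` A `\ [::])%fset.
  by apply/fsubsetP => _ /imfsetP[/= u + ->]; rewrite in_subtree !inE.
apply: leq_ltn_trans (fsubset_leq_card sub) _.
by rewrite [leqRHS](cardfsD1 [::]) A0.
Qed.

Lemma is_tree_subtree (i : nat) (A : {fset word}) :
  is_tree A -> [:: i] \in A -> is_tree (subtree i A).
Proof.
case=> A0 Apos Apre Asib iA; split.
- by rewrite in_subtree.
- by move=> u; rewrite in_subtree => /Apos; rewrite inE negb_or => /andP[].
- by move=> u j; rewrite !in_subtree -rcons_cons => /Apre.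
- by move=> u a j; rewrite !in_subtree -!rcons_cons => /Asib h /h.
Qed.

Lemma nsonsP (A : {fset word}) (u : word) (i : nat) : is_tree A ->
  (i \in iota 1 (nsons A u)) = (rcons u i \in A).
Proof.
case=> _ Apos _ Asib; rewrite mem_iota add1n ltnS; apply/idP/idP; last first.
  move=> uiA; apply/andP; split.
    by have := Apos _ uiA; rewrite mem_rcons inE negb_or eq_sym -lt0n => /andP[].
  have := @leq_bigmax_seq _ (A : seq word) (fun v => v == rcons u (last 0%N v)) (last 0%N).
  by move=> /(_ _ uiA); rewrite last_rcons => ->.
case/andP=> i0 ij.
have [n0|] : nsons A u = 0%N \/ rcons u (nsons A u) \in A.
- rewrite /nsons big_seq_cond.
  pose Q m := m = 0%N \/ rcons u m \in A.
  apply: (big_ind Q) => [|a c ha hc|v /andP[vA /eqP vE]].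
  + by left.
  + by rewrite /maxn; case: ifP.
  + by right; rewrite -vE.
- by move: ij; rewrite n0 leqNgt i0.
case: ltngtP ij => // [ij _ jA|-> _ //].
by apply: Asib jA _; rewrite i0.
Qed.

Section RandomGrid.
Context {R : realType} (T : R) (n : nat).

Definition mesh (l : nat) : R := T / n%:R ^+ l.

(* [k u] lists the labels kappa_1(u), kappa_2(u), ..., so that kappa_i(u) is its
   entry of rank i.-1.  The argument m bounds the depth of the recursion; by
   [gridE] below, m = #|A| makes [grid] satisfy the recursive equation. *)
Fixpoint grid_rec (m l : nat) (A L : {fset word}) (k : word -> seq nat) :
    {fset R} :=
  match m with
  | 0 => [fset 0; mesh l]%fset
  | m'.+1 =>
    if (A `\` L == fset0)%fset then [fset 0; mesh l]%fset else
    ([fset (q%:R * mesh l.+1)%R | q in iota 0 n.+1] `|`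
     \bigcup_(i <- iota 1 (nsons A [::]) | [:: i] \notin L)
       [fset ((nth 0%N (k [::]) i.-1)%:R * mesh l.+1 + s)%R
         | s in grid_rec m' l.+1 (subtree i A) (subleaves i A L)
                         (fun v => k (i :: v))])%fset
  end.

Definition grid (l : nat) (A L : {fset word}) (k : word -> seq nat) :
    {fset R} :=
  grid_rec #|` A| l A L k.

End RandomGrid.

Section RandomGridTheory.
Context {R : realType} (T : R) (n : nat).

Lemma grid_rec_stable (m m' l : nat) (A L : {fset word}) k : is_tree A ->
  (#|` A| <= m)%N -> (#|` A| <= m')%N ->
  grid_rec T n m l A L k = grid_rec T n m' l A L k.
Proof.
elim: m m' l A L k => [|m IH] [|m'] l A L k tA //.
- by case: (tA) => A0 _ _ _; rewrite leqn0 cardfs_eq0 => /eqP A00; rewrite A00 in A0.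
- by case: (tA) => A0 _ _ _ _; rewrite leqn0 cardfs_eq0 => /eqP A00; rewrite A00 in A0.
move=> Am Am' /=; case: ifP => // _; congr (_ `|` _)%fset.
rewrite big_seq_cond [RHS]big_seq_cond; apply: eq_bigr => i /andP[].
rewrite (nsonsP [::] _ tA) => iA _.
have tAi := is_tree_subtree tA iA.
have [A0 _ _ _] := tA.
by rewrite (IH m')// -ltnS; apply: leq_trans (card_subtree i A0) _.
Qed.

Lemma gridE (l : nat) (A L : {fset word}) k : is_tree A ->
  grid T n l A L k =
  if (A `\` L == fset0)%fset then [fset 0; mesh T n l]%fset else
  ([fset (q%:R * mesh T n l.+1)%R | q in iota 0 n.+1] `|`
   \bigcup_(i <- iota 1 (nsons A [::]) | [:: i] \notin L)
     [fset ((nth 0%N (k [::]) i.-1)%:R * mesh T n l.+1 + s)%R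
       | s in grid T n l.+1 (subtree i A) (subleaves i A L)
                   (fun v => k (i :: v))])%fset.
Proof.
move=> tA; have [A0 _ _ _] := tA.
rewrite {1}/grid (@grid_rec_stable _ #|` A|.+1) //=.
case: ifP => // _; congr (_ `|` _)%fset.
rewrite big_seq_cond [RHS]big_seq_cond; apply: eq_bigr => i /andP[].
rewrite (nsonsP [::] _ tA) => iA _.
rewrite /grid (@grid_rec_stable _ #|` subtree i A|) //.
  exact: is_tree_subtree.
exact/ltnW/card_subtree.
Qed.

End RandomGridTheory.

Section EulerScheme.
Context {R : realType} {d : nat}.
Variables (sigma : 'I_d -> 'rV[R]_d -> 'rV[R]_d) (b : 'rV[R]_d -> 'rV[R]_d).
Variable w : 'I_d -> R -> R.

Definition euler_step (s t : R) (y : 'rV[R]_d) : 'rV[R]_d :=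
  y + \sum_(j < d) (w j t - w j s) *: sigma j y + (t - s) *: b y.

Fixpoint euler_from (s : R) (ts : seq R) (y : 'rV[R]_d) : 'rV[R]_d :=
  if ts is t :: ts' then euler_from t ts' (euler_step s t y) else y.

(* Value at the last point of the grid of the scheme started at its first
   point. *)
Definition euler (G : {fset R}) (x : 'rV[R]_d) : 'rV[R]_d :=
  if sort <=%R G is s :: ts then euler_from s ts x else x.

End EulerScheme.

(* Here w and k are the Brownian path and the labels at a given sample point. *)
Definition Upsilon {R : realType} {d : nat} (T : R) (n : nat)
    (sigma : 'I_d -> 'rV[R]_d -> 'rV[R]_d) (b : 'rV[R]_d -> 'rV[R]_d)
    (f : 'rV[R]_d -> R) (A : {fset word})
    (w : 'I_d -> R -> R) (k : word -> seq nat) (x : 'rV[R]_d) : R :=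
  \sum_(L <- fpowerset (leaves A))
    (-1) ^+ #|` L| * f (euler sigma b w (grid T n 0 A L k) x).

Definition tree_coef (n : nat) (A : {fset word}) : nat :=
  (\prod_(u <- A) 'C(n, nsons A u))%N.

Section SmoothBounded.
Context {R : realType} {d : nat} {V : normedModType R}.

Definition iter_partial (s : seq 'I_d) (g : 'rV[R]_d -> V) : 'rV[R]_d -> V :=
  foldr (fun i h => 'D_(delta_mx 0 i) h) g s.

(* s = [::] gives the continuity and the boundedness of g itself. *)
Definition smooth_bounded (g : 'rV[R]_d -> V) : Prop :=
  forall s : seq 'I_d,
    [/\ forall x i, derivable (iter_partial s g) x (delta_mx 0 i),
        continuous (iter_partial s g) &
        exists M : R, forall x, `|iter_partial s g x| <= M].

End SmoothBounded.

Section Probability.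
Context {disp : measure_display} {Omega : measurableType disp} {R : realType}.
Variable P : probability Omega R.

Definition independent_systems {I : choiceType} (D : set I)
    (F : I -> set_system Omega) : Prop :=
  forall (J : {fset I}) (E : I -> set Omega),
    [set` J] `<=` D -> (forall i, i \in J -> F i (E i)) ->
    P (\bigcap_(i in [set` J]) E i) = (\prod_(i <- J) P (E i))%E.

Definition rv_events (X : Omega -> R) : set_system Omega :=
  preimage_set_system setT X measurable.

Definition process_events (B : R -> Omega -> R) : set_system Omega :=
  <<s \bigcup_(t in [set t | 0 <= t]) rv_events (B t) >>.

Definition brownian_motion1 (B : R -> Omega -> R) : Prop :=
  [/\ forall t, 0 <= t -> measurable_fun setT (B t),
      {ae P, forall w, B 0 w = 0},
      {ae P, forall w, {within `[0, +oo[, continuous (fun t => B t w)}},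
      forall s t, 0 <= s -> s < t -> forall S : set R, measurable S ->
        P ((B t \- B s) @^-1` S) = normal_prob 0 (Num.sqrt (t - s)) S &
      forall tau : nat -> R, 0 <= tau 0%N ->
        (forall i, tau i <= tau i.+1) ->
        independent_systems [set: nat]
          (fun i => rv_events (B (tau i.+1) \- B (tau i)))].

Definition brownian_motion {d : nat} (W : 'I_d -> R -> Omega -> R) : Prop :=
  (forall j, brownian_motion1 (W j)) /\
  independent_systems [set: 'I_d] (fun j => process_events (W j)).

Definition label_set (n j : nat) : set (seq nat) :=
  [set s | size s = j /\ sorted ltn s && all (fun i => (i < n)%N) s].

(* seq nat is countable and carries its discrete sigma-algebra. *)
Definition label_events (X : Omega -> seq nat) : set_system Omega :=
  preimage_set_system setT X [set: set (seq nat)].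

(* The value at u of a labelling of A is relevant only if u is not a leaf. *)
Definition inner_nodes (A : {fset word}) : set word := [set` (A `\` leaves A)%fset].

Definition uniform_labels (n : nat) (A : {fset word})
    (kappa : word -> Omega -> seq nat) : Prop :=
  [/\ forall u, inner_nodes A u ->
        label_events (kappa u) `<=` measurable,
      forall u s, inner_nodes A u -> label_set n (nsons A u) s ->
        P (kappa u @^-1` [set s]) = ('C(n, nsons A u)%:R^-1)%:E &
      independent_systems (inner_nodes A) (fun u => label_events (kappa u))].

Definition independent_of_labels {d : nat} (W : 'I_d -> R -> Omega -> R)
    (A : {fset word}) (kappa : word -> Omega -> seq nat) : Prop :=
  forall E F : set Omega,
    <<s \bigcup_j process_events (W j) >> E ->
    <<s \bigcup_(u in inner_nodes A) label_events (kappa u) >> F ->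
    P (E `&` F) = (P E * P F)%E.

End Probability.

(* Main.v *)
Require Import Defs.
From HB Require Import structures.
From mathcomp Require Import all_boot all_order all_algebra finmap.
From mathcomp Require Import all_classical all_reals all_analysis.
From mathcomp Require Import measurable_realfun.
From mathcomp Require Import zify ring lra.

Set Implicit Arguments.
Unset Strict Implicit.
Unset Printing Implicit Defensive.

Import Order.TTheory GRing.Theory Num.Theory.
Import numFieldNormedType.Exports.

Local Open Scope classical_set_scope.
Local Open Scope ring_scope.

(** Conditionally on the labels all the grids are deterministic, so the estimate
    is proved for fixed labels, with a constant that does not depend on them, and
    then averaged.

    Fix the labels.  To each leaf u is attached an interval of length T / n^|u|;
    the intervals of distinct leaves do not overlap, and putting u into Lambda
    removes from the finest grid exactly its points strictly inside the interval
    of u ([grid_coarsen]).  Hence every scheme lives on the finest grid: the one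
    indexed by Lambda has the coefficients frozen, throughout the interval of each
    leaf of Lambda, at their values at the beginning of this interval
    ([euler_grid_scheme]).  Upsilon becomes the mixed difference D_S, with S the
    set of all leaves, of Lambda |-> f(X^Lambda_T), where D_S phi is the sum of
    (-1)^|L| phi(L) over the subsets L of S.  Each leaf u has to contribute a
    factor n^-|u|, the relative length of its interval.

    This is [scheme_moment_bound], proved by induction on the cardinality of S:
    all moments of D_S X_k are of the order of the product over u in S of n^-|u|.
    Two tools are used.  First, [mdiff_comp_split], a discrete form of the formula
    of Faa di Bruno: D_S g(X) is at most linear in D_S X, up to a polynomial in the
    lower differences D_L X, which the induction hypothesis controls, multiplied
    by the right weight.  Secondly, [one_step] and [gronwall_step], which propagate
    moments of even order along a recursion driven by centred increments that are
    independent of the past.  A step in the interval of no leaf of S is then a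
    linear recursion with a source of the right order ([scheme_momentS]).  Before
    the interval of a leaf u of S, D_S X vanishes, as u has had no effect yet.
    Inside this interval D_S X grows by differences over S without u of the
    coefficients taken between the beginning of the interval and the current time.
    These are increments of lower differences over a time at most h = T / n^|u|,
    hence smaller than lower differences by a factor sqrt h; integrating them
    against W over a time h gives the second factor sqrt h
    ([leaf_interval_moment_of_scheme]).

    The labels are averaged over the countably many values of the list of all
    labels, on each of which independence from W applies ([Upsilon_square_le]).
    Inadmissible values have probability zero because the
    admissible ones already carry the mass 1 ([invalid_label_null]).  Finally
    c(A) is at most n to the sum of |u| over the leaves, because binomial(n, j) is
    at most n^j and the sons counted by the j_u are distinct nonempty prefixes of
    leaves ([tree_coef_le]). *)

(** * Mixed differences over finite sets *)

Section MixedDifferences.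
Context {K : choiceType} {R : realType}.
Implicit Types (S L : {fset K}) (phi psi : {fset K} -> R) (u : K).

Definition mdiff S phi : R := \sum_(L <- fpowerset S) (-1) ^+ #|` L| * phi L.

Lemma mdiff0 phi : mdiff fset0 phi = phi fset0.
Proof. by rewrite /mdiff fpowerset0 big_seq_fset1 cardfs0 expr0 mul1r. Qed.

Lemma eq_mdiff S phi psi :
  (forall L, (L `<=` S)%fset -> phi L = psi L) -> mdiff S phi = mdiff S psi.
Proof.
move=> e; apply: eq_big_seq => L; rewrite fpowersetE => /e -> //.
Qed.

(** The subsets of u |` S are split according to whether they contain u.  All
    inductions on the set of directions go through this formula. *)
Lemma mdiffU1 u S phi : u \notin S ->
  mdiff (u |` S)%fset phi = mdiff S phi - mdiff S (fun L => phi (u |` L)%fset).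
Proof.
move=> uS; rewrite /mdiff.
have uL L : L \in fpowerset S -> u \notin L.
  by rewrite fpowersetE => /fsubsetP LS; apply: contra uS => /LS.
rewrite (bigID (fun L : {fset K} => u \in L)) /= addrC; congr (_ + _).
  rewrite -[LHS]big_filter; apply: perm_big; apply: uniq_perm.
  - exact/filter_uniq/fset_uniq.
  - exact/fset_uniq.
  move=> L; rewrite mem_filter !fpowersetE; apply/andP/idP => [[uL' LS]|LS].
    by apply/fsubsetP => v vL; have := fsubsetP LS _ vL; rewrite !inE; case: eqP => // vu; rewrite -vu vL in uL'.
  split; first by apply: uL; rewrite fpowersetE.
  exact: (fsubset_trans LS (fsubsetU1 _ _)).
rewrite -[LHS]big_filter (perm_big [seq (u |` L)%fset | L <- (fpowerset S : seq {fset K})]) /=; last first.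
  apply: uniq_perm; first exact/filter_uniq/fset_uniq.
    rewrite map_inj_in_uniq ?fset_uniq // => L L' /uL nL /uL nL' e.
    by rewrite -(fsetU1K nL) -(fsetU1K nL') e.
  move=> L; rewrite mem_filter fpowersetE; apply/andP/mapP => [[uL' LS]|[L' + ->]].
    exists (L `\ u)%fset; last by rewrite fsetD1K.
    by rewrite fpowersetE fsubDset.
  by rewrite fpowersetE => L'S; rewrite fset1U1 fsetUS.
rewrite big_map -sumrN; apply: eq_big_seq => L /uL nL.
by rewrite cardfsU1 nL exprS mulN1r mulNr.
Qed.

Lemma mdiffD S phi psi : mdiff S (fun L => phi L + psi L) = mdiff S phi + mdiff S psi.
Proof. by rewrite /mdiff -big_split; apply: eq_bigr => L _; rewrite mulrDr. Qed.

Lemma mdiffB S phi psi : mdiff S (fun L => phi L - psi L) = mdiff S phi - mdiff S psi.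
Proof. by rewrite /mdiff -sumrB; apply: eq_bigr => L _; rewrite mulrBr. Qed.

Lemma mdiffZ S c phi : mdiff S (fun L => c * phi L) = c * mdiff S phi.
Proof. by rewrite /mdiff big_distrr; apply: eq_bigr => L _ /=; rewrite mulrCA. Qed.

Lemma mdiff_sum (I : Type) (r : seq I) S (phi : I -> {fset K} -> R) :
  mdiff S (fun L => \sum_(i <- r) phi i L) = \sum_(i <- r) mdiff S (phi i).
Proof.
elim: r => [|i r IH].
  rewrite big_nil /mdiff big1 // => L _; by rewrite big_nil mulr0.
by rewrite big_cons -IH -mdiffD; apply: eq_mdiff => L _; rewrite big_cons.
Qed.

(** The subsets with and without u cancel in pairs. *)
Lemma mdiff_cst0 S phi u : u \in S ->
  (forall L, (L `<=` S)%fset -> u \notin L -> phi (u |` L)%fset = phi L) ->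
  mdiff S phi = 0.
Proof.
move=> uS e; rewrite -(fsetD1K uS) mdiffU1 ?fsetD11 //.
apply/eqP; rewrite subr_eq0; apply/eqP; apply: eq_mdiff => L LS.
rewrite e //; first exact: fsubset_trans LS (fsubD1set _ _).
by apply: contraTN LS => uL; apply/fsubsetPn; exists u; rewrite // fsetD11.
Qed.

Definition weight (w : K -> R) S : R := \prod_(u <- S) w u.

Lemma weightU1 w u S : u \notin S -> weight w (u |` S)%fset = w u * weight w S.
Proof. by move=> uS; rewrite /weight big_fsetU1. Qed.

Lemma weight0 w : weight w fset0 = 1. Proof. by rewrite /weight big_seq_fset0. Qed.

Lemma weight_gt0 w S : (forall u, 0 < w u) -> 0 < weight w S.
Proof. by move=> w0; apply: prodr_gt0. Qed.

Lemma cardfs_ind (P : {fset K} -> Prop) :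
  P fset0 -> (forall u S, u \notin S -> P S -> P (u |` S)%fset) -> forall S, P S.
Proof.
move=> P0 PU S; have [m] := ubnP #|` S|; elim: m S => // m IH S Sm.
have [->//|[u uS]] := fset_0Vmem S.
rewrite -(fsetD1K uS); apply: PU; first by rewrite fsetD11.
by apply: IH; move: Sm; rewrite (cardfsD1 u) uS.
Qed.

(** Leibniz rule.  In one direction, with d chi = chi - chi (u |` _),
    d(phi psi) = d phi psi + phi d psi - d phi d psi; as w u <= 1, each of the three
    terms carries at least one factor w u, whence 3 to the number of directions. *)
Lemma mdiffM_le w S phi psi (a b : R) : (forall u, 0 < w u <= 1) ->
  (forall L, (L `<=` S)%fset -> `|mdiff L phi| <= a * weight w L) ->
  (forall L, (L `<=` S)%fset -> `|mdiff L psi| <= b * weight w L) ->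
  `|mdiff S (fun L => phi L * psi L)| <= 3 ^+ #|` S| * (a * b) * weight w S.
Proof.
move=> w01; elim/cardfs_ind: S phi psi a b => [|u S uS IH] phi psi a b Ha Hb.
  rewrite mdiff0 cardfs0 expr0 mul1r weight0 mulr1 normrM.
  have := Ha fset0 (fsub0set _); have := Hb fset0 (fsub0set _).
  by rewrite !mdiff0 weight0 !mulr1 => ? ?; apply: ler_pM.
have sub L : (L `<=` S)%fset -> u \notin L.
  by move=> /fsubsetP LS; apply: contra uS => /LS.
have subS L : (L `<=` S)%fset -> (L `<=` (u |` S))%fset.
  by move=> LS; apply: fsubset_trans LS (fsubsetU1 _ _).
have w0 : 0 < w u by have /andP[] := w01 u.
have w1 : w u <= 1 by have /andP[] := w01 u.
have D (chi : {fset K} -> R) L : (L `<=` S)%fset ->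
    mdiff L (fun L => chi L - chi (u |` L)%fset) = mdiff (u |` L)%fset chi.
  by move=> LS; rewrite mdiffB mdiffU1 ?sub.
have HA (chi : {fset K} -> R) c :
   (forall L, (L `<=` (u |` S))%fset -> `|mdiff L chi| <= c * weight w L) ->
   forall L, (L `<=` S)%fset ->
   `|mdiff L (fun L => chi L - chi (u |` L)%fset)| <= (c * w u) * weight w L.
  move=> Hc L LS; rewrite D //; apply: le_trans (Hc _ _) _; first exact: fsetUS.
  by rewrite weightU1 ?sub // mulrA.
have -> : mdiff (u |` S)%fset (fun L => phi L * psi L) =
   mdiff S (fun L => (phi L - phi (u |` L)%fset) * psi L) +
   mdiff S (fun L => phi L * (psi L - psi (u |` L)%fset)) -
   mdiff S (fun L => (phi L - phi (u |` L)%fset) * (psi L - psi (u |` L)%fset)).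
  rewrite mdiffU1 // -mdiffD -!mdiffB; apply: eq_mdiff => L _; ring.
have w3 := IH _ _ _ _ (HA _ _ Ha) (HA _ _ Hb).
have w4 := IH _ _ _ _ (HA _ _ Ha) (fun L LS => Hb L (subS L LS)).
have w5 := IH _ _ _ _ (fun L LS => Ha L (subS L LS)) (HA _ _ Hb).
apply: le_trans (ler_normB _ _) _.
apply: le_trans (lerD (ler_normD _ _) (lexx _)) _.
apply: le_trans (lerD (lerD w4 w5) w3) _.
rewrite cardfsU1 uS weightU1 // exprS.
have ab0 : 0 <= a * b.
  have := Ha fset0 (fsub0set _); have := Hb fset0 (fsub0set _).
  rewrite !mdiff0 weight0 !mulr1 => h1 h2.
  by apply: mulr_ge0; [apply: le_trans h2|apply: le_trans h1].
set e := 3 ^+ _.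
have e0 : 0 <= e by rewrite exprn_ge0.
have W0 : 0 < weight w S by apply: weight_gt0 => v; have /andP[] := w01 v.
set q := e * (a * b) * weight w S * w u.
have q0 : 0 <= q.
  by rewrite /q; apply: mulr_ge0; [apply: mulr_ge0; [exact: mulr_ge0|exact: ltW]|exact: ltW].
have -> : e * (a * w u * b) * weight w S = q by rewrite /q; ring.
have -> : e * (a * (b * w u)) * weight w S = q by rewrite /q; ring.
have -> : e * (a * w u * (b * w u)) * weight w S = q * w u by rewrite /q; ring.
have -> : 3 * e * (a * b) * (w u * weight w S) = q + q + q * 1 by rewrite /q; ring.
by rewrite lerD2l ler_wpM2l.
Qed.

End MixedDifferences.

(** * Mixed differences of composed functions *)

Section PartialDerivatives.
Context {R : realType} {d : nat}.
Implicit Types (g : 'rV[R]_d -> R) (x : 'rV[R]_d).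
Local Notation e_ l := (delta_mx 0 l : 'rV[R]_d).

Lemma is_derive_along_line g x (v : 'rV[R]_d) (c t : R) :
  derivable g (x + (t * c) *: v) v ->
  is_derive t 1 (fun s : R => g (x + (s * c) *: v)) ('D_v g (x + (t * c) *: v) * c).
Proof.
move=> dg; pose h (s : R) := g (x + s *: v).
have E (s : R) : (fun r : R => r^-1 *: ((h \o shift s) (r *: 1) - h s)) =
    (fun r : R => r^-1 *: ((g \o shift (x + s *: v)) (r *: v) - g (x + s *: v))).
  apply/funext => r /=; congr (_ *: (g _ - _)).
  by rewrite [r *: 1]mulr1 scalerDl addrCA.
have dh : is_derive (t * c) 1 h ('D_v g (x + (t * c) *: v)).
  split; first by rewrite /derivable E.
  by rewrite /derive E.
have dm : is_derive t 1 (fun s : R => s * c) c.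
  apply: is_derive_eq (@is_deriveM _ _ (@id R) (cst c) t 1 1 0 _ _) _.
  by rewrite scaler0 add0r; exact: mulr1.
exact: (@is_derive1_comp R h (fun s => s * c)).
Qed.

Lemma smooth_bounded_derive g l :
  smooth_bounded g -> smooth_bounded ('D_(e_ l) g).
Proof. by move=> sg s; have := sg (rcons s l); rewrite /iter_partial foldr_rcons. Qed.

End PartialDerivatives.

Section CubeEstimate.
Context {K : choiceType} {R : realType} {d : nat}.
Implicit Types (S L : {fset K}) (g : 'rV[R]_d -> R) (x v : {fset K} -> 'rV[R]_d).
Local Notation e_ l := (delta_mx 0 l : 'rV[R]_d).

Lemma is_derive_mdiff S (phi dphi : {fset K} -> R -> R) (t : R) :
  (forall L, is_derive t 1 (phi L) (dphi L t)) ->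
  is_derive t 1 (fun s => mdiff S (phi^~ s)) (mdiff S (dphi^~ t)).
Proof.
move=> H; rewrite /mdiff; elim: (fpowerset S : seq _) => [|L s IH].
  rewrite big_nil (_ : (fun _ => _) = cst 0); first exact: is_derive_cst.
  by apply/funext => r; rewrite big_nil.
rewrite big_cons (_ : (fun _ => _) =
   ((-1) ^+ #|` L| \*: phi L) + (fun r => \sum_(j <- s) (-1) ^+ #|` j| * phi j r)).
  by apply: is_deriveD; apply: is_deriveZ.
by apply/funext => r; rewrite big_cons.
Qed.

(** The segment parameter c is chosen separately for each coordinate: when
    coordinates are moved one after the other, only partial derivatives occur. *)
Definition between x v (c : 'I_d -> R) L : 'rV[R]_d :=
  \row_i (x L 0 i + c i * v L 0 i).

(** Increment formula for mixed differences: g(x + v) - g(x) is replaced by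
    first order terms v_l d_l g at intermediate points.  The point is that the
    same intermediate parameter serves for all subsets L, so that the first order
    term is again a mixed difference, of a product of functions of L. *)
Lemma mdiff_increment_le S g x v (B : 'I_d -> R) : smooth_bounded g ->
  (forall l (c : 'I_d -> R), (forall i, 0 <= c i <= 1) ->
   `|mdiff S (fun L => v L 0 l * 'D_(e_ l) g (between x v c L))| <= B l) ->
  `|mdiff S (fun L => g (x L + v L)) - mdiff S (fun L => g (x L))| <= \sum_l B l.
Proof.
(* In F k the first k coordinates have been moved. *)
move=> sg HB; pose F k := mdiff S (fun L => g (between x v (fun i => (i < k)%N%:R) L)).
have -> : mdiff S (fun L => g (x L + v L)) = F d.
  apply: eq_mdiff => L _; congr g; apply/rowP => i.
  by rewrite !mxE ltn_ord mul1r.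
have -> : mdiff S (fun L => g (x L)) = F 0%N.
  by apply: eq_mdiff => L _; congr g; apply/rowP => i; rewrite !mxE ltn0 mul0r addr0.
rewrite -(telescope_sumr _ (leq0n d)) big_mkord.
apply: le_trans (ler_norm_sum _ _ _) _; apply: ler_sum => l _.
pose y L := between x v (fun i => (i < l)%N%:R) L.
pose phi L (s : R) := g (y L + (s * v L 0 l) *: e_ l).
pose dphi L (s : R) := 'D_(e_ l) g (y L + (s * v L 0 l) *: e_ l) * v L 0 l.
have dd L (t : R) : is_derive t 1 (phi L) (dphi L t).
  by apply: is_derive_along_line; have [Hd _ _] := sg [::]; exact: Hd.
(* The mean value theorem is applied to the alternating sum as a whole, not to
   its terms; this makes c independent of L. *)
have [||c c01] := @MVT_segment R (fun s => mdiff S (phi^~ s))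
    (fun s => mdiff S (dphi^~ s)) 0 1 ler01.
- by move=> t _; exact: is_derive_mdiff.
- apply/continuous_subspaceT => t.
  apply/differentiable_continuous/derivable1_diffP.
  by have [] := is_derive_mdiff S (fun L => dd L t).
rewrite subr0 mulr1 => E.
have -> : F l.+1 - F l = mdiff S (phi^~ 1) - mdiff S (phi^~ 0).
  congr (_ - _); apply: eq_mdiff => L _; congr g; apply/rowP => i; rewrite !mxE eqxx /=.
    rewrite mul1r ltnS leq_eqVlt -[(i == l :> nat)]/(i == l).
    by case: eqVneq => [->|_]; rewrite ?ltnn /= ?mul0r ?mulr1 ?mul1r ?addr0 ?mulr0 ?addr0.
  by rewrite !mul0r addr0.
rewrite E.
have cc : forall i : 'I_d, 0 <= (if i == l then c else (i < l)%N%:R) <= 1.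
  by move=> i; case: ifP => _; [rewrite in_itv /= in c01|case: ltnP => _; rewrite ?ler01 lexx].
apply: le_trans (HB l _ cc); rewrite le_eqVlt; apply/orP; left; apply/eqP.
congr `|_|; apply: eq_mdiff => L _; rewrite /dphi.
suff -> : y L + (c * v L 0 l) *: e_ l =
    between x v (fun i => if i == l then c else (i < l)%N%:R) L by exact: mulrC.
apply/rowP => i; rewrite !mxE eqxx /=.
by case: eqVneq => [->|_]; rewrite ?ltnn /= ?mul0r ?addr0 ?mulr1 ?mulr0 ?addr0.
Qed.

(** Differences of g o x inherit the weights of the differences of x.  By
    induction on the cardinality: a difference in the direction u turns g(x) into
    g(x + v) - g(x) with v = x(u |` _) - x, that is into terms v_l d_l g; Leibniz
    applies to them, the induction hypothesis to d_l g, and v provides the weight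
    of u.  Each step costs one factor of order 1 + M. *)
Lemma mdiff_comp_le (p : nat) g : smooth_bounded g ->
  exists2 C : R, 0 <= C & forall S x w M, (#|` S| <= p)%N ->
    (forall u, 0 < w u <= 1) -> 0 <= M ->
    (forall L, (L `<=` S)%fset -> L != fset0 ->
       forall i, `|mdiff L (fun L' => x L' 0 i)| <= M * weight w L) ->
    `|mdiff S (fun L => g (x L))| <= C * (1 + M) ^+ p * weight w S.
Proof.
elim: p g => [|p IH] g sg.
  have [_ _ [M0 HM]] := sg [::]; exists `|M0| => // S x w M.
  rewrite leqn0 cardfs_eq0 => /eqP -> w01 M_ge0 _.
  by rewrite mdiff0 expr0 mulr1 weight0 mulr1; apply: le_trans (HM _) (ler_norm _).
have [C0 C00 HC0] := IH g sg.
have HD l := cid2 (IH _ (smooth_bounded_derive l sg)).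
pose C l := s2val (HD l).
pose q : R := 3 ^+ p * 2 ^+ p.
have C_ge0 l : 0 <= C l by exact: (s2valP (HD l)).
exists (C0 + q * \sum_l C l).
  by rewrite addr_ge0 // mulr_ge0 ?sumr_ge0 // /q mulr_ge0 // exprn_ge0.
move=> S x w M Sp w01 M0 Hx.
have M1 : 1 <= 1 + M by rewrite lerDl.
have M10 : 0 <= 1 + M by rewrite addr_ge0.
have W0 : 0 < weight w S by apply: weight_gt0 => v; have /andP[] := w01 v.
have qC0 : 0 <= q * \sum_l C l.
  by rewrite mulr_ge0 ?sumr_ge0 // /q mulr_ge0 // exprn_ge0.
have [S0|[u uS]] := fset_0Vmem S.
  have Sp' : (#|` S| <= p)%N by rewrite S0 cardfs0.
  apply: le_trans (HC0 S x w M Sp' w01 M0 Hx) _.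
  apply: ler_wpM2r; first exact: ltW.
  rewrite exprS mulrCA mulrA; apply: ler_wpM2r; first by rewrite exprn_ge0.
  rewrite -[leLHS]mul1r; apply: ler_pM => //; by rewrite lerDl.
move: Sp Hx W0; rewrite -(fsetD1K uS); set S0 := (S `\ u)%fset => Sp Hx W0.
have uS0 : u \notin S0 by rewrite fsetD11.
have sub L : (L `<=` S0)%fset -> u \notin L.
  by move=> /fsubsetP LS; apply: contra uS0 => /LS.
have S0p : (#|` S0| <= p)%N by move: Sp; rewrite cardfsU1 uS0.
pose v L := x (u |` L)%fset - x L.
have -> : mdiff (u |` S0)%fset (fun L => g (x L)) =
    - (mdiff S0 (fun L => g (x L + v L)) - mdiff S0 (fun L => g (x L))).
  rewrite mdiffU1 // opprB; congr (_ - _); apply: eq_mdiff => L _.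
  by rewrite /v addrCA subrr addr0.
rewrite normrN weightU1 //.
have w0 : 0 < w u by have /andP[] := w01 u.
have w1 : w u <= 1 by have /andP[] := w01 u.
have WS0 : 0 < weight w S0 by apply: weight_gt0 => z; have /andP[] := w01 z.
have dv i L : (L `<=` S0)%fset -> `|mdiff L (fun L => v L 0 i)| <= M * w u * weight w L.
  move=> LS.
  rewrite (@eq_mdiff _ _ _ _ (fun L => x (u |` L)%fset 0 i - x L 0 i)); last first.
    by move=> L' _; rewrite !mxE.
  rewrite mdiffB -opprB normrN -mdiffU1 ?sub // -mulrA -weightU1 ?sub //.
  by apply: Hx; rewrite ?fsetUS //; apply/fset0Pn; exists u; rewrite fset1U1.
apply: le_trans (@mdiff_increment_le S0 g x v
  (fun l => 3 ^+ p * ((M * w u) * (C l * (1 + 2 * M) ^+ p)) * weight w S0) sg _) _.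
  move=> l c c01.
  have HCl := s2valP' (HD l).
  apply: le_trans (@mdiffM_le _ _ w S0 _ _ (M * w u) (C l * (1 + 2 * M) ^+ p) w01 _ _) _.
  - by move=> L LS; exact: dv.
  - move=> L LS.
    have Lp : (#|` L| <= p)%N by apply: leq_trans (fsubset_leq_card LS) S0p.
    apply: HCl => //; first by rewrite mulr_ge0.
    move=> L' L'L L'0 i.
    rewrite (@eq_mdiff _ _ _ _ (fun L => x L 0 i + c i * v L 0 i)); last first.
      by move=> L'' _; rewrite mxE.
    have L'S0 := fsubset_trans L'L LS.
    rewrite mdiffD mdiffZ; apply: le_trans (ler_normD _ _) _.
    (* Intermediate points between x and x + v satisfy the hypothesis with 2 M. *)
    rewrite mulr2n !mulrDl !mul1r; apply: lerD.
      by apply: Hx => //; apply: fsubset_trans L'S0 (fsubsetU1 _ _).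
    rewrite normrM; have /andP[c0 c1] := c01 i; rewrite ger0_norm //.
    apply: le_trans (ler_piMl _ c1) _ => //.
    apply: le_trans (dv _ _ L'S0) _.
    apply: ler_wpM2r; first by apply/ltW/weight_gt0 => z; have /andP[] := w01 z.
    by rewrite ler_piMr.
  - apply: ler_wpM2r; first exact: ltW.
    apply: ler_wpM2r; last by apply: ler_weXn2l => //; rewrite ler1n.
    by rewrite !mulr_ge0 ?exprn_ge0 ?addr_ge0 ?mulr_ge0 // ltW.
rewrite -mulr_suml -mulr_sumr -mulr_sumr -mulr_suml.
have -> : 3 ^+ p * (M * w u * ((\sum_i C i) * (1 + 2 * M) ^+ p)) * weight w S0 =
  (3 ^+ p * (\sum_i C i) * (M * (1 + 2 * M) ^+ p)) * (w u * weight w S0) by ring.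
apply: ler_wpM2r; first by rewrite mulr_ge0 // ltW.
have sC : 0 <= \sum_i C i by rewrite sumr_ge0.
apply: (@le_trans _ _ (3 ^+ p * (\sum_i C i) * (2 ^+ p * (1 + M) ^+ p.+1))).
  apply: ler_wpM2l; first by rewrite mulr_ge0 ?exprn_ge0.
  rewrite exprS mulrCA -exprMn; apply: ler_pM => //.
  - by rewrite exprn_ge0 // addr_ge0 // mulr_ge0.
  - by rewrite lerDr.
  - by rewrite lerXn2r ?nnegrE ?mulr_ge0 ?addr_ge0 ?mulr_ge0 // mulrDr lerD2r mulr1 ler1n.
have -> : 3 ^+ p * (\sum_i C i) * (2 ^+ p * (1 + M) ^+ p.+1) =
  (q * \sum_i C i) * (1 + M) ^+ p.+1 by rewrite /q; ring.
by apply: ler_wpM2r; rewrite ?exprn_ge0 // lerDr.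
Qed.

End CubeEstimate.

(** * Powers of sums *)

Section PowersOfSums.
Context {R : realType}.

(** B is the maximum of a0 and of the a i; its m-th power is one of the powers on
    the right-hand side, which is the whole content of the power inequalities below. *)
Lemma dominating_value (I : Type) (s : seq I) (Q : pred I) (a : I -> R) (a0 : R) (m : nat) :
  0 <= a0 -> (forall i, 0 <= a i) ->
  exists B, [/\ a0 <= B, a0 + \sum_(i <- s | Q i) a i <= (size s).+1%:R * B &
    B ^+ m <= a0 ^+ m + \sum_(i <- s | Q i) a i ^+ m].
Proof.
move=> a00 ai0; elim: s => [|i s [B [B1 B2 B3]]].
  by exists a0; split; rewrite ?big_nil ?addr0 ?mul1r.
have B0 : 0 <= B by exact: le_trans B1.
rewrite !big_cons; case: (Q i); last first.
  exists B; split=> //=; apply: le_trans B2 _; apply: ler_wpM2r => //.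
  by rewrite ler_nat.
have am0 : 0 <= a i ^+ m by rewrite exprn_ge0.
have s0 : 0 <= \sum_(i <- s | Q i) a i ^+ m by rewrite sumr_ge0 // => j _; rewrite exprn_ge0.
have a0m : 0 <= a0 ^+ m by rewrite exprn_ge0.
have E y : (size s).+2%:R * y = (size s).+1%:R * y + y :> R by rewrite -natr1 mulrDl mul1r.
have [aB|/ltW Ba] := leP (a i) B; [exists B | exists (a i)]; split=> //.
- by rewrite /= E addrCA addrC; apply: lerD.
- by rewrite addrCA; apply: ler_wpDl.
- by apply: le_trans Ba.
- rewrite /= E addrCA addrC; apply: lerD => //; apply: le_trans B2 _.
  by apply: ler_wpM2l.
- by rewrite addrCA lerDl addr_ge0.
Qed.

Lemma expr_sum_le (I : Type) (s : seq I) (Q : pred I) (a : I -> R) (a0 : R) (m : nat) :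
  0 <= a0 -> (forall i, 0 <= a i) ->
  (a0 + \sum_(i <- s | Q i) a i) ^+ m <=
    (size s).+1%:R ^+ m * (a0 ^+ m + \sum_(i <- s | Q i) a i ^+ m).
Proof.
move=> a00 ai0; have [B [B1 B2 B3]] := dominating_value s Q m a00 ai0.
have B0 : 0 <= B by exact: le_trans B1.
apply: le_trans (_ : ((size s).+1%:R * B) ^+ m <= _).
  by apply: lerXn2r; rewrite ?nnegrE ?addr_ge0 ?sumr_ge0 ?mulr_ge0.
by rewrite exprMn; apply: ler_wpM2l => //; rewrite exprn_ge0.
Qed.

Lemma expr_even_sum_le (I : Type) (s : seq I) (a : I -> R) (a0 : R) (r : nat) :
  (a0 + \sum_(i <- s) a i) ^+ (2 * r) <=
    (size s).+1%:R ^+ (2 * r) * (a0 ^+ (2 * r) + \sum_(i <- s) a i ^+ (2 * r)).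
Proof.
have N (y : R) : y ^+ (2 * r) = `|y| ^+ (2 * r).
  by rewrite !exprM real_normK ?num_real.
rewrite N (N a0); under [in leRHS]eq_bigr do rewrite N.
apply: le_trans (@expr_sum_le _ s xpredT (fun i => `|a i|) `|a0| (2 * r) _ _) => //.
apply: lerXn2r; rewrite ?nnegrE ?addr_ge0 ?sumr_ge0 //.
by apply: le_trans (ler_normD _ _) _; rewrite lerD2l ler_norm_sum.
Qed.

End PowersOfSums.

(** * Isolating the top difference *)

Section SplitCubeEstimate.
Context {K : choiceType} {R : realType} {d : nat}.
Implicit Types (S L : {fset K}) (g : 'rV[R]_d -> R) (x v : {fset K} -> 'rV[R]_d).
Local Notation e_ l := (delta_mx 0 l : 'rV[R]_d).

(** The increment formula over the empty set of directions is the usual mean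
    value inequality. *)
Lemma smooth_bounded_lipschitz g : smooth_bounded g ->
  exists2 C : R, 0 <= C & forall y z, `|g (y + z) - g y| <= C * \sum_i `|z 0 i|.
Proof.
move=> sg.
have bd l : exists M : R, forall y, `|'D_(e_ l) g y| <= M.
  by have [_ _] := sg [:: l].
have HM l := cid (bd l); pose C : R := \sum_l `|sval (HM l)|.
exists C => [|y z]; first by rewrite sumr_ge0.
have := @mdiff_increment_le K R d fset0 g (fun=> y) (fun=> z) (fun l => C * `|z 0 l|) sg.
rewrite !mdiff0 mulr_sumr; apply => l c c01; rewrite mdiff0 mulrC normrM.
apply: ler_wpM2r => //; apply: le_trans (svalP (HM l) _) _.
apply: le_trans (ler_norm _) _.
by rewrite /C (bigD1 l) //= lerDl sumr_ge0.
Qed.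

Lemma mdiff_point S c : mdiff S (fun L => if L == S then c else 0) = (-1) ^+ #|` S| * c :> R.
Proof.
rewrite /mdiff (big_fsetD1 S) ?fpowersetE //= eqxx big1_seq ?addr0 //= => L.
by rewrite !inE => /andP[/negbTE -> _]; rewrite mulr0.
Qed.

(** The top difference D_S x has a special status in the induction on schemes: it
    is the unknown of a linear recursion, so that it may enter only to the first
    degree, while lower differences may enter to any degree.  To achieve this, the
    point x S is moved so as to cancel D_S x; [mdiff_comp_le] then involves lower
    differences only, and the move, of size |D_S x|, is paid for by the Lipschitz
    constant of g. *)
Lemma mdiff_comp_split (p r : nat) g : (0 < r)%N -> smooth_bounded g ->
  exists2 C : R, 0 <= C & forall S x w, (#|` S| <= p)%N ->
    (forall u, 0 < w u <= 1) ->
    mdiff S (fun L => g (x L)) ^+ (2 * r) <=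
    C * (\sum_i mdiff S (fun L => x L 0 i) ^+ (2 * r) +
      weight w S ^+ (2 * r) * (1 + \sum_(L <- fpowerset S | (L != fset0) && (L != S))
         \sum_i (mdiff L (fun L' => x L' 0 i) / weight w L) ^+ (2 * (r * p)))).
Proof.
move=> r0 sg.
have [C1 C10 HC1] := @mdiff_comp_le K R d p g sg.
have [C2 C20 HC2] := smooth_bounded_lipschitz sg.
pose c1 : R := 2 ^+ (2 * r) * (C1 ^+ (2 * r) * (2 ^ p * d).+1%:R ^+ (2 * (r * p))).
pose c2 : R := 2 ^+ (2 * r) * (C2 ^+ (2 * r) * d.+1%:R ^+ (2 * r)).
have c10 : 0 <= c1 by rewrite !mulr_ge0 ?exprn_ge0.
have c20 : 0 <= c2 by rewrite !mulr_ge0 ?exprn_ge0.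
exists (c1 + c2) => [|S x w Sp w01]; first exact: addr_ge0.
have W0 L : 0 < weight w L by apply: weight_gt0 => v; have /andP[] := w01 v.
have Xabs (y : R) m : y ^+ (2 * m) = `|y| ^+ (2 * m).
  by rewrite !exprM real_normK ?num_real.
pose Q := fun L : {fset K} => (L != fset0) && (L != S).
pose a (q : {fset K} * 'I_d) := `|mdiff q.1 (fun L' => x L' 0 q.2) / weight w q.1|.
pose pairs := [seq (L, i) | L <- [seq L <- (fpowerset S : seq {fset K}) | Q L], i <- enum 'I_d].
have a0 q : 0 <= a q by rewrite /a.
(* A sum rather than a maximum, since its powers are bounded by sums of powers. *)
pose M := \sum_(q <- pairs) a q.
have M0 : 0 <= M by rewrite /M sumr_ge0.
have Ma q : q \in pairs -> a q <= M.
  by move=> qp; rewrite /M (big_rem q) //= lerDl sumr_ge0.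
have sizeP : (size pairs <= 2 ^ p * d)%N.
  rewrite size_allpairs size_enum_ord; apply: leq_mul => //.
  rewrite size_filter (leq_trans (count_size _ _)) //.
  by rewrite card_fpowerset leq_exp2l.
pose N := 1 + \sum_(L <- fpowerset S | Q L)
         \sum_i (mdiff L (fun L' => x L' 0 i) / weight w L) ^+ (2 * (r * p)).
have EM : (1 + M) ^+ (2 * (r * p)) <= (2 ^ p * d).+1%:R ^+ (2 * (r * p)) * N.
  apply: le_trans (expr_sum_le pairs xpredT (2 * (r * p)) ler01 a0) _.
  rewrite expr1n big_allpairs big_filter.
  under eq_bigr do (rewrite big_enum /=; under eq_bigr do rewrite -Xabs).
  apply: ler_wpM2r.
    rewrite addr_ge0 // sumr_ge0 // => L _; rewrite sumr_ge0 // => i _.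
    by rewrite exprM exprn_ge0 // sqr_ge0.
  by apply: lerXn2r; rewrite ?nnegrE // ler_nat ltnS.
pose dS : 'rV[R]_d := \row_i mdiff S (fun L => x L 0 i).
(* The sign is the one with which the vertex S enters D_S. *)
pose x' L := if L == S then x S - (-1) ^+ #|` S| *: dS else x L.
have E1 : mdiff S (fun L => g (x L)) =
    mdiff S (fun L => g (x' L)) + (-1) ^+ #|` S| * (g (x S) - g (x' S)).
  rewrite -mdiff_point -mdiffD; apply: eq_mdiff => L _; rewrite /x'.
  by case: eqVneq => [->|_]; rewrite ?eqxx ?addr0 // addrC subrK.
have E2 : `|mdiff S (fun L => g (x' L))| <= C1 * (1 + M) ^+ p * weight w S.
  apply: HC1 => // L LS L0 i; have [->|nLS] := eqVneq L S.
    rewrite (@eq_mdiff _ _ _ _ (fun L => x L 0 i -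
       (if L == S then (-1) ^+ #|` S| * dS 0 i else 0))); last first.
      by move=> L' _; rewrite /x'; case: eqVneq => [->|_]; rewrite ?subr0 // !mxE.
    rewrite mdiffB mdiff_point mulrA -expr2 sqrr_sign mul1r mxE subrr normr0.
    by rewrite mulr_ge0 // ltW.
  rewrite (@eq_mdiff _ _ _ _ (fun L => x L 0 i)); last first.
    move=> L' L'L; rewrite /x'; case: eqVneq => // L'S; rewrite L'S in L'L.
    by move: nLS; rewrite eqEfsubset LS L'L.
  rewrite -ler_pdivrMr // -(gtr0_norm (W0 L)) -normf_div.
  apply: (Ma (L, i)); apply/allpairsP; exists (L, i); split => //=.
    by rewrite mem_filter /Q L0 nLS fpowersetE.
  by rewrite mem_enum.
have E3 : `|g (x S) - g (x' S)| <= C2 * \sum_i `|mdiff S (fun L => x L 0 i)|.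
  rewrite distrC /x' eqxx; apply: le_trans (HC2 _ _) _.
  apply: ler_wpM2l => //; apply: ler_sum => i _.
  by rewrite !mxE normrN normrM normrX normrN1 expr1n mul1r.
rewrite Xabs E1.
apply: le_trans (_ : (C1 * (1 + M) ^+ p * weight w S +
   \sum_(t <- [:: tt]) (C2 * \sum_i `|mdiff S (fun L => x L 0 i)|)) ^+ (2 * r) <= _).
  apply: lerXn2r; rewrite ?nnegrE //.
    rewrite addr_ge0 ?mulr_ge0 ?sumr_ge0 ?exprn_ge0 ?addr_ge0 ?(ltW (W0 _)) //.
    by move=> _ _; rewrite mulr_ge0 ?sumr_ge0.
  apply: le_trans (ler_normD _ _) _; apply: lerD => //.
  by rewrite big_seq1 normrM normrX normrN1 expr1n mul1r.
apply: le_trans (expr_sum_le _ _ _ _ _) _.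
- by rewrite !mulr_ge0 ?exprn_ge0 ?addr_ge0 ?(ltW (W0 _)).
- by move=> _; rewrite mulr_ge0 ?sumr_ge0.
rewrite big_seq1 /= !exprMn -exprM (mulnC p) -mulnA.
rewrite -/N.
set s0 := \sum_i mdiff _ _ ^+ _.
have s00 : 0 <= s0.
  by apply: sumr_ge0 => i _; rewrite exprM exprn_ge0 // sqr_ge0.
have N0 : 0 <= N.
  rewrite addr_ge0 // sumr_ge0 // => L _; rewrite sumr_ge0 // => i _.
  by rewrite exprM exprn_ge0 // sqr_ge0.
have W20 : 0 <= weight w S ^+ (2 * r) by rewrite exprn_ge0 // ltW.
have E4 : (\sum_i `|mdiff S (fun L => x L 0 i)|) ^+ (2 * r) <= d.+1%:R ^+ (2 * r) * s0.
  have := @expr_sum_le R _ (index_enum 'I_d) xpredT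
     (fun i => `|mdiff S (fun L => x L 0 i)|) 0 (2 * r) (lexx _).
  rewrite add0r expr0n muln_eq0 (gtn_eqF r0) /= add0r => /(_ (fun=> normr_ge0 _)).
  rewrite /index_enum -enumT size_enum_ord enumT => /le_trans; apply.
  by apply: ler_wpM2l; rewrite ?exprn_ge0 //; apply: ler_sum => i _; rewrite -Xabs.
apply: (@le_trans _ _ (c1 * (weight w S ^+ (2 * r) * N) + c2 * s0)).
  rewrite mulrDr; apply: lerD; rewrite /c1 /c2.
    rewrite -!mulrA; apply: ler_wpM2l; first by rewrite exprn_ge0.
    apply: ler_wpM2l; first by rewrite exprn_ge0.
    by rewrite mulrC mulrCA; apply: ler_wpM2l.
  rewrite -!mulrA; apply: ler_wpM2l; first by rewrite exprn_ge0.
  by apply: ler_wpM2l; first by rewrite exprn_ge0.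
have : 0 <= c1 * s0 by exact: mulr_ge0.
have : 0 <= c2 * (weight w S ^+ (2 * r) * N) by apply: mulr_ge0 => //; exact: mulr_ge0.
by rewrite mulrDr !mulrDl => ? ?; lra.
Qed.

End SplitCubeEstimate.

(** * Centred Gaussian laws *)

Section CenteredGaussian.
Context {R : realType}.
Local Open Scope ereal_scope.
Local Notation mu := (@lebesgue_measure R).

Lemma lebesgue_measure_opp (A : set (measurableTypeR R)) : measurable A ->
  mu (-%R @^-1` A) = mu A.
Proof.
move=> mA; apply/esym.
pose nu := pushforward mu (-%R : measurableTypeR R -> measurableTypeR R).
have mN : measurable_fun setT (-%R : measurableTypeR R -> measurableTypeR R).
  exact: oppr_measurable.
pose opp : {mfun (measurableTypeR R) >-> (measurableTypeR R)} :=
   HB.pack (-%R : measurableTypeR R -> measurableTypeR R) (isMeasurableFun.Build _ _ _ _ _ mN).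
have -> : mu (-%R @^-1` A) = pushforward mu opp A by [].
apply: (@lebesgue_measure_unique R (pushforward mu opp)) => // X [[a b] _ <-].
rewrite /pushforward /=.
rewrite [X in _ = mu X](_ : _ = [set` `[- b, - a[%R]); last first.
  apply/seteqP; split => x /=; rewrite !in_itv /= => /andP[h1 h2]; apply/andP; split; lra.
rewrite !lebesgue_measure_itv /= !lte_fin ltrN2.
by case: ifP => // _; rewrite -!EFinD; congr _%:E; lra.
Qed.

Lemma ge0_integral_normal (s : R) (f : R -> \bar R) : (forall x, 0 <= f x) ->
  measurable_fun setT f ->
  \int[normal_prob 0 s]_x f x = \int[mu]_x (f x * (normal_pdf 0 s x)%:E).
Proof.
move=> f0 mf.
have dom := @normal_prob_dominates R 0 s.
rewrite -(Radon_Nikodym_SigmaFinite.change_of_variables dom f0 measurableT mf).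
have mpdf : measurable_fun setT (fun x => (normal_pdf 0 s x)%:E).
  by apply/measurable_EFinP; exact: measurable_normal_pdf.
apply: ae_eq_integral => //.
- apply: emeasurable_funM => //.
  exact: measurable_int (Radon_Nikodym_SigmaFinite.f_integrable dom).
- exact: emeasurable_funM.
apply: ae_eqe_mul2l => /=; apply: integral_ae_eq => //.
  exact: (Radon_Nikodym_SigmaFinite.f_integrable dom).
by move=> E _ mE; rewrite -(Radon_Nikodym_SigmaFinite.f_integral dom) //.
Qed.

(** The symmetry of the law is what makes increments centred: it replaces the
    computation of a mean. *)
Lemma normal_prob_opp (s : R) (A : set R) : (s != 0)%R -> measurable A ->
  normal_prob 0 s (-%R @^-1` A) = normal_prob 0 s A.
Proof.
move=> s0 mA.
have mN : measurable_fun setT (-%R : measurableTypeR R -> measurableTypeR R).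
  exact: oppr_measurable.
have mpdf : measurable_fun setT (fun x => (normal_pdf 0 s x)%:E).
  by apply/measurable_EFinP; exact: measurable_normal_pdf.
pose opp : {mfun (measurableTypeR R) >-> (measurableTypeR R)} :=
   HB.pack (-%R : measurableTypeR R -> measurableTypeR R) (isMeasurableFun.Build _ _ _ _ _ mN).
rewrite /normal_prob [RHS](_ : _ = \int[pushforward mu opp]_(x in A) (normal_pdf 0 s x)%:E); last first.
  by apply: eq_measure_integral => B mB _; first [exact: lebesgue_measure_opp|apply/esym; exact: lebesgue_measure_opp].
rewrite (ge0_integral_pushforward mN mu mA (measurable_funTS mpdf)); last first.
  by move=> x _; rewrite lee_fin normal_pdf_ge0.
apply: eq_integral => x _ /=; congr _%:E.
by rewrite normal_pdfE // /normal_fun !subr0 sqrrN.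
Qed.

Definition gauss_const (m : nat) : R := (m%:R ^+ m * 4 ^+ m * Num.sqrt 2)%R.

(** With y = x^2 / 4 s^2 one has x^(2m) = (4 s^2)^m y^m <= (4 s^2)^m m^m e^y, and
    e^y times the density of standard deviation s is sqrt 2 times the density of
    standard deviation sqrt 2 s. *)
Lemma normal_even_moment (s : R) (m : nat) : (0 < s)%R ->
  \int[normal_prob 0 s]_x (x ^+ (2 * m))%:E <= (gauss_const m * s ^+ (2 * m))%:E.
Proof.
move=> s0; rewrite ge0_integral_normal; last 2 first.
- by move=> x; rewrite lee_fin exprM exprn_ge0 // sqr_ge0.
- apply/measurable_EFinP; exact: measurable_funX.
pose s2 := (Num.sqrt 2 * s)%R.
have s20 : (0 < s2)%R by rewrite mulr_gt0 // sqrtr_gt0.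
have C0 : (0 <= gauss_const m * s ^+ (2 * m))%R.
  by rewrite !mulr_ge0 ?exprn_ge0 // ltW.
have mpdf t : measurable_fun setT (fun x : R => (normal_pdf 0 t x)%:E).
  by apply/measurable_EFinP; exact: measurable_normal_pdf.
have mX : measurable_fun setT (fun x : R => (x ^+ (2 * m))%:E).
  by apply/measurable_EFinP; exact: exprn_measurable.
apply: (@le_trans _ _ (\int[mu]_x ((gauss_const m * s ^+ (2 * m))%:E * (normal_pdf 0 s2 x)%:E))); last first.
  rewrite ge0_integralZl //.
  - by rewrite integral_normal_pdf mule1.
  - exact: mpdf.
  - by move=> x _; rewrite lee_fin normal_pdf_ge0.
apply: ge0_le_integral => //.
- move=> x _; apply: mule_ge0; last by rewrite lee_fin normal_pdf_ge0.
  by rewrite lee_fin exprM exprn_ge0 // sqr_ge0.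
- exact: (emeasurable_funM mX (mpdf s)).
- exact: (emeasurable_funM (measurable_cst _) (mpdf s2)).
move=> x _; rewrite -!EFinM lee_fin !normal_pdfE ?gt_eqF // /normal_fun !subr0.
have sqrt2 : (Num.sqrt 2 ^+ 2 = 2 :> R)%R by rewrite sqr_sqrtr.
set y := (x ^+ 2 / (4 * s ^+ 2))%R.
have y0 : (0 <= y)%R by rewrite divr_ge0 ?sqr_ge0 // mulr_ge0 // sqr_ge0.
have E1 : (- x ^+ 2 / (s2 ^+ 2 *+ 2) = - y)%R.
  by rewrite /s2 exprMn sqrt2 /y; field; rewrite gt_eqF.
have E2 : (- x ^+ 2 / (s ^+ 2 *+ 2) = - y - y)%R.
  by rewrite /y; field; rewrite gt_eqF.
rewrite E1 E2 expRD.
have E3 : normal_peak s = (Num.sqrt 2 * normal_peak s2)%R.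
  rewrite /normal_peak (_ : s2 ^+ 2 * pi *+ 2 = 2 * (s ^+ 2 * pi *+ 2))%R; last first.
    by rewrite /s2 exprMn sqrt2; ring.
  rewrite (sqrtrM (s ^+ 2 * pi *+ 2)%R) // invfM mulrA mulfV ?mul1r //.
have E4 : (x ^+ (2 * m) <= m%:R ^+ m * 4 ^+ m * s ^+ (2 * m) * expR y)%R.
  have -> : (x ^+ (2 * m) = 4 ^+ m * s ^+ (2 * m) * y ^+ m)%R.
    by rewrite !exprM -!exprMn; congr (_ ^+ _)%R; rewrite /y; field; rewrite gt_eqF.
  rewrite [leRHS](_ : _ = 4 ^+ m * s ^+ (2 * m) * (m%:R ^+ m * expR y))%R; last by ring.
  apply: ler_wpM2l; first by rewrite mulr_ge0 ?exprn_ge0 // ltW.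
  have [->|m0] := posnP m.
    by rewrite !expr0 mul1r -expR0 ler_expR.
  have {2}-> : (y = m%:R * (y / m%:R))%R by field; rewrite pnatr_eq0 -lt0n.
  (* y^m <= m^m e^y is the m-th power of y <= m e^(y/m). *)
  rewrite expRM_natl -exprMn; apply: lerXn2r; [exact: y0|by rewrite nnegrE mulr_ge0 ?expR_ge0|].
  have h := expR_ge1Dx (y / m%:R).
  have : (m%:R * (1 + y / m%:R) <= m%:R * expR (y / m%:R))%R by apply: ler_wpM2l.
  rewrite mulrDr mulr1 mulrCA mulfV ?pnatr_eq0 -?lt0n // mulr1.
  by move=> h2; apply: le_trans h2; rewrite lerDr.
rewrite E3 /gauss_const.
set p := normal_peak s2; have p0 : (0 <= p)%R by exact: normal_peak_ge0.
have eN : (expR y * expR (- y) = 1)%R by rewrite -expRD subrr expR0.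
set ex := expR (- y); have ex0 : (0 <= ex)%R by exact: expR_ge0.
have Q0 : (0 <= Num.sqrt 2 * p * (ex * ex))%R by rewrite !mulr_ge0.
apply: le_trans (ler_wpM2r Q0 E4) _.
rewrite le_eqVlt; apply/orP; left; apply/eqP.
transitivity (m%:R ^+ m * 4 ^+ m * s ^+ (2 * m) * Num.sqrt 2 * p * ex * (expR y * ex))%R; first by ring.
by rewrite eN; ring.
Qed.

End CenteredGaussian.

(** * Random variables with moments of all orders *)

Section Moments.
Context {disp : measure_display} {Omega : measurableType disp} {R : realType}.
Variable P : probability Omega R.
Implicit Types X Y Z : Omega -> R.

(** Even powers dominate all powers of the absolute value and are polynomial. *)
Definition has_moments X := measurable_fun setT X /\
  forall m, P.-integrable setT (fun w => (X w ^+ (2 * m))%:E).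

Definition expect X : R := Rintegral P setT X.

Lemma even_pow_ge0 (y : R) m : 0 <= y ^+ (2 * m).
Proof. by rewrite exprM exprn_ge0 // sqr_ge0. Qed.

Lemma even_pow_norm (y : R) m : `|y ^+ (2 * m)| = y ^+ (2 * m).
Proof. by rewrite ger0_norm // even_pow_ge0. Qed.

Lemma integrable_dominated X Z : measurable_fun setT X ->
  P.-integrable setT (fun w => (Z w)%:E) -> (forall w, `|X w| <= Z w) ->
  P.-integrable setT (fun w => (X w)%:E).
Proof.
move=> mX iZ XZ; apply: le_integrable iZ => //; first exact/measurable_EFinP.
move=> w _ /=; rewrite lee_fin; apply: le_trans (XZ w) (ler_norm _).
Qed.

Lemma integrable_lin (a b : R) X Y :
  P.-integrable setT (fun w => (X w)%:E) -> P.-integrable setT (fun w => (Y w)%:E) ->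
  P.-integrable setT (fun w => (a * X w + b * Y w)%:E).
Proof.
move=> iX iY.
have := integrableD measurableT (integrableZl measurableT a iX) (integrableZl measurableT b iY).
by apply: eq_integrable => // w _; rewrite /= EFinD !EFinM.
Qed.

Lemma integrable_cst_prob (c : R) : P.-integrable setT (fun=> c%:E).
Proof. exact: finite_measure_integrable_cst. Qed.

Lemma mom_measurable X : has_moments X -> measurable_fun setT X. Proof. by case. Qed.

Lemma mom_integrable X : has_moments X -> P.-integrable setT (fun w => (X w)%:E).
Proof.
move=> [mX iX].
apply: (@integrable_dominated _ (fun w => 1 * 1 + 1 * X w ^+ (2 * 1))) => //.
  by apply: integrable_lin => //; exact: integrable_cst_prob.
move=> w; rewrite !mul1r muln1.
have := sqr_ge0 (`|X w| - 1); rewrite sqrrB1 real_normK ?num_real // => h.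
have := normr_ge0 (X w) => h2.
rewrite -(real_normK (num_real (X w))) in h *; nra.
Qed.

Lemma mom_cst c : has_moments (cst c).
Proof.
split; first exact: measurable_cst.
by move=> m; exact: (integrable_cst_prob (c ^+ (2 * m))).
Qed.

Lemma momD X Y : has_moments X -> has_moments Y -> has_moments (fun w => X w + Y w).
Proof.
move=> [mX iX] [mY iY]; split; first exact: measurable_funD.
move=> m; pose c : R := 2%:R ^+ (2 * m).
apply: (@integrable_dominated _ (fun w => c * X w ^+ (2 * m) + c * Y w ^+ (2 * m))).
- by apply: measurable_funX; exact: measurable_funD.
- by apply: integrable_lin.
move=> w; rewrite even_pow_norm -mulrDr.
by have := expr_even_sum_le [:: tt] (fun=> Y w) (X w) m; rewrite !big_seq1.
Qed.

Lemma momM X Y : has_moments X -> has_moments Y -> has_moments (fun w => X w * Y w).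
Proof.
move=> [mX iX] [mY iY]; split; first exact: measurable_funM.
move=> m.
apply: (@integrable_dominated _ (fun w => 1 * X w ^+ (2 * (2 * m)) + 1 * Y w ^+ (2 * (2 * m)))).
- by apply: measurable_funX; exact: measurable_funM.
- by apply: integrable_lin.
move=> w; rewrite even_pow_norm !mul1r exprMn !(mulnC 2 (2 * m)) !(exprM _ (2 * m) 2).
have := sqr_ge0 (X w ^+ (2 * m) - Y w ^+ (2 * m)).
have := even_pow_ge0 (X w) m; have := even_pow_ge0 (Y w) m; nra.
Qed.

Lemma momZ c X : has_moments X -> has_moments (fun w => c * X w).
Proof. by move=> mX; apply: momM mX; exact: mom_cst. Qed.

Lemma momB X Y : has_moments X -> has_moments Y -> has_moments (fun w => X w - Y w).
Proof.
move=> mX mY; have -> : (fun w => X w - Y w) = (fun w => X w + -1 * Y w).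
  by apply/funext => w; rewrite mulN1r.
exact: momD mX (momZ (-1) mY).
Qed.

Lemma momX X k : has_moments X -> has_moments (fun w => X w ^+ k).
Proof.
move=> mX; elim: k => [|k IH].
  by rewrite (_ : (fun _ => _) = cst 1); [exact: mom_cst|apply/funext => w; rewrite expr0].
rewrite (_ : (fun _ => _) = (fun w => X w * X w ^+ k)); first exact: momM.
by apply/funext => w; rewrite exprS.
Qed.

Lemma mom_sum (I : Type) (s : seq I) (Q : pred I) (X : I -> Omega -> R) :
  (forall i, has_moments (X i)) -> has_moments (fun w => \sum_(i <- s | Q i) X i w).
Proof.
move=> mX; elim: s => [|i s IH].
  by rewrite (_ : (fun _ => _) = cst 0); [exact: mom_cst|apply/funext => w; rewrite big_nil].
have -> : (fun w => \sum_(j <- i :: s | Q j) X j w) =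
  (fun w => if Q i then X i w + \sum_(j <- s | Q j) X j w else \sum_(j <- s | Q j) X j w).
  by apply/funext => w; rewrite big_cons.
by case: (Q i) => //; exact: momD.
Qed.

Lemma mom_bounded X M : measurable_fun setT X -> (forall w, `|X w| <= M) -> has_moments X.
Proof.
move=> mX XM; split=> // m.
apply: (@integrable_dominated _ (fun=> M ^+ (2 * m))); first exact: measurable_funX.
  exact: integrable_cst_prob.
move=> w; rewrite normrX; apply: lerXn2r => //; rewrite nnegrE //.
by apply: le_trans (XM w).
Qed.

Lemma expect_cst c : expect (cst c) = c.
Proof. by rewrite /expect (Rintegral_cst P measurableT) /= probability_setT mulr1. Qed.

Lemma expectD X Y : has_moments X -> has_moments Y -> expect (fun w => X w + Y w) = expect X + expect Y.
Proof. by move=> /mom_integrable iX /mom_integrable iY; exact: RintegralD. Qed.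

Lemma expectZ c X : has_moments X -> expect (fun w => c * X w) = c * expect X.
Proof. by move=> /mom_integrable iX; exact: RintegralZl. Qed.

Lemma expect_le X Y : has_moments X -> has_moments Y -> (forall w, X w <= Y w) -> expect X <= expect Y.
Proof. by move=> /mom_integrable iX /mom_integrable iY h; apply: le_Rintegral. Qed.

Lemma expect_ge0 X : (forall w, 0 <= X w) -> 0 <= expect X.
Proof. by move=> h; apply: Rintegral_ge0. Qed.

Lemma expect_sum (I : Type) (s : seq I) (Q : pred I) (X : I -> Omega -> R) :
  (forall i, has_moments (X i)) ->
  expect (fun w => \sum_(i <- s | Q i) X i w) = \sum_(i <- s | Q i) expect (X i).
Proof.
move=> mX; elim: s => [|i s IH].
  rewrite big_nil (_ : (fun _ => _) = cst 0); first exact: expect_cst.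
  by apply/funext => w; rewrite big_nil.
rewrite big_cons -IH -expectD //; last exact: mom_sum.
rewrite (_ : (fun w => \sum_(j <- i :: s | Q j) X j w) =
  (fun w => if Q i then X i w + \sum_(j <- s | Q j) X j w else \sum_(j <- s | Q j) X j w)).
  by case: (Q i).
by apply/funext => w; rewrite big_cons.
Qed.

Lemma expect_integral X : has_moments X -> (\int[P]_w (X w)%:E)%E = (expect X)%:E.
Proof.
move=> /mom_integrable iX; rewrite /expect /Rintegral fineK //.
exact: integrable_fin_num.
Qed.

Definition indep_rv X Y := forall S1 S2 : set R, measurable S1 -> measurable S2 ->
  P (X @^-1` S1 `&` Y @^-1` S2) = (P (X @^-1` S1) * P (Y @^-1` S2))%E.

Lemma indep_rvX X Y k : indep_rv X Y -> indep_rv X (fun w => Y w ^+ k).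
Proof.
move=> h S1 S2 m1 m2.
rewrite -[(fun w => Y w ^+ k) @^-1` S2]/(Y @^-1` ((fun y : R => y ^+ k) @^-1` S2)).
by apply: h => //; rewrite -[X in measurable X]setTI; apply: exprn_measurable.
Qed.

(** Independence says that the law of (X, Y) is the product of the laws; the
    formula is then Fubini's theorem. *)
Lemma expect_indepM X Y : has_moments X -> has_moments Y -> indep_rv X Y ->
  expect (fun w => X w * Y w) = expect X * expect Y.
Proof.
move=> mmX mmY ind; have mX := mom_measurable mmX; have mY := mom_measurable mmY.
have iX := mom_integrable mmX; have iY := mom_integrable mmY.
have iXY := mom_integrable (momM mmX mmY).
pose X' : {mfun Omega >-> R} := HB.pack X (isMeasurableFun.Build _ _ _ _ _ mX).
pose Y' : {mfun Omega >-> R} := HB.pack Y (isMeasurableFun.Build _ _ _ _ _ mY).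
have mXY : measurable_fun setT (fun w => (X w, Y w)) by exact: measurable_fun_pair.
pose XY' : {mfun Omega >-> (R * R)%type} := HB.pack (fun w => (X w, Y w)) (isMeasurableFun.Build _ _ _ _ _ mXY).
pose muX := distribution P X'. pose muY := distribution P Y'.
pose muXY := pushforward P XY'.
have E A : measurable A -> (muX \x muY)%E A = muXY A.
  apply: product_measure_unique => B C mB mC.
  rewrite /muXY /pushforward.
  exact: ind.
pose f (z : R * R) := (z.1 * z.2)%:E.
have mf : measurable_fun setT f.
  by apply/measurable_EFinP; apply: measurable_funM.
have if1 : muXY.-integrable setT f by exact: integrable_pushforward.
have if2 : (muX \x muY)%E.-integrable setT f.
  move/integrableP : if1 => [? h]; apply/integrableP; split=> //.
  rewrite (@eq_measure_integral _ _ _ _ muXY) // => A mA _; exact: E.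
have -> : expect (fun w => X w * Y w) = fine (\int[(muX \x muY)%E]_z f z)%E.
  rewrite /expect /Rintegral (@eq_measure_integral _ _ _ _ muXY); last by move=> A mA _; exact: E.
  by rewrite integral_pushforward.
rewrite -integral12_prod_meas1 //.
have iX' : muX.-integrable setT (fun x => x%:E).
  by apply: integrable_pushforward => //; exact/measurable_EFinP/measurable_id.
have iY' : muY.-integrable setT (fun x => x%:E).
  by apply: integrable_pushforward => //; exact/measurable_EFinP/measurable_id.
have EX : (\int[muX]_x x%:E = (expect X)%:E)%E.
  by rewrite -expect_integral // integral_pushforward.
have EY : (\int[muY]_x x%:E = (expect Y)%:E)%E.
  by rewrite -expect_integral // integral_pushforward.
have -> : (\int[muX]_x fubini_F muY f x = \int[muX]_x ((expect Y)%:E * x%:E))%E.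
  apply: eq_integral => x _; rewrite /fubini_F /f /=.
  under eq_integral do rewrite EFinM.
  by rewrite integralZl // EY muleC.
by rewrite integralZl // EX -EFinM /= mulrC.
Qed.

End Moments.

(** * Brownian increments and their past *)

(** An open set of row vectors is a countable union of boxes with rational centres
    and rational half-widths, and the preimage of a box is a finite intersection
    of preimages of intervals under the coordinates. *)
Lemma measurable_continuous_coord (R : realType) (d : nat) (d1 : measure_display)
    (T1 : measurableType d1) (Z : T1 -> 'rV[R]_d) (g : 'rV[R]_d -> R) :
  continuous g -> (forall i, measurable_fun setT (fun w => Z w 0 i)) ->
  measurable_fun setT (fun w => g (Z w)).
Proof.
move=> cg mZ; apply: (measurability _ (RGenOInfty.measurableE R)) => //.
move=> /= _ [_ [a ->] <-]; rewrite setTI.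
pose O : set 'rV[R]_d := g @^-1` `]a, +oo[%classic.
have oO : open O by apply: (continuousP _).1 => //; exact: open_gt.
pose box (q : 'rV[rat]_d * nat) : set 'rV[R]_d :=
  [set z | forall i, `|z 0 i - ratr (q.1 0 i)| < q.2.+1%:R^-1].
pose good (q : 'rV[rat]_d * nat) := box q `<=` O.
have -> : (fun w => g (Z w)) @^-1` `]a, +oo[%classic =
    \bigcup_q (if pselect (good q) then Z @^-1` box q else set0).
  apply/seteqP; split => [w Ow|w [q _]]; last first.
    by case: pselect => // h /= /h.
  have /nbhs_ballP[e /= e0 eO] : nbhs (Z w) O.
    by rewrite openE in oO; exact: oO.
  pose k := `|Num.trunc (2 / e)|%N.
  have ke : 2 * k.+1%:R^-1 < e.
    rewrite ltr_pdivrMr // mulrC -ltr_pdivrMr //.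
    by rewrite /k absz_nat; exact: truncnS_gt.
  have k0 : (0 : R) < k.+1%:R^-1 by rewrite invr_gt0.
  have [eps epsE] : exists eps : R, eps = k.+1%:R^-1 by eexists.
  rewrite -epsE in ke k0.
  have Hq' i : exists q : rat, `|Z w 0 i - ratr q| < eps.
    have [|q] := @rat_in_itvoo R (Z w 0 i - eps) (Z w 0 i + eps); first by lra.
    rewrite in_itv /= => /andP[h1 h2]; exists q; rewrite ltr_norml; apply/andP; split; lra.
  have Hq i := cid (Hq' i).
  exists (\row_i sval (Hq i), k) => //; case: pselect => [_|ng] /=.
    by move=> i; rewrite mxE -epsE; exact: (svalP (Hq i)).
  exfalso; apply: ng => z bz; apply: eO; split=> //= i j.
  rewrite (ord1 i) /ball /= -(subrKA (ratr (sval (Hq j)))).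
  apply: le_lt_trans (ler_normD _ _) _.
  have := svalP (Hq j); have := bz j; rewrite /= -epsE mxE distrC => h1 h2; lra.
apply: countable_bigcupT_measurable; first exact: countableP.
move=> q; case: pselect => [gq|ngq]; last exact: measurable0.
have -> : Z @^-1` box q = \bigcap_(i in [set: 'I_d])
   ((fun w => Z w 0 i) @^-1`
     `](ratr (q.1 0 i) - q.2.+1%:R^-1), (ratr (q.1 0 i) + q.2.+1%:R^-1)[%classic).
  apply/seteqP; split => w /= h i.
    by move=> _; rewrite /= in_itv /=; have := h i; rewrite ltr_distl.
  by have := h i I; rewrite /= in_itv /= ltr_distl.
apply: fin_bigcap_measurable; first exact: finite_finset.
by move=> i _; rewrite -[X in measurable X]setTI; exact: mZ.
Qed.

Section Increments.
Context {disp : measure_display} {Omega : measurableType disp} {R : realType} {d : nat}.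
Variables (P : probability Omega R) (W : 'I_d -> R -> Omega -> R) (tau : nat -> R).
Hypothesis bmW : brownian_motion P W.
Hypothesis tau0 : 0 <= tau 0%N.
Hypothesis tauS : forall k, tau k <= tau k.+1.

Definition increment (j : 'I_d) (k : nat) (w : Omega) : R := W j (tau k.+1) w - W j (tau k) w.
Definition time_step (k : nat) : R := tau k.+1 - tau k.

Lemma tau_ge0 k : 0 <= tau k.
Proof. by elim: k => // k IH; apply: le_trans (tauS k). Qed.

Lemma measurable_bm j t : 0 <= t -> measurable_fun setT (W j t).
Proof. by move=> t0; have [/(_ j)[h _ _ _ _] _] := bmW; exact: h. Qed.

Lemma measurable_incr j k : measurable_fun setT (increment j k).
Proof. by apply: measurable_funB; apply: measurable_bm; exact: tau_ge0. Qed.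

(** Cylinders over the increments of all coordinates in the first k steps.  They are
    stable under intersection, so that a measure on the sigma-algebra which they
    generate is determined by its values on them. *)
Definition rect (k : nat) (S : 'I_d -> nat -> set R) : set Omega :=
  [set w | forall j i, (i < k)%N -> S j i (increment j i w)].

(** Independence is assumed between the coordinates of W on the one hand, and
    between the increments of one coordinate on the other; together they make all
    the increments mutually independent. *)
Lemma rect_prob k S : (forall j i, measurable (S j i)) ->
  P (rect k S) = (\prod_(j < d) \prod_(i < k) P (increment j i @^-1` S j i))%E.
Proof.
move=> mS; have [bm1 ind] := bmW.
pose E j : set Omega := [set w | forall i, (i < k)%N -> S j i (increment j i w)].
have EE j : E j = \bigcap_(i in [set` [fset i | i in iota 0 k]%fset]) (increment j i @^-1` S j i).
  apply/seteqP; split => w /= h i.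
    by move=> /imfsetP[/= x]; rewrite mem_iota => /andP[_ xk] ->; exact: h.
  by move=> ik; apply: h; apply/imfsetP; exists i => //=; rewrite mem_iota.
have PE j : P (E j) = (\prod_(i < k) P (increment j i @^-1` S j i))%E.
  have [_ _ _ _ /(_ _ tau0 tauS) indj] := bm1 j.
  rewrite EE indj => //; last first.
    by move=> i _; exists (S j i) => //; rewrite setTI.
  rewrite big_imfset //= undup_id ?iota_uniq //.
  by rewrite -[k in LHS]subn0 -/(index_iota 0 k) big_mkord.
have -> : rect k S = \bigcap_(j in [set` [fset j | j in enum 'I_d]%fset]) E j.
  apply/seteqP; split => w h j; first by move=> _ i ik; exact: h.
  by move=> i ik; apply: h => //; apply/imfsetP; exists j => //=; rewrite mem_enum.
rewrite ind => //; last first.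
  move=> j _; rewrite EE.
  pose GW := \bigcup_(t in [set t | 0 <= t]) rv_events (W j t).
  have mW t : 0 <= t -> measurable_fun (setT : set (g_sigma_algebraType GW)) (W j t).
    move=> t0 _ B mB; apply: sub_sigma_algebra; exists t => //.
    by exists B.
  have mI i : measurable_fun (setT : set (g_sigma_algebraType GW)) (increment j i).
    by apply: measurable_funB; apply: mW; exact: tau_ge0.
  apply: (@fin_bigcap_measurable _ (g_sigma_algebraType GW)).
    exact: finite_fset.
  by move=> i _; rewrite -[X in measurable X]setTI; apply: mI.
rewrite big_imfset //= undup_id ?enum_uniq //.
by rewrite big_enum /=; apply: eq_bigr => j _.
Qed.

Definition past (k : nat) : set_system Omega :=
  [set A | exists2 S, (forall j i, measurable (S j i)) & A = rect k S].

Lemma past_measurable k : past k `<=` measurable.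
Proof.
move=> _ [S mS ->].
have -> : rect k S = \bigcap_(j in [set: 'I_d]) \bigcap_(i in `I_k) (increment j i @^-1` S j i).
  by apply/seteqP; split => w h j; [move=> _ i ik; exact: h|move=> i ik; exact: (h j I i ik)].
apply: fin_bigcap_measurable => [|j _]; first exact: finite_finset.
apply: fin_bigcap_measurable => [|i _]; first exact: finite_II.
by rewrite -[X in measurable X]setTI; apply: measurable_incr.
Qed.

Lemma past_setI k : setI_closed (past k).
Proof.
move=> _ _ [S mS ->] [S' mS' ->].
exists (fun j i => S j i `&` S' j i); first by move=> j i; exact: measurableI.
apply/seteqP; split => w /=; first by move=> [h h'] j i ik; split; [exact: h|exact: h'].
by move=> h; split=> j i ik; have [] := h j i ik.
Qed.

(** One more increment extends a cylinder over k steps to one over k + 1 steps,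
    with no constraint on the other coordinates at step k. *)
Lemma rect_incr k S j (S0 : set R) : (forall j i, measurable (S j i)) -> measurable S0 ->
  P (rect k S `&` increment j k @^-1` S0) = (P (rect k S) * P (increment j k @^-1` S0))%E.
Proof.
move=> mS mS0.
pose S' j' i := if (i < k)%N then S j' i else if (j' == j) then S0 else setT.
have mS' j' i : measurable (S' j' i).
  by rewrite /S'; case: ifP => // _; case: ifP => // _; exact: measurableT.
have -> : rect k S `&` increment j k @^-1` S0 = rect k.+1 S'.
  apply/seteqP; split => w /=.
    move=> [h h0] j' i; rewrite ltnS leq_eqVlt /S' => /predU1P[->|ik].
      by rewrite ltnn; case: eqVneq => // ->.
    by rewrite ik; exact: h.
  move=> h; split; last by have := h j k (ltnSn k); rewrite /S' ltnn eqxx.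
  by move=> j' i ik; have := h j' i (ltnW ik); rewrite /S' ik.
rewrite !rect_prob //.
transitivity ((\prod_(j' < d) ((\prod_(i < k) P (increment j' i @^-1` S j' i)) *
    (if j' == j then P (increment j k @^-1` S0) else 1)))%E).
  apply: eq_bigr => j' _; rewrite big_ord_recr /= /S' ltnn; congr (_ * _)%E.
    by apply: eq_bigr => i _; rewrite ltn_ord.
  by case: eqVneq => [->|_] //; rewrite preimage_setT probability_setT.
by rewrite big_split /= -big_mkcond big_pred1_eq.
Qed.

(** The two sides are finite measures in A that agree on cylinders. *)
Lemma past_indep k A j (S0 : set R) : <<s past k >> A -> measurable S0 ->
  P (A `&` increment j k @^-1` S0) = (P A * P (increment j k @^-1` S0))%E.
Proof.
move=> sA mS0.
have mI : measurable (increment j k @^-1` S0).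
  by rewrite -[X in measurable X]setTI; apply: measurable_incr.
have Pfin : P (increment j k @^-1` S0) \is a fin_num by exact: fin_num_measure.
have pge0 : 0 <= fine (P (increment j k @^-1` S0)) by rewrite fine_ge0.
pose m1 := mrestr P mI; pose m2 := mscale (NngNum pge0) P.
have h : m1 A = m2 A.
  apply: (g_sigma_algebra_measure_unique (past k) _ (fun=> setT)) sA.
  - exact: past_measurable.
  - by move=> _; exists (fun _ _ => setT) => //; apply/seteqP; split.
  - by apply: bigcup_const; exists 0%N.
  - exact: past_setI.
  - move=> _ [S mS ->].
    change (P (rect k S `&` increment j k @^-1` S0) =
      (fine (P (increment j k @^-1` S0)))%:E * P (rect k S))%E.
    by rewrite fineK // muleC rect_incr.
  - move=> _; change (P (setT `&` increment j k @^-1` S0) < +oo)%E.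
    by rewrite setTI (le_lt_trans _ (ltry 1)) //; exact: probability_le1.
have -> : P (A `&` increment j k @^-1` S0) = ((fine (P (increment j k @^-1` S0)))%:E * P A)%E.
  exact: h.
by rewrite fineK // muleC.
Qed.

Definition past_rv (k : nat) (X : Omega -> R) :=
  measurable_fun (setT : set (g_sigma_algebraType (past k))) (X : g_sigma_algebraType (past k) -> R).

Lemma incr_past_rv k j i : (i < k)%N -> past_rv k (increment j i).
Proof.
move=> ik _ B mB; apply: sub_sigma_algebra.
exists (fun j' i' => if (j' == j) && (i' == i) then B else setT).
  by move=> j' i'; case: ifP => // _; exact: measurableT.
rewrite setTI; apply/seteqP; split => w /=.
  by move=> h j' i' _; case: ifP => // /andP[/eqP -> /eqP ->].
by move=> /(_ j i ik); rewrite !eqxx.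
Qed.

Lemma past_rvS k X : past_rv k X -> past_rv k.+1 X.
Proof.
move=> mX _ B mB; have := mX measurableT _ mB.
apply: smallest_sub; first exact: smallest_sigma_algebra.
move=> _ [S mS ->]; apply: sub_sigma_algebra.
exists (fun j i => if (i < k)%N then S j i else setT).
  by move=> j i; case: ifP => // _; exact: measurableT.
apply/seteqP; split => w /= h j i.
  by move=> _; case: ifP => // ik; exact: h.
by move=> ik; have := h j i (ltnW ik); rewrite ik.
Qed.

Lemma past_rv_indep k X j : past_rv k X -> indep_rv P X (increment j k).
Proof.
move=> mX S1 S2 mS1 mS2; apply: past_indep => //.
by have := mX measurableT _ mS1; rewrite setTI.
Qed.

End Increments.

(** * Moments of Brownian increments *)

Section NoiseMoments.
Context {disp : measure_display} {Omega : measurableType disp} {R : realType} {d : nat}.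
Variables (P : probability Omega R) (W : 'I_d -> R -> Omega -> R) (tau : nat -> R).
Hypothesis bmW : brownian_motion P W.
Hypothesis tau0 : 0 <= tau 0%N.
Hypothesis tauS : forall k, tau k <= tau k.+1.

Local Notation increment := (increment W tau).
Local Notation time_step := (time_step tau).
Local Notation past_rv := (past_rv W tau).

Lemma time_step_ge0 k : 0 <= time_step k. Proof. by rewrite subr_ge0. Qed.

Lemma incr_law j k : tau k < tau k.+1 -> forall S : set R, measurable S ->
  P (increment j k @^-1` S) = normal_prob 0 (Num.sqrt (time_step k)) S.
Proof.
move=> lt S mS; have tk := tau_ge0 tau0 tauS k.
by have [/(_ j)[_ _ _ h _] _] := bmW; exact: h tk lt S mS.
Qed.

Lemma incr0 j k : tau k = tau k.+1 -> increment j k = cst 0.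
Proof. by move=> e; apply/funext => w; rewrite /increment e subrr. Qed.

Lemma integral_incr j k (f : R -> \bar R) : tau k < tau k.+1 ->
  measurable_fun setT f -> (forall x, 0 <= f x)%E ->
  (\int[P]_w f (increment j k w) = \int[normal_prob 0 (Num.sqrt (time_step k))]_x f x)%E.
Proof.
move=> lt mf f0; have mi : measurable_fun setT (increment j k : Omega -> measurableTypeR R) :=
  measurable_incr bmW tau0 tauS j k.
pose X' : {mfun Omega >-> measurableTypeR R} := HB.pack (increment j k : Omega -> measurableTypeR R) (isMeasurableFun.Build _ _ _ _ _ mi).
transitivity (\int[pushforward P X']_x f x)%E; first by rewrite ge0_integral_pushforward.
apply: (@eq_measure_integral _ (measurableTypeR R) R setT
  (normal_prob 0 (Num.sqrt (time_step k))) (pushforward P X') f) => A mA _.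
exact: incr_law.
Qed.

(** A degenerate step is treated apart, as the assumption on the law of Brownian
    increments concerns distinct times. *)
Lemma incr_even_moment j k m :
  (\int[P]_w (increment j k w ^+ (2 * m))%:E <= (gauss_const m * time_step k ^+ m)%:E)%E.
Proof.
have := tauS k; rewrite le_eqVlt => /predU1P[e|lt].
  have -> : (\int[P]_w (increment j k w ^+ (2 * m))%:E = \int[P]_w cst (0 ^+ (2 * m))%:E w)%E.
    by apply: eq_integral => w _; rewrite (incr0 j e).
  rewrite integral_cst //= probability_setT mule1 lee_fin.
  rewrite /time_step e subrr; case: m => [|m]; last by rewrite mulnS !expr0n mulr0.
  rewrite muln0 !expr0 mulr1 /gauss_const !expr0 !mul1r.
  by rewrite -[leLHS]sqrtr1 ler_sqrt // ler1n.
rewrite (@integral_incr j k (fun x => (x ^+ (2 * m))%:E)) //.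
- have s0 : 0 < Num.sqrt (time_step k) by rewrite sqrtr_gt0 subr_gt0.
  apply: le_trans (normal_even_moment m s0) _.
  by rewrite exprM sqr_sqrtr // time_step_ge0.
- by apply/measurable_EFinP; exact: exprn_measurable.
- by move=> x; rewrite lee_fin even_pow_ge0.
Qed.

Lemma incr_mom j k : has_moments P (increment j k).
Proof.
have mi := measurable_incr bmW tau0 tauS j k.
split => // m; apply/integrableP; split.
  by apply/measurable_EFinP; exact: measurable_funX.
under eq_integral do rewrite /= even_pow_norm.
exact: le_lt_trans (incr_even_moment j k m) (ltry _).
Qed.

Lemma expect_incr_even j k m : expect P (fun w => increment j k w ^+ (2 * m)) <= gauss_const m * time_step k ^+ m.
Proof.
by rewrite -lee_fin -expect_integral ?incr_even_moment //; apply: momX; exact: incr_mom.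
Qed.

(** The increment and its opposite have the same law. *)
Lemma expect_incr0 j k : expect P (increment j k) = 0.
Proof.
have := tauS k; rewrite le_eqVlt => /predU1P[e|lt].
  by rewrite (incr0 j e) expect_cst.
have mi : measurable_fun setT (increment j k : Omega -> measurableTypeR R) :=
  measurable_incr bmW tau0 tauS j k.
have mo := incr_mom j k.
pose X' : {mfun Omega >-> measurableTypeR R} := HB.pack (increment j k : Omega -> measurableTypeR R) (isMeasurableFun.Build _ _ _ _ _ mi).
have mN : measurable_fun setT ((fun w => - increment j k w) : Omega -> measurableTypeR R).
  exact: (measurable_funN (measurable_incr bmW tau0 tauS j k)).
pose Y' : {mfun Omega >-> measurableTypeR R} := HB.pack ((fun w => - increment j k w) : Omega -> measurableTypeR R) (isMeasurableFun.Build _ _ _ _ _ mN).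
have momN : has_moments P (fun w => - increment j k w).
  have -> : (fun w => - increment j k w) = (fun w => -1 * increment j k w).
    by apply/funext => w; rewrite mulN1r.
  exact: momZ.
have s0 : Num.sqrt (time_step k) != 0 by rewrite gt_eqF // sqrtr_gt0 subr_gt0.
have E : expect P (increment j k) = expect P (fun w => - increment j k w).
  apply: EFin_inj; rewrite -!expect_integral //.
  have <- : (\int[pushforward P X']_x x%:E = \int[P]_w (increment j k w)%:E)%E.
    rewrite integral_pushforward //.
    exact: mom_integrable.
  have <- : (\int[pushforward P Y']_x x%:E = \int[P]_w (- increment j k w)%:E)%E.
    rewrite integral_pushforward //.
    exact: mom_integrable.
  apply: eq_measure_integral => A mA _.
  transitivity (P (increment j k @^-1` (-%R @^-1` A))); last by [].
  rewrite incr_law //; last first.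
    by rewrite -[X in measurable X]setTI; apply: oppr_measurable.
  by rewrite normal_prob_opp // -(incr_law j).
have EN : expect P (fun w => - increment j k w) = - expect P (increment j k).
  rewrite -mulN1r -expectZ //; congr (expect P _); apply/funext => w; by rewrite mulN1r.
by rewrite EN in E; lra.
Qed.

Definition adapted k (X : Omega -> R) := past_rv k X /\ has_moments P X.

Lemma adapted_mom k X : adapted k X -> has_moments P X. Proof. by case. Qed.

(** The martingale property, in the form needed: an increment is independent of
    the past and centred. *)
Lemma expect_adapted_incr k X j : adapted k X -> expect P (fun w => X w * increment j k w) = 0.
Proof.
move=> [pX mX]; rewrite expect_indepM ?expect_incr0 ?mulr0 //; first exact: incr_mom.
exact: past_rv_indep.
Qed.

Lemma expect_adapted_incr_even k X j m : adapted k X -> (forall w, 0 <= X w) ->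
  expect P (fun w => X w * increment j k w ^+ (2 * m)) <= gauss_const m * time_step k ^+ m * expect P X.
Proof.
move=> [pX mX] X0; rewrite expect_indepM //; last exact/indep_rvX/past_rv_indep.
  by rewrite mulrC; apply: ler_wpM2r (expect_incr_even _ _ _); exact: expect_ge0.
by apply: momX; exact: incr_mom.
Qed.

Lemma adapted_cst k c : adapted k (cst c).
Proof. by split; [exact: measurable_cst|exact: mom_cst]. Qed.

Lemma adaptedD k X Y : adapted k X -> adapted k Y -> adapted k (fun w => X w + Y w).
Proof. by move=> [? ?] [? ?]; split; [exact: measurable_funD|exact: momD]. Qed.

Lemma adaptedM k X Y : adapted k X -> adapted k Y -> adapted k (fun w => X w * Y w).
Proof. by move=> [? ?] [? ?]; split; [exact: measurable_funM|exact: momM]. Qed.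

Lemma adaptedB k X Y : adapted k X -> adapted k Y -> adapted k (fun w => X w - Y w).
Proof. by move=> [? ?] [? ?]; split; [exact: measurable_funB|exact: momB]. Qed.

Lemma adaptedX k X m : adapted k X -> adapted k (fun w => X w ^+ m).
Proof. by move=> [? ?]; split; [exact: measurable_funX|exact: momX]. Qed.

Lemma adapted_sum k (I : Type) (s : seq I) (X : I -> Omega -> R) :
  (forall i, adapted k (X i)) -> adapted k (fun w => \sum_(i <- s) X i w).
Proof.
move=> aX; elim: s => [|i s IH].
  have -> : (fun w => \sum_(i <- [::]) X i w) = cst 0.
    by apply/funext => w; rewrite big_nil.
  exact: adapted_cst.
have -> : (fun w => \sum_(j <- i :: s) X j w) = (fun w => X i w + \sum_(j <- s) X j w).
  by apply/funext => w; rewrite big_cons.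
exact: adaptedD.
Qed.

Lemma adaptedS k X : adapted k X -> adapted k.+1 X.
Proof. by move=> [? ?]; split; [exact: past_rvS|]. Qed.

Lemma adapted_incr k j : adapted k.+1 (increment j k).
Proof. by split; [exact: incr_past_rv|exact: incr_mom]. Qed.

End NoiseMoments.

(** * One step of a linear recursion *)

Section RealInequalities.
Context {R : realType}.
Implicit Types a e c x y h : R.

Lemma young x y m n : 0 <= x -> 0 <= y -> x ^+ m * y ^+ n <= x ^+ (m + n) + y ^+ (m + n).
Proof.
move=> x0 y0; rewrite !exprD; have [xy|/ltW yx] := leP x y.
  apply: ler_wpDl; first by rewrite mulr_ge0 ?exprn_ge0.
  by apply: ler_wpM2r; rewrite ?exprn_ge0 // lerXn2r.
apply: ler_wpDr; first by rewrite mulr_ge0 ?exprn_ge0.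
by apply: ler_wpM2l; rewrite ?exprn_ge0 // lerXn2r.
Qed.

(** Young's inequality at the time scale h: a drift c acting during a time h
    produces a displacement h c, which is compared with a. *)
Lemma young_drift a c h s : 0 < h ->
  a ^+ (2 * s).+1 * c <= a ^+ (2 * s.+1) / h + h ^+ (2 * s).+1 * c ^+ (2 * s.+1).
Proof.
move=> h0; have -> : (2 * s.+1 = (2 * s).+1 + 1)%N by rewrite mulnS addn1.
apply: le_trans (ler_norm _) _.
have E m (y : R) : ~~ odd m -> y ^+ m = `|y| ^+ m.
  by move=> /even_halfK <-; rewrite -mul2n !exprM real_normK ?num_real.
have ev : ~~ odd ((2 * s).+1 + 1) by rewrite addn1 /= negbK mul2n odd_double.
rewrite (E _ a ev) (E _ c ev) normrM normrX.
have h00 := ltW h0.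
have := young (2 * s).+1 1 (normr_ge0 a) (mulr_ge0 h00 (normr_ge0 c)).
have hE : h ^+ ((2 * s).+1 + 1) = h ^+ (2 * s).+1 * h by rewrite exprD expr1.
rewrite expr1 [in X in _ <= _ + X]exprMn hE => Y.
rewrite -(ler_pM2r h0) mulrDl divfK ?gt_eqF //.
rewrite -mulrA [( `|c| ) * h]mulrC.
apply: le_trans Y _.
rewrite lerD2l le_eqVlt; apply/orP; left; apply/eqP; ring.
Qed.

(** Young's inequality at the time scale h: a noise e acting during a time h
    produces a displacement of order sqrt h e, which is compared with a. *)
Lemma young_noise a e h s : 0 < h ->
  a ^+ (2 * s) * e ^+ 2 <= a ^+ (2 * s.+1) / h + h ^+ s * e ^+ (2 * s.+1).
Proof.
move=> h0; have h00 := ltW h0; rewrite !exprM.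
have := young s 1 (sqr_ge0 a) (mulr_ge0 h00 (sqr_ge0 e)).
have hE : h ^+ s.+1 = h * h ^+ s by rewrite exprS.
rewrite addn1 expr1 [in X in _ <= _ + X]exprMn hE => Y.
rewrite -(ler_pM2r h0) mulrDl divfK ?gt_eqF //.
rewrite -mulrA [e ^+ 2 * h]mulrC.
apply: le_trans Y _.
rewrite lerD2l le_eqVlt; apply/orP; left; apply/eqP; ring.
Qed.

(** The term of first order is kept exact, because its expectation will vanish for
    a centred e; the terms in between the second and the last order are
    interpolated by these two. *)
Lemma binomial_second_order a e s :
  (a + e) ^+ (2 * s.+1) <= a ^+ (2 * s.+1) + (2 * s.+1)%:R * (a ^+ (2 * s).+1 * e) +
    2 ^+ (2 * s.+1) * (a ^+ (2 * s) * e ^+ 2 + e ^+ (2 * s.+1)).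
Proof.
have ev (y : R) : 0 <= y ^+ (2 * s).+2 by rewrite -[(2 * s).+2](mulnS 2) even_pow_ge0.
rewrite (mulnS 2 s) !add2n.
set D := a ^+ (2 * s) * e ^+ 2 + e ^+ (2 * s).+2.
have D0 : 0 <= D.
  by apply: addr_ge0 => //; apply: mulr_ge0; [exact: even_pow_ge0|exact: sqr_ge0].
have bd i : (i <= 2 * s)%N -> a ^+ (2 * s - i) * e ^+ (i + 2) <= D.
  move=> is'; apply: le_trans (ler_norm _) _; rewrite normrM !normrX exprD mulrA.
  rewrite real_normK ?num_real //.
  have Y := young (2 * s - i) i (normr_ge0 a) (normr_ge0 e).
  apply: le_trans (ler_wpM2r (sqr_ge0 e) Y) _.
  rewrite subnK // mulrDl /D -!normrX !even_pow_norm lerD2l.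
  by rewrite -[(2 * s).+2]addn2 exprD.
rewrite exprDn big_ord_recl big_ord_recl /= -addrA; apply: lerD.
  by rewrite subn0 bin0 expr0 mulr1 mulr1n.
apply: lerD; first by rewrite /bump /= ?addn0 ?add0n bin1 subn1 expr1 mulr_natl.
apply: (@le_trans _ _ (\sum_(i < (2 * s).+1) D *+ 'C((2 * s).+2, bump 0 (bump 0 i)))).
  apply: ler_sum => i _; apply: ler_wMn2r.
  rewrite /bump /= !add1n !subSS.
  by have := bd i; rewrite addn2 -ltnS => /(_ (ltn_ord i)).
rewrite sumrMnr -[leLHS]mulr_natl.
apply: ler_wpM2r => //; rewrite -natrX ler_nat.
rewrite [leqRHS](_ : _ = \sum_(i < (2 * s).+3) 'C((2 * s).+2, i))%N; last first.
  by rewrite -[2%N]/(1 + 1)%N expnDn; apply: eq_bigr => i _; rewrite !exp1n !muln1.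
by rewrite [leqRHS]big_ord_recl big_ord_recl /= addnA leq_addl.
Qed.

End RealInequalities.

Section OneStep.
Context {disp : measure_display} {Omega : measurableType disp} {R : realType} {d : nat}.
Variables (P : probability Omega R) (W : 'I_d -> R -> Omega -> R) (tau : nat -> R).
Hypothesis bmW : brownian_motion P W.
Hypothesis tau0 : 0 <= tau 0%N.
Hypothesis tauS : forall k, tau k <= tau k.+1.
Variable T : R.
Hypothesis T0 : 0 < T.

Local Notation increment := (increment W tau).
Local Notation time_step := (time_step tau).
Local Notation adapted := (adapted P W tau).
Local Notation E := (expect P).
Local Notation gc := (@gauss_const R).

Lemma gauss_const_ge0 m : 0 <= gc m.
Proof. by rewrite !mulr_ge0 ?exprn_ge0. Qed.

(** The sum of the constants in the bounds of the first order, second order and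
    top order terms of the expansion. *)
Definition step_const (d' s : nat) (T' : R) : R :=
  (2 * s.+1)%:R * (1 + T' ^+ s.+1) +
  2 ^+ (2 * s.+1) * (d'.+1%:R ^+ 2 * (T' + gc 1) * (d'.+1%:R + 1) +
                     d'.+1%:R ^+ (2 * s.+1) * (T' ^+ s.+1 + gc s.+1)).

Variables (k s : nat) (h : R) (a c : Omega -> R) (B : 'I_d -> Omega -> R).
Hypotheses (h0 : 0 < h) (hT : h <= T) (dth : time_step k <= h).
Hypotheses (aa : adapted k a) (ac : adapted k c) (aB : forall j, adapted k (B j)).

Let eta w := c w * time_step k + \sum_j B j w * increment j k w.
Let S := E (fun w => c w ^+ (2 * s.+1)) + \sum_j E (fun w => B j w ^+ (2 * s.+1)).
Let Ea := E (fun w => a w ^+ (2 * s.+1)).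

Let dt0 : 0 <= time_step k. Proof. exact: time_step_ge0. Qed.
Let mincr j : has_moments P (increment j k). Proof. exact: incr_mom. Qed.
Let ma : has_moments P a. Proof. exact: adapted_mom aa. Qed.
Let mc : has_moments P c. Proof. exact: adapted_mom ac. Qed.
Let mB j : has_moments P (B j). Proof. exact: adapted_mom (aB j). Qed.
Let meta : has_moments P eta.
Proof.
apply: momD; first by apply: momM mc _; exact: mom_cst.
by apply: mom_sum => j; exact: momM.
Qed.
Let Ee0 (X : Omega -> R) m : 0 <= E (fun w => X w ^+ (2 * m)).
Proof. by apply: expect_ge0 => w; exact: even_pow_ge0. Qed.

Let S0 : 0 <= S.
Proof. by rewrite addr_ge0 // sumr_ge0. Qed.

Let sizeI : size (index_enum 'I_d) = d.
Proof. by rewrite /index_enum -enumT size_enum_ord. Qed.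

(** The noise part has expectation zero; only the drift contributes. *)
Lemma step_linear : E (fun w => a w ^+ (2 * s).+1 * eta w) <=
  time_step k * (Ea / h + T ^+ s.+1 * h ^+ s * S).
Proof.
have -> : (fun w => a w ^+ (2 * s).+1 * eta w) =
   (fun w => time_step k * (a w ^+ (2 * s).+1 * c w) +
      \sum_j (a w ^+ (2 * s).+1 * B j w) * increment j k w).
  apply/funext => w; rewrite /eta mulrDr mulr_sumr; congr (_ + _); first by ring.
  by apply: eq_bigr => j _; rewrite mulrA.
have maB j : has_moments P (fun w => a w ^+ (2 * s).+1 * B j w * increment j k w).
  by apply: momM => //; apply: momM => //; exact: momX.
have mac : has_moments P (fun w => a w ^+ (2 * s).+1 * c w) by apply: momM => //; exact: momX.
rewrite expectD; [|exact: momZ|exact: mom_sum].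
rewrite expect_sum // big1 ?addr0; last first.
  move=> j _; apply: (expect_adapted_incr bmW tau0 tauS).
  by apply: adaptedM => //; exact: adaptedX.
rewrite expectZ //; apply: ler_wpM2l => //.
apply: (@le_trans _ _ (E (fun w => h^-1 * a w ^+ (2 * s.+1) + h ^+ (2 * s).+1 * c w ^+ (2 * s.+1)))).
  apply: expect_le => //; first by apply: momD; apply: momZ; exact: momX.
  by move=> w; rewrite [h^-1 * _]mulrC; exact: young_drift.
rewrite expectD; [|by apply: momZ; exact: momX..].
rewrite !expectZ; [|exact: momX..]; rewrite [h^-1 * _]mulrC lerD2l.
apply: ler_pM => //; first by rewrite exprn_ge0 // ltW.
  have -> : ((2 * s).+1 = s.+1 + s)%N by lia.
  rewrite exprD; apply: ler_wpM2r; first by rewrite exprn_ge0 // ltW.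
  by apply: lerXn2r => //; rewrite nnegrE ltW.
by rewrite lerDl sumr_ge0.
Qed.

(** Each squared increment has an expectation of the order of the time step,
    independently of the past. *)
Lemma step_quadratic : E (fun w => a w ^+ (2 * s) * eta w ^+ 2) <=
  d.+1%:R ^+ 2 * (T + gc 1) * time_step k * (d.+1%:R * (Ea / h) + h ^+ s * S).
Proof.
pose Y (X : Omega -> R) w := a w ^+ (2 * s) * X w ^+ 2.
have mY X : has_moments P X -> has_moments P (Y X) by move=> mX; apply: momM; exact: momX.
have Y0 X w : 0 <= Y X w by rewrite mulr_ge0 ?even_pow_ge0 // sqr_ge0.
have EY X : has_moments P X -> E (Y X) <= Ea / h + h ^+ s * E (fun w => X w ^+ (2 * s.+1)).
  move=> mX; apply: (@le_trans _ _ (E (fun w => h^-1 * a w ^+ (2 * s.+1) + h ^+ s * X w ^+ (2 * s.+1)))).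
    apply: expect_le => //; [exact: mY|by apply: momD; apply: momZ; exact: momX|].
    by move=> w; rewrite [h^-1 * _]mulrC; exact: young_noise.
  rewrite expectD; [|by apply: momZ; exact: momX..].
  by rewrite !expectZ; [|exact: momX..]; rewrite [h^-1 * _]mulrC.
apply: (@le_trans _ _ (E (fun w => d.+1%:R ^+ 2 * (time_step k ^+ 2 * Y c w + \sum_j Y (B j) w * increment j k w ^+ (2 * 1))))).
  apply: expect_le.
  - by apply: momM; exact: momX.
  - apply: momZ; apply: momD; first by apply: momZ; exact: mY.
    by apply: mom_sum => j; apply: momM; [exact: mY|exact: momX].
  - move=> w; have := expr_even_sum_le (index_enum 'I_d) (fun j => B j w * increment j k w) (c w * time_step k) 1.
    rewrite sizeI !muln1 -/(eta w) => h2.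
    apply: le_trans (ler_wpM2l (even_pow_ge0 (a w) s) h2) _.
    rewrite mulrCA; apply: ler_wpM2l; first exact: sqr_ge0.
    rewrite mulrDr mulr_sumr; apply: lerD; first by rewrite /Y exprMn; lra.
    by apply: ler_sum => j _; rewrite exprMn mulrA.
rewrite expectZ; last first.
  apply: momD; first by apply: momZ; exact: mY.
  by apply: mom_sum => j; apply: momM; [exact: mY|exact: momX].
rewrite -[leRHS]mulrA -[leRHS]mulrA [(T + gc 1) * _]mulrA.
apply: ler_wpM2l; first exact: sqr_ge0.
rewrite expectD; [|by apply: momZ; exact: mY|by apply: mom_sum => j; apply: momM; [exact: mY|exact: momX]].
rewrite expectZ; last exact: mY.
rewrite expect_sum; last by move=> j; apply: momM; [exact: mY|exact: momX].
have g10 := gauss_const_ge0 1.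
have Tg : 0 <= T + gc 1 by rewrite addr_ge0 // ltW.
apply: (@le_trans _ _ ((T + gc 1) * time_step k * (E (Y c) + \sum_j E (Y (B j))))).
  rewrite mulrDr mulr_sumr; apply: lerD.
    apply: ler_wpM2r; first exact: expect_ge0.
    rewrite expr2; apply: ler_wpM2r => //.
    by apply: le_trans dth _; apply: le_trans hT _; rewrite lerDl.
  apply: ler_sum => j _.
  have aY : adapted k (Y (B j)) by apply: adaptedM; exact: adaptedX.
  apply: le_trans (expect_adapted_incr_even bmW tau0 tauS j 1 aY (Y0 (B j))) _.
  rewrite expr1; apply: ler_wpM2r; first exact: expect_ge0.
  by apply: ler_wpM2r => //; rewrite lerDr ltW.
apply: ler_wpM2l; first by rewrite mulr_ge0.
rewrite /S mulrDr mulr_sumr addrA.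
apply: (@le_trans _ _ ((Ea / h + h ^+ s * E (fun w => c w ^+ (2 * s.+1))) +
    \sum_j (Ea / h + h ^+ s * E (fun w => B j w ^+ (2 * s.+1))))).
  by apply: lerD; [exact: EY|apply: ler_sum => j _; exact: EY].
rewrite big_split /= sumr_const card_ord -mulr_natl -(natr1 d) mulrDl mul1r.
by rewrite le_eqVlt; apply/orP; left; apply/eqP; ring.
Qed.

Lemma step_top : E (fun w => eta w ^+ (2 * s.+1)) <=
  d.+1%:R ^+ (2 * s.+1) * (T ^+ s.+1 + gc s.+1) * time_step k * (h ^+ s * S).
Proof.
have mX X : has_moments P X -> has_moments P (fun w => X w ^+ (2 * s.+1)) by exact: momX.
apply: (@le_trans _ _ (E (fun w => d.+1%:R ^+ (2 * s.+1) * (time_step k ^+ (2 * s.+1) * c w ^+ (2 * s.+1)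
    + \sum_j B j w ^+ (2 * s.+1) * increment j k w ^+ (2 * s.+1))))).
  apply: expect_le => //; first exact: mX.
    apply: momZ; apply: momD; first by apply: momZ; exact: mX.
    by apply: mom_sum => j; apply: momM; exact: mX.
  move=> w; have := expr_even_sum_le (index_enum 'I_d) (fun j => B j w * increment j k w) (c w * time_step k) s.+1.
  rewrite sizeI -/(eta w) => h2; apply: le_trans h2 _.
  apply: ler_wpM2l; first exact: even_pow_ge0.
  apply: lerD; first by rewrite exprMn mulrC.
  by apply: ler_sum => j _; rewrite exprMn.
have msum : has_moments P (fun w => \sum_j B j w ^+ (2 * s.+1) * increment j k w ^+ (2 * s.+1)).
  by apply: mom_sum => j; apply: momM; exact: mX.
have mcc : has_moments P (fun w => time_step k ^+ (2 * s.+1) * c w ^+ (2 * s.+1)) by apply: momZ; exact: mX.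
rewrite expectZ; last exact: momD.
rewrite -!mulrA; apply: ler_wpM2l; first exact: even_pow_ge0.
rewrite expectD // expectZ; last exact: mX.
rewrite expect_sum; last by move=> j; apply: momM; exact: mX.
have g0 := gauss_const_ge0 s.+1.
have dtk : time_step k ^+ s.+1 <= time_step k * h ^+ s.
  rewrite exprS; apply: ler_wpM2l => //; apply: lerXn2r => //; rewrite nnegrE //; exact: ltW.
have TS : 0 <= T ^+ s.+1 by rewrite exprn_ge0 // ltW.
rewrite !mulrA -[(T ^+ s.+1 + _) * _ * _]mulrA; rewrite /S mulrDr mulr_sumr; apply: lerD.
  apply: ler_wpM2r => //.
  rewrite mul2n -addnn exprD; apply: ler_pM => //; rewrite ?exprn_ge0 //.
  apply: (@le_trans _ _ (T ^+ s.+1)); last by rewrite lerDl.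
  by apply: lerXn2r; rewrite ?nnegrE //; [exact: ltW|apply: le_trans dth hT].
apply: ler_sum => j _.
have aY : adapted k (fun w => B j w ^+ (2 * s.+1)) by exact: adaptedX.
apply: le_trans (expect_adapted_incr_even bmW tau0 tauS j s.+1 aY _) _.
  by move=> w; exact: even_pow_ge0.
apply: ler_wpM2r => //; apply: ler_pM => //; first by rewrite exprn_ge0.
by rewrite lerDr.
Qed.

(** The parameter h is a time scale at choice.  Iterated over a total time h
    starting from a = 0, the inequality bounds moments of order 2(s+1) by a
    multiple of h^(s+1) S: the recursion gains a factor sqrt h over its
    coefficients.  Iterated over the whole of [0, T] with h = T it is the usual
    moment estimate of Euler schemes. *)
Lemma one_step : E (fun w => (a w + eta w) ^+ (2 * s.+1)) <=
  Ea + step_const d s T * time_step k * (Ea / h + h ^+ s * S).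
Proof.
have m1 : has_moments P (fun w => a w ^+ (2 * s.+1)) by exact: momX.
have m2 : has_moments P (fun w => a w ^+ (2 * s).+1 * eta w) by apply: momM => //; exact: momX.
have m3 : has_moments P (fun w => a w ^+ (2 * s) * eta w ^+ 2) by apply: momM; exact: momX.
have m4 : has_moments P (fun w => eta w ^+ (2 * s.+1)) by exact: momX.
apply: (@le_trans _ _ (E (fun w => (a w ^+ (2 * s.+1) +
   (2 * s.+1)%:R * (a w ^+ (2 * s).+1 * eta w)) +
    2 ^+ (2 * s.+1) * (a w ^+ (2 * s) * eta w ^+ 2 + eta w ^+ (2 * s.+1))))).
  apply: expect_le.
  - by apply: momX; exact: momD.
  - apply: momD; first by apply: momD => //; exact: momZ.
    by apply: momZ; exact: momD.
  - by move=> w; exact: binomial_second_order.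
rewrite expectD; [|by apply: momD => //; exact: momZ|by apply: momZ; exact: momD].
rewrite expectD //; last exact: momZ.
rewrite !expectZ //; last exact: momD.
rewrite expectD // -/Ea -addrA lerD2l.
have h1 := step_linear; have h2 := step_quadratic; have h3 := step_top.
have A0 : 0 <= Ea / h by apply: divr_ge0; [exact: Ee0|exact: ltW].
have Q0 : 0 <= h ^+ s * S by apply: mulr_ge0 => //; rewrite exprn_ge0 // ltW.
move: h1 h2 h3; rewrite -mulrA /step_const.
move: A0 Q0; move: (Ea / h) (h ^+ s * S) => A Q A0 Q0 h1 h2 h3.
have r0 : 0 <= (2 * s.+1)%:R :> R by [].
have p0 : 0 <= 2 ^+ (2 * s.+1) :> R by rewrite exprn_ge0.
have TS : 0 <= T ^+ s.+1 by rewrite exprn_ge0 // ltW.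
have Tg : 0 <= T + gc 1 by rewrite addr_ge0 ?gauss_const_ge0 // ltW.
have Tr : 0 <= T ^+ s.+1 + gc s.+1 by rewrite addr_ge0 ?gauss_const_ge0.
rewrite !mulrDl; apply: lerD.
  apply: le_trans (ler_wpM2l r0 h1) _.
  rewrite -!mulrA; apply: ler_wpM2l => //.
  rewrite mulrCA; apply: ler_wpM2l => //.
  rewrite mulrDl mul1r mulrDr.
  have : 0 <= T ^+ s.+1 * A by rewrite mulr_ge0.
  lra.
apply: (le_trans (ler_wpM2l p0 (lerD h2 h3))).
rewrite -!mulrA; apply: ler_wpM2l => //.
set N := d.+1%:R; have N0 : 0 <= N :> R by [].
have c20 : 0 <= N ^+ 2 * (T + gc 1) * time_step k.
  by rewrite mulr_ge0 // mulr_ge0 // exprn_ge0.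
have c30 : 0 <= N ^+ (2 * s.+1) * (T ^+ s.+1 + gc s.+1) * time_step k.
  by rewrite mulr_ge0 // mulr_ge0 // exprn_ge0.
have e1 : N ^+ 2 * (T + gc 1) * time_step k * (N * A + Q) <= N ^+ 2 * (T + gc 1) * time_step k * ((N + 1) * (A + Q)).
  by apply: ler_wpM2l => //; have : 0 <= N * Q by [rewrite mulr_ge0]; lra.
have e2 : N ^+ (2 * s.+1) * (T ^+ s.+1 + gc s.+1) * time_step k * Q <=
   N ^+ (2 * s.+1) * (T ^+ s.+1 + gc s.+1) * time_step k * (A + Q).
  by apply: ler_wpM2l => //; rewrite lerDr.
apply: le_trans (_ : _ <= N ^+ 2 * (T + gc 1) * time_step k * (N * A + Q) +
   N ^+ (2 * s.+1) * (T ^+ s.+1 + gc s.+1) * time_step k * Q) _.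
  by rewrite le_eqVlt; apply/orP; left; apply/eqP; ring.
apply: le_trans (lerD e1 e2) _.
by rewrite le_eqVlt; apply/orP; left; apply/eqP; ring.
Qed.

End OneStep.

(** * Discrete Gronwall inequality *)

Section Gronwall.
Context {R : realType}.
Implicit Types alpha beta c t delta : R.

(** The solution of y' = alpha y + beta e^(alpha t) with y(0) = c, which dominates
    that of y' = alpha y + beta and involves no division by alpha. *)
Definition gronwall_bound alpha beta c t : R := expR (alpha * t) * (c + beta * t).

Lemma gronwall_step alpha beta c t delta y :
  0 <= alpha -> 0 <= beta -> 0 <= c -> 0 <= t -> 0 <= delta ->
  y <= gronwall_bound alpha beta c t ->
  (1 + alpha * delta) * y + beta * delta <= gronwall_bound alpha beta c (t + delta).
Proof.
move=> a0 b0 c0 t0 d0 yb; rewrite /gronwall_bound (mulrDr alpha) expRD (mulrDr beta) addrA mulrDr.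
have e1 : 1 + alpha * delta <= expR (alpha * delta) by exact: expR_ge1Dx.
have ad : 0 <= alpha * delta by exact: mulr_ge0.
have bd : 0 <= beta * delta by exact: mulr_ge0.
have f0 : 0 <= c + beta * t by rewrite addr_ge0 // mulr_ge0.
apply: lerD.
  apply: le_trans (ler_wpM2l _ yb) _; first by rewrite addr_ge0.
  rewrite /gronwall_bound mulrA; apply: ler_wpM2r => //.
  by rewrite mulrC; apply: ler_wpM2l; rewrite ?expR_ge0.
rewrite -[leLHS]mul1r; apply: ler_wpM2r => //.
have E1 : 1 <= expR (alpha * t).
  by apply: le_trans (expR_ge1Dx _); rewrite lerDl mulr_ge0.
have E2 : 1 <= expR (alpha * delta) by apply: le_trans e1; rewrite lerDl.
by rewrite -[leLHS]mul1r; apply: ler_pM.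
Qed.

End Gronwall.

(** * Expected mixed differences of composed functions *)

Section SmoothCoord.
Context {R : realType} {d : nat}.

Lemma iter_partial_coord (g : 'rV[R]_d -> 'rV[R]_d) i s : smooth_bounded g ->
  iter_partial s (fun y => g y 0 i) = (fun y => iter_partial s g y 0 i).
Proof.
move=> sg; elim: s => [//|l s IH] /=; apply/funext => y; rewrite -/(iter_partial s _) IH.
have [dg _ _] := sg s.
by rewrite -/(iter_partial s g) derive_mx // mxE.
Qed.

Lemma smooth_bounded_coord (g : 'rV[R]_d -> 'rV[R]_d) i : smooth_bounded g ->
  smooth_bounded (fun y => g y 0 i).
Proof.
move=> sg s; have [dg cg [M HM]] := sg s.
rewrite iter_partial_coord //; split.
- by move=> y l; apply: (derivable_mxP _ _ _).1; exact: dg.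
- move=> y; apply: (@continuous_comp _ _ _ (iter_partial s g) (fun z : 'rV[R]_d => z 0 i)).
    exact: cg.
  exact: coord_continuous.
exists M => y; apply: le_trans (HM y).
rewrite [leRHS]/Num.Def.normr /= mx_normE.
exact: (le_bigmax _ (fun k : 'I_1 * 'I_d => `|iter_partial s g y k.1 k.2|%:nng) (0, i)).
Qed.

Lemma smooth_bounded_bound (g : 'rV[R]_d -> R) : smooth_bounded g ->
  exists2 M, 0 <= M & forall y, `|g y| <= M.
Proof.
move=> sg; have [_ _ [M HM]] := sg [::]; exists `|M| => // y.
exact: le_trans (HM y) (ler_norm _).
Qed.

Lemma smooth_bounded_continuous (g : 'rV[R]_d -> R) : smooth_bounded g -> continuous g.
Proof. by move=> sg; have [] := sg [::]. Qed.

End SmoothCoord.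

Section ExpectedSplit.
Context {K : choiceType} {R : realType} {d : nat}.

Lemma mom_mdiff disp (Omega : measurableType disp) (P : probability Omega R)
   (S : {fset K}) (Y : {fset K} -> Omega -> R) :
  (forall L, has_moments P (Y L)) -> has_moments P (fun w => mdiff S (fun L => Y L w)).
Proof. by move=> mY; apply: mom_sum => L; exact: momZ. Qed.

(** Expected form of [mdiff_comp_split]: moments of high order of the lower
    differences turn its polynomial into a constant. *)
Lemma expect_mdiff_split (p s : nat) (g : 'rV[R]_d -> R) : smooth_bounded g ->
  exists2 C : R, 0 <= C &
  forall disp (Omega : measurableType disp) (P : probability Omega R)
    (Y : {fset K} -> Omega -> 'rV[R]_d) (v : K -> R) (S : {fset K}) (C2 : R),
  (forall L i, has_moments P (fun w => Y L w 0 i)) ->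
  (#|` S| <= p)%N -> (forall u, 0 < v u <= 1) -> 0 <= C2 ->
  (forall L i, (L `<=` S)%fset -> L != fset0 -> L != S ->
     expect P (fun w => mdiff L (fun L' => Y L' w 0 i) ^+ (2 * (s.+1 * p))) <=
       C2 * weight v L ^+ (2 * (s.+1 * p))) ->
  expect P (fun w => mdiff S (fun L => g (Y L w)) ^+ (2 * s.+1)) <=
    C * (1 + C2) * (\sum_i expect P (fun w => mdiff S (fun L => Y L w 0 i) ^+ (2 * s.+1))
      + weight v S ^+ (2 * s.+1)).
Proof.
move=> sg; have [C C0 HC] := @mdiff_comp_split K R d p s.+1 g isT sg.
have [M M0 HM] := smooth_bounded_bound sg.
pose D : R := 1 + (2 ^ p)%:R * d%:R.
have D1 : 1 <= D by rewrite lerDl mulr_ge0.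
have D0 : 0 <= D by exact: le_trans D1.
exists (C * D) => [|disp Omega P Y v S C2 mY Sp v01 C20 HC2]; first exact: mulr_ge0.
set q := (s.+1 * p)%N in HC2 HC *.
have W0 L : 0 < weight v L by apply: weight_gt0 => u; have /andP[] := v01 u.
have mdif L i : has_moments P (fun w => mdiff L (fun L' => Y L' w 0 i)).
  exact: (@mom_mdiff _ _ P L (fun L' w => Y L' w 0 i)).
have mg : has_moments P (fun w => mdiff S (fun L => g (Y L w))).
  apply: (@mom_mdiff _ _ P S (fun L w => g (Y L w))) => L.
  apply: (@mom_bounded _ _ _ P _ M) => //.
  apply: measurable_continuous_coord; first exact: smooth_bounded_continuous.
  by move=> i; have [] := mY L i.
set Q := fun L : {fset K} => (L != fset0) && (L != S).
have m1 : has_moments P (fun w => \sum_i mdiff S (fun L => Y L w 0 i) ^+ (2 * s.+1)).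
  by apply: mom_sum => i; exact: momX.
have m2 L i : has_moments P (fun w => (mdiff L (fun L' => Y L' w 0 i) / weight v L) ^+ (2 * q)).
  by apply: momX; apply: momM => //; exact: mom_cst.
have m3 L : has_moments P (fun w => \sum_i (mdiff L (fun L' => Y L' w 0 i) / weight v L) ^+ (2 * q)).
  by apply: mom_sum.
have m4 : has_moments P (fun w => \sum_(L <- fpowerset S | Q L)
   \sum_i (mdiff L (fun L' => Y L' w 0 i) / weight v L) ^+ (2 * q)) by exact: mom_sum.
have m5 : has_moments P (fun w => 1 + \sum_(L <- fpowerset S | Q L)
   \sum_i (mdiff L (fun L' => Y L' w 0 i) / weight v L) ^+ (2 * q)).
  by apply: momD => //; exact: mom_cst.
apply: (@le_trans _ _ (expect P (fun w =>
   C * (\sum_i mdiff S (fun L => Y L w 0 i) ^+ (2 * s.+1) +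
   weight v S ^+ (2 * s.+1) * (1 + \sum_(L <- fpowerset S | Q L)
   \sum_i (mdiff L (fun L' => Y L' w 0 i) / weight v L) ^+ (2 * q)))))).
  apply: expect_le; first exact: momX.
    by apply: momZ; apply: momD => //; exact: momZ.
  by move=> w; exact: HC.
rewrite expectZ; last by apply: momD => //; exact: momZ.
rewrite expectD //; last exact: momZ.
rewrite expectZ // expectD //; last exact: mom_cst.
rewrite expect_cst expect_sum; last by move=> i; exact: momX.
rewrite expect_sum //.
have b1 : \sum_(L <- fpowerset S | Q L)
   expect P (fun w => \sum_i (mdiff L (fun L' => Y L' w 0 i) / weight v L) ^+ (2 * q)) <=
   (2 ^ p)%:R * d%:R * C2.
  apply: (@le_trans _ _ (\sum_(L <- fpowerset S) d%:R * C2)).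
    rewrite big_mkcond /= big_seq [leRHS]big_seq; apply: ler_sum => L.
    rewrite fpowersetE => LS; case: ifP => [/andP[L0 LnS]|_]; last exact: mulr_ge0.
    rewrite expect_sum //.
    apply: (@le_trans _ _ (\sum_(i < d) C2)); last by rewrite sumr_const card_ord mulr_natl.
    apply: ler_sum => i _.
    have -> : (fun w => (mdiff L (fun L' => Y L' w 0 i) / weight v L) ^+ (2 * q)) =
       (fun w => (weight v L ^+ (2 * q))^-1 * mdiff L (fun L' => Y L' w 0 i) ^+ (2 * q)).
      by apply/funext => w; rewrite expr_div_n mulrC.
    rewrite expectZ; last exact: momX.
    by rewrite mulrC ler_pdivrMr ?exprn_gt0 //; exact: HC2.
  rewrite big_const_seq count_predT iter_addr_0 -[leLHS]mulr_natl mulrA.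
  apply: ler_wpM2r => //; apply: ler_wpM2r => //; rewrite ler_nat.
  by rewrite card_fpowerset leq_exp2l.
rewrite -!mulrA; apply: ler_wpM2l => //.
set A := \sum_i _; set V := weight v S ^+ _.
have A0 : 0 <= A by apply: sumr_ge0 => i _; apply: expect_ge0 => w; exact: even_pow_ge0.
have V0 : 0 <= V by exact: even_pow_ge0.
set Z := \sum_(L <- _ | _) _ in b1 *.
have DC : 1 + Z <= D * (1 + C2).
  apply: le_trans (_ : _ <= 1 + (2 ^ p)%:R * d%:R * C2) _; first by rewrite lerD2l.
  have : 0 <= (2 ^ p)%:R * d%:R :> R by rewrite mulr_ge0.
  by rewrite /D; lra.
have DC1 : 1 <= D * (1 + C2).
  by rewrite -[leLHS]mulr1; apply: ler_pM => //; rewrite lerDl.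
rewrite mulrA [leRHS]mulrDr; apply: lerD; first by rewrite ler_peMl.
by rewrite mulrC; apply: ler_wpM2r.
Qed.

End ExpectedSplit.

(** * Euler schemes with frozen coefficients *)

Section FrozenScheme.
Context {K : choiceType} {R : realType} {d : nat}.
Variables (sigma : 'I_d -> 'rV[R]_d -> 'rV[R]_d) (b : 'rV[R]_d -> 'rV[R]_d).
Variables (lo hi : K -> nat).

(** The inequalities are strict: at index lo u the coefficients are evaluated,
    and kept until they are evaluated again at index hi u. *)
Definition frozen (L : {fset K}) (k : nat) : bool :=
  has (fun u => (lo u < k < hi u)%N) (L : seq K).

(** The second component is the point at which the coefficients of the next step
    are evaluated.  Keeping it constant over several steps amounts to one Euler
    step over their union, since increments add up. *)
Fixpoint scheme (xi : 'I_d -> nat -> R) (delta : nat -> R) (L : {fset K})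
    (x : 'rV[R]_d) (k : nat) : 'rV[R]_d * 'rV[R]_d :=
  if k is k'.+1 then
    let: (X, Z) := scheme xi delta L x k' in
    let X' := X + \sum_j xi j k' *: sigma j Z + delta k' *: b Z in
    (X', if frozen L k'.+1 then Z else X')
  else (x, x).

(** Drift and diffusion coefficients in one family, the drift being [None]: the
    same estimates hold for all of them. *)
Definition coefficient (o : option 'I_d) (i : 'I_d) (y : 'rV[R]_d) : R :=
  if o is Some j then sigma j y 0 i else b y 0 i.

Section Deterministic.
Variables (xi : 'I_d -> nat -> R) (delta : nat -> R) (x : 'rV[R]_d).
Local Notation XX L k := (scheme xi delta L x k).1.
Local Notation ZZ L k := (scheme xi delta L x k).2.

Lemma schemeS L k i : XX L k.+1 0 i =
  XX L k 0 i + (coefficient None i (ZZ L k) * delta k + \sum_j coefficient (Some j) i (ZZ L k) * xi j k).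
Proof.
rewrite /=; case: (scheme _ _ _ _ k) => X Z /=; rewrite !mxE summxE -addrA; congr (_ + _).
rewrite addrC mulrC; congr (_ + _); apply: eq_bigr => j _; by rewrite mxE mulrC.
Qed.

Lemma schemeZ L k : ZZ L k.+1 = if frozen L k.+1 then ZZ L k else XX L k.+1.
Proof. by rewrite /=; case: (scheme _ _ _ _ k). Qed.

Lemma scheme_unfrozen (L : {fset K}) k : (forall u, u \in L -> ~~ (lo u < k < hi u)%N) ->
  ZZ L k = XX L k.
Proof.
case: k => [//|k] h; rewrite schemeZ; case: ifP => // /hasP[u uL /andP[h1 h2]].
by have := h u uL; rewrite h1 h2.
Qed.

Variable E : {fset K}.
Hypothesis lohi : forall u, u \in E -> (lo u <= hi u)%N.
Hypothesis disj : forall u v, u \in E -> v \in E -> u != v ->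
  (hi u <= lo v)%N \/ (hi v <= lo u)%N.

(** As the intervals do not overlap, no other index freezes the scheme at lo u. *)
Lemma scheme_frozen (L : {fset K}) u k : (L `<=` E)%fset -> u \in L -> (lo u <= k < hi u)%N ->
  ZZ L k = XX L (lo u).
Proof.
move=> /fsubsetP LE uL /andP[]; elim: k => [|k IH].
  by rewrite leqn0 => /eqP ->.
rewrite leq_eqVlt => /predU1P[E1|]; last first.
  rewrite ltnS => luk kh; rewrite schemeZ -IH // ?(ltnW kh) //.
  by case: ifP => // /negbT /hasPn /(_ u uL); rewrite ltnS luk kh.
move=> kh; rewrite E1 scheme_unfrozen // => v vL.
have [->|vu] := eqVneq v u; first by lia.
have := lohi (LE _ uL); have [] := disj (LE _ vL) (LE _ uL) vu; lia.
Qed.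

Lemma scheme_before (L : {fset K}) u k : (k <= lo u)%N ->
  scheme xi delta (u |` L)%fset x k = scheme xi delta L x k.
Proof.
elim: k => [//|k IH] kl /=; rewrite IH ?(ltnW kl) //.
case: (scheme _ _ _ _ k) => X Z; congr (_, if _ then _ else _).
apply/hasP/hasP => [[v]|[v vL h]]; last by exists v => //; rewrite !inE vL orbT.
by rewrite !inE => /predU1P[->|vL h]; [lia|exists v].
Qed.

Lemma mdiff_scheme_before (S : {fset K}) u k i : u \in S -> (k <= lo u)%N ->
  mdiff S (fun L => XX L k 0 i) = 0.
Proof. by move=> uS kl; apply: (mdiff_cst0 uS) => L _ _; rewrite scheme_before. Qed.

Lemma mdiff_schemeS (S : {fset K}) k i : mdiff S (fun L => XX L k.+1 0 i) =
  mdiff S (fun L => XX L k 0 i) + (mdiff S (fun L => coefficient None i (ZZ L k)) * delta k +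
    \sum_j mdiff S (fun L => coefficient (Some j) i (ZZ L k)) * xi j k).
Proof.
rewrite (eq_mdiff (fun L _ => schemeS L k i)) mdiffD; congr (_ + _).
rewrite mdiffD mdiff_sum; congr (_ + _).
  by rewrite mulrC -mdiffZ; apply: eq_mdiff => L _; rewrite mulrC.
by apply: eq_bigr => j _; rewrite mulrC -mdiffZ; apply: eq_mdiff => L _; rewrite mulrC.
Qed.

(** Inside the interval of u, adding u to L' replaces the current value by the
    value at lo u; the difference in the direction u is therefore an increment in
    time of the scheme without u.  This is where the first factor sqrt h comes
    from. *)
Lemma mdiff_frozen (L : {fset K}) u k (g : 'rV[R]_d -> R) : (L `<=` E)%fset -> u \in E ->
  u \notin L -> (lo u <= k < hi u)%N ->
  mdiff (u |` L)%fset (fun L' => g (ZZ L' k)) =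
  mdiff L (fun L' => g (XX L' k) - g (XX L' (lo u))).
Proof.
move=> LE uE uL luk; rewrite mdiffU1 // -mdiffB; apply: eq_mdiff => L' L'L.
have uL'E : (u |` L' `<=` E)%fset.
  by rewrite fsubUset fsub1set uE /=; apply: fsubset_trans LE.
rewrite (scheme_frozen uL'E _ luk) ?fset1U1 // scheme_before //.
rewrite scheme_unfrozen // => v /(fsubsetP L'L) vL.
have vu : v != u by apply: contraNneq uL => <-.
have := disj (fsubsetP LE _ vL) uE vu; lia.
Qed.

End Deterministic.
End FrozenScheme.

(** The ends of the intervals are recorded by their indices in the subdivision,
    since the schemes are recursions over these indices. *)
Record subdivision {K : choiceType} {R : realType} (T : R) (E : {fset K})
    (lo hi : K -> nat) (tau : nat -> R) (wgt : K -> R) : Prop := Subdivision {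
  sub_tau0 : 0 <= tau 0%N;
  sub_tauS : forall k, tau k <= tau k.+1;
  sub_tauT : forall k, tau k <= T;
  sub_wgt : forall u, 0 < wgt u <= 1;
  sub_lohi : forall u, u \in E -> (lo u <= hi u)%N;
  sub_len : forall u, u \in E -> tau (hi u) - tau (lo u) <= T * wgt u;
  sub_disj : forall u v, u \in E -> v \in E -> u != v ->
    (hi u <= lo v)%N \/ (hi v <= lo u)%N
}.

(** * Moments over one interval *)

Section RandomScheme.
Context {K : choiceType} {R : realType} {d : nat}.
Variables (sigma : 'I_d -> 'rV[R]_d -> 'rV[R]_d) (b : 'rV[R]_d -> 'rV[R]_d).
Hypothesis hsigma : forall j, smooth_bounded (sigma j).
Hypothesis hb : smooth_bounded b.
Variable T : R.
Hypothesis T0 : 0 < T.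

Lemma smooth_bounded_coef o i : smooth_bounded (coefficient sigma b o i).
Proof. by case: o => [j|]; exact: smooth_bounded_coord. Qed.

Context {disp : measure_display} {Omega : measurableType disp}.
Variables (P : probability Omega R) (W : 'I_d -> R -> Omega -> R).
Hypothesis bmW : brownian_motion P W.
Variables (E : {fset K}) (lo hi : K -> nat) (tau : nat -> R) (wgt : K -> R).
Hypothesis sub : subdivision T E lo hi tau wgt.
Variable x : 'rV[R]_d.

Let tau0 := sub_tau0 sub.
Let tauS := sub_tauS sub.

Definition random_scheme (L : {fset K}) (k : nat) (w : Omega) :=
  scheme sigma b lo hi (fun j k => increment W tau j k w) (time_step tau) L x k.

Local Notation XX L k w := (random_scheme L k w).1.
Local Notation ZZ L k w := (random_scheme L k w).2.
Local Notation adapted := (adapted P W tau).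

Lemma adapted_smooth k (Y : Omega -> 'rV[R]_d) (g : 'rV[R]_d -> R) : smooth_bounded g ->
  (forall i, adapted k (fun w => Y w 0 i)) -> adapted k (fun w => g (Y w)).
Proof.
move=> sg aY; have [M _ HM] := smooth_bounded_bound sg.
have cg := smooth_bounded_continuous sg.
split; first by apply: measurable_continuous_coord => // i; have [] := aY i.
apply: (@mom_bounded _ _ _ P _ M) => //.
by apply: measurable_continuous_coord => // i; have [_ []] := aY i.
Qed.

Lemma adapted_scheme L k : (forall i, adapted k (fun w => XX L k w 0 i)) /\
  (forall i, adapted k (fun w => ZZ L k w 0 i)).
Proof.
elim: k => [|k [IHX IHZ]]; first by split => i; exact: adapted_cst.
have aX i : adapted k.+1 (fun w => XX L k.+1 w 0 i).
  have -> : (fun w => XX L k.+1 w 0 i) = (fun w => XX L k w 0 i +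
     (coefficient sigma b None i (ZZ L k w) * time_step tau k +
       \sum_j coefficient sigma b (Some j) i (ZZ L k w) * increment W tau j k w)).
    by apply/funext => w; rewrite /random_scheme schemeS.
  have ac o : adapted k.+1 (fun w => coefficient sigma b o i (ZZ L k w)).
    by apply: adaptedS => //; apply: adapted_smooth => //; exact: smooth_bounded_coef.
  apply: adaptedD; first exact: adaptedS.
  apply: adaptedD; first by apply: adaptedM => //; exact: adapted_cst.
  apply: adapted_sum => j; apply: adaptedM; first exact: (ac (Some j)).
  exact: adapted_incr.
split => // i.
have -> : (fun w => ZZ L k.+1 w 0 i) =
   (fun w => (if frozen lo hi L k.+1 then ZZ L k w else XX L k.+1 w) 0 i).
  by apply/funext => w; rewrite /random_scheme schemeZ.
by case: (frozen _ _ _ _); [exact: adaptedS|exact: aX].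
Qed.

Lemma adapted_mdiff S k (Y : {fset K} -> Omega -> R) :
  (forall L, adapted k (Y L)) -> adapted k (fun w => mdiff S (fun L => Y L w)).
Proof. by move=> aY; apply: adapted_sum => L; apply: adaptedM => //; exact: adapted_cst. Qed.

Lemma adapted_coef L k o i : adapted k (fun w => coefficient sigma b o i (ZZ L k w)).
Proof.
apply: adapted_smooth; first exact: smooth_bounded_coef.
by move=> j; have [_] := adapted_scheme L k; apply.
Qed.

Lemma tau_mono i j : (i <= j)%N -> tau i <= tau j.
Proof.
move=> /subnK <-; elim: (j - i)%N => [|m IH]; first by rewrite add0n.
by rewrite addSn; apply: le_trans IH _.
Qed.

Lemma step_const_ge0 s : 0 <= step_const d s T.
Proof.
have T00 := ltW T0.
have g0 m : 0 <= @gauss_const R m by exact: gauss_const_ge0.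
rewrite /step_const; apply: addr_ge0.
  by rewrite mulr_ge0 // addr_ge0 // exprn_ge0.
rewrite mulr_ge0 ?exprn_ge0 //; apply: addr_ge0; rewrite !mulr_ge0 ?addr_ge0 ?exprn_ge0 //.
Qed.

(** [one_step] in the form that [gronwall_step] iterates. *)
Lemma step_bound k s h (a c : Omega -> R) (B : 'I_d -> Omega -> R) beta :
  0 < h -> h <= T -> time_step tau k <= h ->
  adapted k a -> adapted k c -> (forall j, adapted k (B j)) ->
  expect P (fun w => c w ^+ (2 * s.+1)) <= beta ->
  (forall j, expect P (fun w => B j w ^+ (2 * s.+1)) <= beta) ->
  expect P (fun w => (a w + (c w * time_step tau k + \sum_j B j w * increment W tau j k w)) ^+ (2 * s.+1)) <=
  (1 + step_const d s T / h * time_step tau k) * expect P (fun w => a w ^+ (2 * s.+1)) +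
   step_const d s T * h ^+ s * d.+1%:R * beta * time_step tau k.
Proof.
move=> h0 hT dth aa ac aB cb Bb.
apply: le_trans (one_step bmW tau0 tauS T0 s h0 hT dth aa ac aB) _.
set A := expect P _; set D := time_step tau k; set C := step_const d s T.
have D0 : 0 <= D by rewrite subr_ge0.
have C0 : 0 <= C by exact: step_const_ge0.
rewrite [(1 + _) * A]mulrDl mul1r -addrA lerD2l [leLHS]mulrDr; apply: lerD.
  by rewrite le_eqVlt; apply/orP; left; apply/eqP; ring.
rewrite [leRHS](_ : _ = C * D * (h ^+ s * (d.+1%:R * beta))); last by ring.
apply: ler_wpM2l; first exact: mulr_ge0.
apply: ler_wpM2l; first by rewrite exprn_ge0 // ltW.
rewrite -(natr1 d) mulrDl mul1r addrC; apply: lerD => //.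
apply: (@le_trans _ _ (\sum_(j < d) beta)); first exact: ler_sum.
by rewrite sumr_const card_ord mulr_natl.
Qed.

(** A recursion started at 0 at the beginning of the interval of u, with
    coefficients of order beta, has on this interval an additional factor wgt u in
    the square: [one_step] with h = T wgt u, iterated over a time at most h. *)
Lemma leaf_moment u s beta (a : nat -> Omega -> R) (c : nat -> Omega -> R)
    (B : nat -> 'I_d -> Omega -> R) : u \in E -> 0 <= beta ->
  (forall w, a (lo u) w = 0) ->
  (forall k, adapted k (c k)) -> (forall k j, adapted k (B k j)) ->
  (forall k w, (lo u <= k < hi u)%N ->
     a k.+1 w = a k w + (c k w * time_step tau k + \sum_j B k j w * increment W tau j k w)) ->
  (forall k, (lo u <= k < hi u)%N -> adapted k (a k)) ->
  (forall k, (lo u <= k < hi u)%N -> expect P (fun w => c k w ^+ (2 * s.+1)) <= beta) ->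
  (forall k j, (lo u <= k < hi u)%N -> expect P (fun w => B k j w ^+ (2 * s.+1)) <= beta) ->
  forall k, (lo u <= k <= hi u)%N -> expect P (fun w => a k w ^+ (2 * s.+1)) <=
    expR (step_const d s T) * (step_const d s T * T ^+ s.+1 * d.+1%:R) * beta * wgt u ^+ s.+1.
Proof.
move=> uE b0 a0 ac aB rec aa cb Bb.
have /andP[w0 w1] := sub_wgt sub u.
set C := step_const d s T.
have C0 : 0 <= C by exact: step_const_ge0.
pose h := T * wgt u.
have h0 : 0 < h by exact: mulr_gt0.
have hT : h <= T by rewrite -[leRHS]mulr1 ler_wpM2l // ltW.
have len k : (lo u <= k <= hi u)%N -> tau k - tau (lo u) <= h.
  move=> /andP[_ kh]; apply: le_trans (sub_len sub uE).
  by rewrite lerD2r; exact: tau_mono.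
(* alpha blows up with 1 / h, but it acts only during a time at most h. *)
pose alpha := C / h; pose bet := C * h ^+ s * d.+1%:R * beta.
have al0 : 0 <= alpha by rewrite divr_ge0 // ltW.
have be0 : 0 <= bet by rewrite !mulr_ge0 // exprn_ge0 // ltW.
suff main k : (lo u <= k <= hi u)%N -> expect P (fun w => a k w ^+ (2 * s.+1)) <=
    gronwall_bound alpha bet 0 (tau k - tau (lo u)).
  move=> k kk; apply: le_trans (main k kk) _; rewrite /gronwall_bound add0r.
  have t0 : 0 <= tau k - tau (lo u) by rewrite subr_ge0; apply: tau_mono; case/andP: kk.
  have th := len k kk.
  apply: (@le_trans _ _ (expR C * (C * T ^+ s.+1 * d.+1%:R * beta * wgt u ^+ s.+1))); last first.
    by rewrite !mulrA.
  apply: ler_pM; [exact: expR_ge0|exact: mulr_ge0| |].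
    by rewrite ler_expR /alpha -mulrA ler_piMr // mulrC ler_pdivrMr // mul1r.
  apply: le_trans (ler_wpM2l be0 th) _.
  rewrite /bet /h le_eqVlt; apply/orP; left; apply/eqP.
  by rewrite exprMn !exprS; ring.
elim: k => [|k IH].
  rewrite leqn0 => /andP[/eqP e _].
  have -> : (fun w => a 0%N w ^+ (2 * s.+1)) = cst 0.
    by apply/funext => w; rewrite -e a0 expr0n.
  by rewrite expect_cst e subrr /gronwall_bound !mulr0 addr0 mulr0.
move=> /andP[]; rewrite leq_eqVlt => /predU1P[e _|].
  have -> : (fun w => a k.+1 w ^+ (2 * s.+1)) = cst 0.
    by apply/funext => w; rewrite -e a0 expr0n.
  by rewrite expect_cst e subrr /gronwall_bound !mulr0 addr0 mulr0.
rewrite ltnS => luk kh.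
have lk : (lo u <= k < hi u)%N by rewrite luk.
have dtk : time_step tau k <= h.
  apply: le_trans (_ : tau k.+1 - tau (lo u) <= _).
    by rewrite lerD2l lerN2; exact: tau_mono.
  by apply: len; rewrite kh ltnW.
have -> : (fun w => a k.+1 w ^+ (2 * s.+1)) = (fun w =>
    (a k w + (c k w * time_step tau k + \sum_j B k j w * increment W tau j k w)) ^+ (2 * s.+1)).
  by apply/funext => w; rewrite rec.
apply: le_trans (step_bound h0 hT dtk (aa k lk) (ac k) (aB k) (cb k lk) (fun j => Bb k j lk)) _.
have -> : tau k.+1 - tau (lo u) = (tau k - tau (lo u)) + time_step tau k by rewrite /time_step; ring.
apply: gronwall_step => //.
- by rewrite subr_ge0; exact: tau_mono.
- by rewrite subr_ge0.
- by apply: IH; rewrite luk ltnW.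
Qed.

End RandomScheme.

(** * Moments of mixed differences of schemes *)

Section SchemeMoments.
Context {K : choiceType} {R : realType} {d : nat}.
Variables (sigma : 'I_d -> 'rV[R]_d -> 'rV[R]_d) (b : 'rV[R]_d -> 'rV[R]_d).
Hypothesis hsigma : forall j, smooth_bounded (sigma j).
Hypothesis hb : smooth_bounded b.
Variable T : R.
Hypothesis T0 : 0 < T.

Local Notation "'X_[ W , tau , lo , hi , x ] L k w" :=
  (random_scheme sigma b W lo hi tau x L k w).1 (at level 10, W, tau, lo, hi, x at level 9, L, k, w at level 9).
Local Notation "'Z_[ W , tau , lo , hi , x ] L k w" :=
  (random_scheme sigma b W lo hi tau x L k w).2 (at level 10, W, tau, lo, hi, x at level 9, L, k, w at level 9).

(** There are finitely many coefficients, so that constants attached to each of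
    them can be added up. *)
Lemma uniform_coef_bound (Phi : ('rV[R]_d -> R) -> R -> Prop) :
  (forall g C C', C <= C' -> Phi g C -> Phi g C') ->
  (forall g, smooth_bounded g -> exists2 C, 0 <= C & Phi g C) ->
  exists2 C, 0 <= C & forall o i, Phi (coefficient sigma b o i) C.
Proof.
move=> mon H.
have H' (q : option 'I_d * 'I_d) := cid2 (H _ (smooth_bounded_coef hsigma hb q.1 q.2)).
pose c q := s2val (H' q).
have c0 q : 0 <= c q by exact: s2valP (H' q).
exists (\sum_q c q) => [|o i]; first exact: sumr_ge0.
apply: mon (s2valP' (H' (o, i))).
by rewrite (bigD1 (o, i)) //= lerDl sumr_ge0.
Qed.

(** The constant precedes the quantifiers over probability spaces, subdivisions,
    starting points and times: this is the uniformity in n, in the labels and in x. *)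
Definition scheme_moment (p s : nat) (C : R) : Prop :=
  forall disp (Omega : measurableType disp) (P : probability Omega R)
    (W : 'I_d -> R -> Omega -> R), brownian_motion P W ->
  forall (E : {fset K}) lo hi tau wgt, subdivision T E lo hi tau wgt ->
  forall x (S : {fset K}) k i, (S `<=` E)%fset -> S != fset0 -> (#|` S| <= p)%N ->
  expect P (fun w => mdiff S (fun L => ('X_[W, tau, lo, hi, x] L k w) 0 i) ^+ (2 * s.+1)) <=
  C * weight wgt S ^+ (2 * s.+1).

Definition smooth_moment (p s : nat) (g : 'rV[R]_d -> R) (C : R) : Prop :=
  forall disp (Omega : measurableType disp) (P : probability Omega R)
    (W : 'I_d -> R -> Omega -> R), brownian_motion P W ->
  forall (E : {fset K}) lo hi tau wgt, subdivision T E lo hi tau wgt ->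
  forall x (S : {fset K}) k, (S `<=` E)%fset -> (#|` S| <= p)%N ->
  expect P (fun w => mdiff S (fun L => g ('X_[W, tau, lo, hi, x] L k w)) ^+ (2 * s.+1)) <=
  C * weight wgt S ^+ (2 * s.+1).

(** The increment is taken from the beginning of the interval of u, over a time at
    most T wgt u, whence the square root of wgt u in the size of the increment. *)
Definition increment_moment (p s : nat) (C : R) : Prop :=
  forall disp (Omega : measurableType disp) (P : probability Omega R)
    (W : 'I_d -> R -> Omega -> R), brownian_motion P W ->
  forall (E : {fset K}) lo hi tau wgt, subdivision T E lo hi tau wgt ->
  forall x (S : {fset K}) u k i, (S `<=` E)%fset -> (#|` S| <= p)%N ->
  u \in E -> u \notin S -> (lo u <= k <= hi u)%N ->
  expect P (fun w => mdiff S (fun L => ('X_[W, tau, lo, hi, x] L k w) 0 i -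
     ('X_[W, tau, lo, hi, x] L (lo u) w) 0 i) ^+ (2 * s.+1)) <=
  C * weight wgt S ^+ (2 * s.+1) * wgt u ^+ s.+1.

Definition leaf_interval_moment (p s : nat) (C : R) : Prop :=
  forall disp (Omega : measurableType disp) (P : probability Omega R)
    (W : 'I_d -> R -> Omega -> R), brownian_motion P W ->
  forall (E : {fset K}) lo hi tau wgt, subdivision T E lo hi tau wgt ->
  forall x (S : {fset K}) u k i, (S `<=` E)%fset -> (#|` S| <= p)%N ->
  u \in S -> (lo u <= k <= hi u)%N ->
  expect P (fun w => mdiff S (fun L => ('X_[W, tau, lo, hi, x] L k w) 0 i) ^+ (2 * s.+1)) <=
  C * weight wgt S ^+ (2 * s.+1).

(** [expect_mdiff_split], with the hypothesis used for the top difference as well. *)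
Lemma smooth_moment_of_scheme p : (forall s, exists2 C, 0 <= C & scheme_moment p s C) ->
  forall g s, smooth_bounded g -> exists2 C, 0 <= C & smooth_moment p s g C.
Proof.
move=> IH g s sg; have [M M0 HM] := smooth_bounded_bound sg.
(* [scheme_moment p s] bounds the power 2 * s.+1, whence the predecessor. *)
have [C1 C10 H1] := IH s; have [C2 C20 H2] := IH (s.+1 * p).-1.
have [C C0 HC] := @expect_mdiff_split K R d p s g sg.
exists (M ^+ (2 * s.+1) + C * (1 + C2) * (d%:R * C1 + 1)).
  by rewrite addr_ge0 ?exprn_ge0 // !mulr_ge0 // addr_ge0 // mulr_ge0.
move=> disp Omega P W bmW E lo hi tau wgt sub x S k SE Sp.
have mX L i : has_moments P (fun w => ('X_[W, tau, lo, hi, x] L k w) 0 i).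
  by have [aX _] := adapted_scheme hsigma hb bmW sub x L k; have [_] := aX i.
have W0 := even_pow_ge0 (weight wgt S) s.+1.
have cC : 0 <= C * (1 + C2) * (d%:R * C1 + 1).
  by rewrite !mulr_ge0 // addr_ge0 // mulr_ge0.
have [Se|Sn] := eqVneq S fset0.
  have mg : has_moments P (fun w => g ('X_[W, tau, lo, hi, x] fset0 k w)).
    apply: adapted_mom (adapted_smooth sg _).
    by have [aX _] := adapted_scheme hsigma hb bmW sub x fset0 k.
  rewrite Se; apply: (@le_trans _ _ (expect P (cst (M ^+ (2 * s.+1))))).
    apply: expect_le; [by apply: momX; rewrite (_ : (fun _ => _) = (fun w => g ('X_[W, tau, lo, hi, x] fset0 k w))) //; apply/funext => w; rewrite mdiff0|exact: mom_cst|].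
    move=> w; rewrite mdiff0 -even_pow_norm normrX.
    by apply: lerXn2r; rewrite ?nnegrE.
  by rewrite expect_cst weight0 expr1n mulr1 lerDl.
apply: le_trans (HC _ _ P (fun L w => 'X_[W, tau, lo, hi, x] L k w) wgt S C2 mX Sp (sub_wgt sub) C20 _) _.
  move=> L i LS L0 LnS.
  have p0 : (0 < s.+1 * p)%N.
    by rewrite muln_gt0 /=; apply: leq_trans Sp; rewrite cardfs_gt0.
  rewrite -(prednK p0); apply: (H2 _ _ P W bmW E) => //; first exact: fsubset_trans SE.
  exact: leq_trans (fsubset_leq_card LS) Sp.
rewrite mulrDl -[leLHS]add0r; apply: lerD; first by apply: mulr_ge0 => //; rewrite exprn_ge0.
rewrite -[leRHS]mulrA; apply: ler_wpM2l; first by rewrite mulr_ge0 // addr_ge0.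
rewrite mulrDl mul1r lerD2r.
apply: (@le_trans _ _ (\sum_(i < d) C1 * weight wgt S ^+ (2 * s.+1))).
  by apply: ler_sum => i _; exact: (H1 _ _ P W bmW E).
by rewrite sumr_const card_ord -[leLHS]mulr_natl mulrA.
Qed.

(** As u is not in S, the interval of u meets no interval of S, so that on it
    nothing is frozen and the increment is driven by coefficients at the current
    points, of order the weight of S; [leaf_moment] adds sqrt(wgt u). *)
Lemma increment_moment_of_scheme p : (forall s, exists2 C, 0 <= C & scheme_moment p s C) ->
  forall s, exists2 C, 0 <= C & increment_moment p s C.
Proof.
move=> IH s.
have [||C C0 HC] := @uniform_coef_bound (smooth_moment p s).
- move=> g c c' cc H disp Omega P W bmW E lo hi tau wgt sub x S k SE Sp.
  apply: le_trans (H _ _ P W bmW E lo hi tau wgt sub x S k SE Sp) _.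
  by apply: ler_wpM2r => //; exact: even_pow_ge0.
- by move=> g sg; exact: smooth_moment_of_scheme.
have G0 : 0 <= step_const d s T by exact: step_const_ge0.
exists (expR (step_const d s T) * (step_const d s T * T ^+ s.+1 * d.+1%:R) * C).
  by rewrite !mulr_ge0 ?expR_ge0 ?exprn_ge0 // ltW.
move=> disp Omega P W bmW E lo hi tau wgt sub x S u k i SE Sp uE uS luk.
have W0 := even_pow_ge0 (weight wgt S) s.+1.
rewrite -[_ * C * _]mulrA.
have unf j w L : (lo u <= j < hi u)%N -> (L `<=` S)%fset ->
    'Z_[W, tau, lo, hi, x] L j w = 'X_[W, tau, lo, hi, x] L j w.
  move=> luj LS; apply: scheme_unfrozen => v vL.
  have vE := fsubsetP SE _ (fsubsetP LS _ vL).
  have vu : v != u by apply: contraNneq uS => <-; exact: (fsubsetP LS).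
  by move: (sub_disj sub vE uE vu) luj; clear; lia.
have aX L j := (adapted_scheme hsigma hb bmW sub x L j).1.
apply: (leaf_moment T0 bmW sub (a := fun j w => mdiff S (fun L => ('X_[W, tau, lo, hi, x] L j w) 0 i -
     ('X_[W, tau, lo, hi, x] L (lo u) w) 0 i))
   (c := fun j w => mdiff S (fun L => coefficient sigma b None i ('Z_[W, tau, lo, hi, x] L j w)))
   (B := fun j l w => mdiff S (fun L => coefficient sigma b (Some l) i ('Z_[W, tau, lo, hi, x] L j w)))) => //.
- exact: mulr_ge0.
- move=> w; rewrite (@eq_mdiff _ _ _ _ (fun=> 0 * 0)) ?mdiffZ ?mul0r // => L _.
  by rewrite subrr ?mul0r.
- move=> j; apply: (@adapted_mdiff _ _ _ _ _ _ _ _ S j (fun L w => coefficient sigma b None i ('Z_[W, tau, lo, hi, x] L j w))) => L.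
  exact: (adapted_coef hsigma hb bmW sub).
- move=> j l; apply: (@adapted_mdiff _ _ _ _ _ _ _ _ S j (fun L w => coefficient sigma b (Some l) i ('Z_[W, tau, lo, hi, x] L j w))) => L.
  exact: (adapted_coef hsigma hb bmW sub).
- move=> j w luj; rewrite !mdiffB /random_scheme mdiff_schemeS; ring.
- move=> j /andP[luj _]; apply: (@adapted_mdiff _ _ _ _ _ _ _ _ S j (fun L w => ('X_[W, tau, lo, hi, x] L j w) 0 i - ('X_[W, tau, lo, hi, x] L (lo u) w) 0 i)) => L.
  apply: adaptedB; first exact: aX.
  have : forall m, adapted P W tau (lo u + m) (fun w => ('X_[W, tau, lo, hi, x] L (lo u) w) 0 i).
    elim=> [|m IHm]; first by rewrite addn0; exact: aX.
    by rewrite addnS; exact: adaptedS IHm.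
  by move=> /(_ (j - lo u)%N); rewrite subnKC.
- move=> j luj.
  have -> : (fun w => mdiff S (fun L => coefficient sigma b None i ('Z_[W, tau, lo, hi, x] L j w)) ^+ (2 * s.+1)) =
    (fun w => mdiff S (fun L => coefficient sigma b None i ('X_[W, tau, lo, hi, x] L j w)) ^+ (2 * s.+1)).
    by apply/funext => w; congr (_ ^+ _); apply: eq_mdiff => L LS; rewrite unf.
  exact: (HC None i _ _ P W bmW E).
- move=> j l luj.
  have -> : (fun w => mdiff S (fun L => coefficient sigma b (Some l) i ('Z_[W, tau, lo, hi, x] L j w)) ^+ (2 * s.+1)) =
    (fun w => mdiff S (fun L => coefficient sigma b (Some l) i ('X_[W, tau, lo, hi, x] L j w)) ^+ (2 * s.+1)).
    by apply/funext => w; congr (_ ^+ _); apply: eq_mdiff => L LS; rewrite unf.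
  exact: (HC (Some l) i _ _ P W bmW E).
Qed.

(** The frozen point Z depends on u only through an increment over the interval of
    u, of order sqrt(wgt u).  With these modified weights the frozen points satisfy
    the hypotheses of [expect_mdiff_split]. *)
Definition half_wgt (wgt : K -> R) (u z : K) : R :=
  if z == u then Num.sqrt (wgt u) else wgt z.

Lemma half_wgt_01 wgt u : (forall z, 0 < wgt z <= 1) -> forall z, 0 < half_wgt wgt u z <= 1.
Proof.
move=> w01 z; rewrite /half_wgt; case: eqP => // _; have /andP[w0 w1] := w01 u.
rewrite sqrtr_gt0 w0 /=; have := @ler_sqrt R (wgt u) 1.
by rewrite sqrtr1 => ->.
Qed.

Lemma weight_half_notin wgt u (L : {fset K}) : u \notin L -> weight (half_wgt wgt u) L = weight wgt L.
Proof.
move=> uL; rewrite /weight !big_seq; apply: eq_bigr => z zL.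
by rewrite /half_wgt; case: eqP => // zu; rewrite -zu zL in uL.
Qed.

Lemma weight_half_in wgt u (L : {fset K}) q : 0 < wgt u -> u \notin L ->
  weight (half_wgt wgt u) (u |` L)%fset ^+ (2 * q) = weight wgt L ^+ (2 * q) * wgt u ^+ q.
Proof.
move=> w0 uL; rewrite weightU1 // weight_half_notin // /half_wgt eqxx mulrC exprMn.
by rewrite [in X in _ * X]exprM sqr_sqrtr // ltW.
Qed.

(** Only the directions other than u are counted by p: in the direction u the
    difference of Z is an increment of schemes without u. *)
Definition frozen_moment (p s : nat) (C : R) : Prop :=
  forall disp (Omega : measurableType disp) (P : probability Omega R)
    (W : 'I_d -> R -> Omega -> R), brownian_motion P W ->
  forall (E : {fset K}) lo hi tau wgt, subdivision T E lo hi tau wgt ->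
  forall x (L : {fset K}) u k i, (L `<=` E)%fset -> L != fset0 ->
  u \in E -> (#|` (L `\ u)%fset| <= p)%N -> (lo u <= k < hi u)%N ->
  expect P (fun w => mdiff L (fun L' => ('Z_[W, tau, lo, hi, x] L' k w) 0 i) ^+ (2 * s.+1)) <=
  C * weight (half_wgt wgt u) L ^+ (2 * s.+1).

(** If u is in L, [mdiff_frozen] reduces to increments over the interval of u of
    differences over L without u; otherwise nothing is frozen. *)
Lemma frozen_moment_of_scheme p : (forall s, exists2 C, 0 <= C & scheme_moment p s C) ->
  forall s, exists2 C, 0 <= C & frozen_moment p s C.
Proof.
move=> IH s; have [C1 C10 H1] := IH s.
have [C2 C20 H2] := increment_moment_of_scheme IH s.
exists (C1 + C2) => [|disp Omega P W bmW E lo hi tau wgt sub x L u k i LE L0 uE Lp luk].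
  exact: addr_ge0.
have w01 := sub_wgt sub.
have W0 (v : K -> R) := even_pow_ge0 (weight v L) s.+1.
have [uL|uL] := boolP (u \in L); last first.
  rewrite weight_half_notin // mulrDl; apply: ler_wpDr; first exact: mulr_ge0.
  have -> : (fun w => mdiff L (fun L' => ('Z_[W, tau, lo, hi, x] L' k w) 0 i) ^+ (2 * s.+1)) =
    (fun w => mdiff L (fun L' => ('X_[W, tau, lo, hi, x] L' k w) 0 i) ^+ (2 * s.+1)).
    apply/funext => w; congr (_ ^+ _); apply: eq_mdiff => L' L'L.
    rewrite /random_scheme scheme_unfrozen // => v vL.
    have vL' := fsubsetP L'L _ vL; have vu : v != u by apply: contraNneq uL => <-.
    by move: (sub_disj sub (fsubsetP LE _ vL') uE vu) luk; clear; lia.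
  apply: (H1 _ _ P W bmW E lo hi tau wgt sub) => //.
  by move: Lp; rewrite mem_fsetD1 // => ->.
rewrite -(fsetD1K uL) in LE *; set L1 := (L `\ u)%fset in LE Lp *.
have uL1 : u \notin L1 by rewrite fsetD11.
have L1E : (L1 `<=` E)%fset by apply: fsubset_trans LE; exact: fsubsetU1.
have w0 : 0 < wgt u by have /andP[] := w01 u.
rewrite weight_half_in // mulrDl; apply: ler_wpDl.
  by rewrite !mulr_ge0 ?even_pow_ge0 // exprn_ge0 // ltW.
have -> : (fun w => mdiff (u |` L1)%fset (fun L' => ('Z_[W, tau, lo, hi, x] L' k w) 0 i) ^+ (2 * s.+1)) =
   (fun w => mdiff L1 (fun L' => ('X_[W, tau, lo, hi, x] L' k w) 0 i -
     ('X_[W, tau, lo, hi, x] L' (lo u) w) 0 i) ^+ (2 * s.+1)).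
  apply/funext => w; congr (_ ^+ _).
  exact: (mdiff_frozen sigma b _ _ x (sub_lohi sub) (sub_disj sub) (fun y : 'rV[R]_d => y 0 i)).
rewrite mulrA; apply: (H2 _ _ P W bmW E lo hi tau wgt sub) => //.
by move: luk; clear; lia.
Qed.

(** The gain of one direction.  In the interval of u in S, D_S X solves a recursion
    started at 0 whose coefficients D_S g(Z), for g a coefficient of the scheme,
    have only half of the weight of u; the other half is the factor that
    [leaf_moment] adds.  All differences involved are over S without u, which is
    how the cardinality decreases. *)
Lemma leaf_interval_moment_of_scheme p : (forall s, exists2 C, 0 <= C & scheme_moment p s C) ->
  forall s, exists2 C, 0 <= C & leaf_interval_moment p.+1 s C.
Proof.
move=> IH s.
pose Phi (g : 'rV[R]_d -> R) (C : R) :=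
  forall disp (Omega : measurableType disp) (P : probability Omega R)
    (W : 'I_d -> R -> Omega -> R), brownian_motion P W ->
  forall (E : {fset K}) lo hi tau wgt, subdivision T E lo hi tau wgt ->
  forall x (S : {fset K}) u k, (S `<=` E)%fset -> (#|` S| <= p.+1)%N ->
  u \in S -> (lo u <= k < hi u)%N ->
  expect P (fun w => mdiff S (fun L => g ('Z_[W, tau, lo, hi, x] L k w)) ^+ (2 * s.+1)) <=
  C * weight (half_wgt wgt u) S ^+ (2 * s.+1).
have [||C C0 HC] := @uniform_coef_bound Phi.
- move=> g c c' cc H disp Omega P W bmW E lo hi tau wgt sub x S u k SE Sp uS luk.
  apply: le_trans (H _ _ P W bmW E lo hi tau wgt sub x S u k SE Sp uS luk) _.
  by apply: ler_wpM2r => //; exact: even_pow_ge0.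
- move=> g sg.
  have [C1 C10 H1] := frozen_moment_of_scheme IH s.
  have [C2 C20 H2] := frozen_moment_of_scheme IH (s.+1 * p.+1).-1.
  have [C C0 HC] := @expect_mdiff_split K R d p.+1 s g sg.
  exists (C * (1 + C2) * (d%:R * C1 + 1)).
    by rewrite !mulr_ge0 // addr_ge0 // mulr_ge0.
  move=> disp Omega P W bmW E lo hi tau wgt sub x S u k SE Sp uS luk.
  have w01 := half_wgt_01 u (sub_wgt sub).
  have uE := fsubsetP SE _ uS.
  have cardL L : (L `<=` S)%fset -> (#|` (L `\ u)%fset| <= p)%N.
    move=> LS; apply: (@leq_trans #|` (S `\ u)%fset|).
      by apply: fsubset_leq_card; apply: fsetSD.
    by move: Sp; rewrite (cardfsD1 u) uS.
  have mZ L i : has_moments P (fun w => ('Z_[W, tau, lo, hi, x] L k w) 0 i).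
    by have [_ aZ] := adapted_scheme hsigma hb bmW sub x L k; have [_] := aZ i.
  apply: le_trans (HC _ _ P (fun L w => 'Z_[W, tau, lo, hi, x] L k w) (half_wgt wgt u) S C2 mZ Sp w01 C20 _) _.
    move=> L i LS L0 LnS; rewrite -(prednK (isT : 0 < s.+1 * p.+1)%N).
    apply: (H2 _ _ P W bmW E lo hi tau wgt sub) => //; first exact: fsubset_trans SE.
    exact: cardL.
  rewrite -[leRHS]mulrA; apply: ler_wpM2l; first by rewrite mulr_ge0 // addr_ge0.
  rewrite mulrDl mul1r lerD2r.
  apply: (@le_trans _ _ (\sum_(i < d) C1 * weight (half_wgt wgt u) S ^+ (2 * s.+1))).
    apply: ler_sum => i _; apply: (H1 _ _ P W bmW E lo hi tau wgt sub) => //; last exact: cardL.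
    by apply/fset0Pn; exists u.
  by rewrite sumr_const card_ord -[leLHS]mulr_natl mulrA.
have G0 : 0 <= step_const d s T by exact: step_const_ge0.
exists (expR (step_const d s T) * (step_const d s T * T ^+ s.+1 * d.+1%:R) * C).
  by rewrite !mulr_ge0 ?expR_ge0 ?exprn_ge0 // ltW.
move=> disp Omega P W bmW E lo hi tau wgt sub x S u k i SE Sp uS luk.
have uE := fsubsetP SE _ uS.
have w0 : 0 < wgt u by have /andP[] := sub_wgt sub u.
(* wgt u ^+ (2 * s.+1) is split into the share of the frozen points and that of
   the recursion over the interval of u. *)
have WE : weight wgt S ^+ (2 * s.+1) = weight (half_wgt wgt u) S ^+ (2 * s.+1) * wgt u ^+ s.+1.
  rewrite -(fsetD1K uS) weight_half_in ?fsetD11 // weightU1 ?fsetD11 // exprMn mulrC -mulrA -exprD.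
  by rewrite addnn -mul2n.
rewrite WE [leRHS](_ : _ = expR (step_const d s T) * (step_const d s T * T ^+ s.+1 * d.+1%:R) *
  (C * weight (half_wgt wgt u) S ^+ (2 * s.+1)) * wgt u ^+ s.+1); last by ring.
apply: (leaf_moment T0 bmW sub (a := fun j w => mdiff S (fun L => ('X_[W, tau, lo, hi, x] L j w) 0 i))
   (c := fun j w => mdiff S (fun L => coefficient sigma b None i ('Z_[W, tau, lo, hi, x] L j w)))
   (B := fun j l w => mdiff S (fun L => coefficient sigma b (Some l) i ('Z_[W, tau, lo, hi, x] L j w)))) => //.
- by rewrite mulr_ge0 // even_pow_ge0.
- by move=> w; exact: (mdiff_scheme_before sigma b hi _ _ x i uS).
- move=> j; apply: (@adapted_mdiff _ _ _ _ _ _ _ _ S j (fun L w => coefficient sigma b None i ('Z_[W, tau, lo, hi, x] L j w))) => L.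
  exact: (adapted_coef hsigma hb bmW sub).
- move=> j l; apply: (@adapted_mdiff _ _ _ _ _ _ _ _ S j (fun L w => coefficient sigma b (Some l) i ('Z_[W, tau, lo, hi, x] L j w))) => L.
  exact: (adapted_coef hsigma hb bmW sub).
- by move=> j w luj; rewrite /random_scheme mdiff_schemeS.
- move=> j _; apply: (@adapted_mdiff _ _ _ _ _ _ _ _ S j (fun L w => ('X_[W, tau, lo, hi, x] L j w) 0 i)) => L.
  exact: (adapted_scheme hsigma hb bmW sub x L j).1.
- by move=> j luj; exact: (HC None i _ _ P W bmW E).
- by move=> j l luj; exact: (HC (Some l) i _ _ P W bmW E).
Qed.

(** In the interval of a leaf of S the bound is known from
    [leaf_interval_moment_of_scheme].  Elsewhere nothing is frozen, and D_S X
    satisfies a linear recursion whose source, coming from lower differences, is of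
    the order of the weight of S. *)
Lemma scheme_momentS p : (forall s, exists2 C, 0 <= C & scheme_moment p s C) ->
  forall s, exists2 C, 0 <= C & scheme_moment p.+1 s C.
Proof.
move=> IH s.
have [C1 C10 H1] := leaf_interval_moment_of_scheme IH s.
have [C2 C20 H2] := IH (s.+1 * p.+1).-1.
pose Phi (g : 'rV[R]_d -> R) (C : R) :=
  forall disp (Omega : measurableType disp) (P : probability Omega R)
    (W : 'I_d -> R -> Omega -> R), brownian_motion P W ->
  forall (E : {fset K}) lo hi tau wgt, subdivision T E lo hi tau wgt ->
  forall x (S : {fset K}) k, (S `<=` E)%fset -> (#|` S| <= p.+1)%N ->
  expect P (fun w => mdiff S (fun L => g ('X_[W, tau, lo, hi, x] L k w)) ^+ (2 * s.+1)) <=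
  C * (\sum_i expect P (fun w => mdiff S (fun L => ('X_[W, tau, lo, hi, x] L k w) 0 i) ^+ (2 * s.+1))
     + weight wgt S ^+ (2 * s.+1)).
have [||C C0 HC] := @uniform_coef_bound Phi.
- move=> g c c' cc H disp Omega P W bmW E lo hi tau wgt sub x S k SE Sp.
  apply: le_trans (H _ _ P W bmW E lo hi tau wgt sub x S k SE Sp) _.
  apply: ler_wpM2r => //; apply: addr_ge0; last exact: even_pow_ge0.
  by apply: sumr_ge0 => i _; apply: expect_ge0 => w; exact: even_pow_ge0.
- move=> g sg; have [C C0 HC] := @expect_mdiff_split K R d p.+1 s g sg.
  exists (C * (1 + C2)); first by rewrite mulr_ge0 // addr_ge0.
  move=> disp Omega P W bmW E lo hi tau wgt sub x S k SE Sp.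
  have mX L i : has_moments P (fun w => ('X_[W, tau, lo, hi, x] L k w) 0 i).
    by have [aX _] := adapted_scheme hsigma hb bmW sub x L k; have [_] := aX i.
  apply: (HC _ _ P (fun L w => 'X_[W, tau, lo, hi, x] L k w) wgt S C2 mX Sp (sub_wgt sub) C20).
  move=> L i LS L0 LnS; rewrite -(prednK (isT : 0 < s.+1 * p.+1)%N).
  apply: (H2 _ _ P W bmW E lo hi tau wgt sub) => //; first exact: fsubset_trans SE.
  rewrite -ltnS; apply: leq_trans Sp; apply: fproper_ltn_card.
  by rewrite fproperEneq LnS.
have G0 : 0 <= step_const d s T by exact: step_const_ge0.
set G := step_const d s T in G0.
have T00 := ltW T0.
pose bet := G * T ^+ s * d.+1%:R * C * d%:R.
have bet0 : 0 <= bet by rewrite !mulr_ge0 // exprn_ge0.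
pose alpha := G / T + bet.
have al0 : 0 <= alpha by rewrite addr_ge0 // divr_ge0.
exists (expR (alpha * T) * (d%:R * C1 + bet * T)).
  by rewrite mulr_ge0 ?expR_ge0 // addr_ge0 // mulr_ge0.
move=> disp Omega P W bmW E lo hi tau wgt sub x S k i SE S0 Sp.
have tau_ge0 j : 0 <= tau j by apply: tau_ge0; [exact: (sub_tau0 sub)|exact: (sub_tauS sub)].
pose A j := \sum_i expect P (fun w => mdiff S (fun L => ('X_[W, tau, lo, hi, x] L j w) 0 i) ^+ (2 * s.+1)).
set V := weight wgt S ^+ (2 * s.+1).
have V0 : 0 <= V by exact: even_pow_ge0.
have A0 j : 0 <= A j.
  by apply: sumr_ge0 => l _; apply: expect_ge0 => w; exact: even_pow_ge0.
have c0 : 0 <= d%:R * C1 * V by rewrite !mulr_ge0.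
have bV0 : 0 <= bet * V by rewrite mulr_ge0.
have [u uS] := fset0Pn _ S0.
(* The constant term of the bound is large enough for the recursion to be
   restarted after the interval of a leaf of S, wherever this interval lies. *)
suff main j : A j <= gronwall_bound alpha (bet * V) (d%:R * C1 * V) (tau j).
  apply: (@le_trans _ _ (A k)).
    rewrite /A (bigD1 i) //= lerDl; apply: sumr_ge0 => l _.
    by apply: expect_ge0 => w; exact: even_pow_ge0.
  apply: le_trans (main k) _; rewrite /gronwall_bound -[leRHS]mulrA.
  have tT := sub_tauT sub k.
  apply: ler_pM; rewrite ?expR_ge0 //.
  - by apply: addr_ge0 => //; exact: mulr_ge0.
  - by rewrite ler_expR; apply: ler_wpM2l.
  - by rewrite mulrDl lerD2l mulrAC; apply: ler_wpM2r => //; apply: ler_wpM2l.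
elim: j => [|j IHj].
  rewrite /A big1 => [|l _].
    rewrite /gronwall_bound; apply: mulr_ge0; first exact: expR_ge0.
    by apply: addr_ge0 => //; exact: mulr_ge0.
  have -> : (fun w => mdiff S (fun L => ('X_[W, tau, lo, hi, x] L 0%N w) 0 l) ^+ (2 * s.+1)) = cst 0.
    apply/funext => w; rewrite /random_scheme (mdiff_scheme_before sigma b hi _ _ x l uS) //.
    by rewrite expr0n.
  by rewrite expect_cst.
have [/hasP[v vS luj]|/hasPn nlu] := boolP (has (fun v => (lo v <= j < hi v)%N) (S : seq K)).
  apply: (@le_trans _ _ (d%:R * C1 * V)).
    apply: (@le_trans _ _ (\sum_(l < d) C1 * V)).
      apply: ler_sum => l _; apply: (H1 _ _ P W bmW E lo hi tau wgt sub x S v) => //.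
      by move: luj; clear; lia.
    by rewrite sumr_const card_ord -[leLHS]mulr_natl mulrA.
  rewrite /gronwall_bound -[leLHS]mul1r; apply: ler_pM => //.
    by apply: le_trans (expR_ge1Dx _); rewrite lerDl; exact: mulr_ge0.
  by rewrite lerDl; exact: mulr_ge0.
have dtT : time_step tau j <= T by rewrite /time_step; have := sub_tauT sub j.+1; have := tau_ge0 j; lra.
have dt0 : 0 <= time_step tau j by rewrite subr_ge0; exact: (sub_tauS sub).
have -> : tau j.+1 = tau j + time_step tau j by rewrite /time_step; ring.
apply: le_trans (gronwall_step al0 bV0 c0 (tau_ge0 j) dt0 IHj).
have unf w L : (L `<=` S)%fset ->
    'Z_[W, tau, lo, hi, x] L j w = 'X_[W, tau, lo, hi, x] L j w.
  move=> LS; apply: scheme_unfrozen => v vL.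
  by have := nlu v (fsubsetP LS _ vL); clear; lia.
have cb o l : expect P (fun w => mdiff S (fun L => coefficient sigma b o l ('Z_[W, tau, lo, hi, x] L j w)) ^+ (2 * s.+1))
    <= C * (A j + V).
  have -> : (fun w => mdiff S (fun L => coefficient sigma b o l ('Z_[W, tau, lo, hi, x] L j w)) ^+ (2 * s.+1)) =
    (fun w => mdiff S (fun L => coefficient sigma b o l ('X_[W, tau, lo, hi, x] L j w)) ^+ (2 * s.+1)).
    by apply/funext => w; congr (_ ^+ _); apply: eq_mdiff => L LS; rewrite unf.
  exact: (HC o l _ _ P W bmW E).
have aX L l := (adapted_scheme hsigma hb bmW sub x L j).1 l.
have aXd l := @adapted_mdiff _ _ _ _ _ P W tau S j (fun L w => ('X_[W, tau, lo, hi, x] L j w) 0 l) (fun L => aX L l).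
have aC o l : adapted P W tau j (fun w => mdiff S (fun L => coefficient sigma b o l ('Z_[W, tau, lo, hi, x] L j w))).
  apply: (@adapted_mdiff _ _ _ _ _ _ _ _ S j (fun L w => coefficient sigma b o l ('Z_[W, tau, lo, hi, x] L j w))) => L.
  exact: (adapted_coef hsigma hb bmW sub).
apply: (@le_trans _ _ (\sum_l ((1 + G / T * time_step tau j) *
    expect P (fun w => mdiff S (fun L => ('X_[W, tau, lo, hi, x] L j w) 0 l) ^+ (2 * s.+1)) +
    G * T ^+ s * d.+1%:R * (C * (A j + V)) * time_step tau j))).
  apply: ler_sum => l _.
  apply: le_trans (step_bound T0 bmW sub T0 (lexx T) dtT (aXd l) (aC None l) (fun m => aC (Some m) l)
    (cb None l) (fun m => cb (Some m) l)).
  rewrite le_eqVlt; apply/orP; left; apply/eqP; congr (expect P _); apply/funext => w.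
  by rewrite /random_scheme mdiff_schemeS.
rewrite big_split /= -mulr_sumr -/(A j) sumr_const card_ord -[X in _ + X <= _]mulr_natl.
rewrite /alpha /bet le_eqVlt; apply/orP; left; apply/eqP; ring.
Qed.

Theorem scheme_moment_bound p s : exists2 C, 0 <= C & scheme_moment p s C.
Proof.
elim: p s => [|p IH] s; last exact: scheme_momentS.
exists 0 => // disp Omega P W bmW E lo hi tau wgt sub x S k i SE S0.
by rewrite leqn0 cardfs_eq0 (negbTE S0).
Qed.

Theorem smooth_moment_bound p g s : smooth_bounded g ->
  exists2 C, 0 <= C & smooth_moment p s g C.
Proof. by move=> sg; apply: smooth_moment_of_scheme => // s'; exact: scheme_moment_bound. Qed.

End SchemeMoments.

(** * Trees *)

Section Trees.
Implicit Types (A L : {fset word}) (u v : word) (i j : nat).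

Lemma tree_ind (Q : {fset word} -> Prop) :
  (forall A, is_tree A -> (forall i, [:: i] \in A -> Q (subtree i A)) -> Q A) ->
  forall A, is_tree A -> Q A.
Proof.
move=> H A; have [m] := ubnP #|` A|; elim: m A => // m IH A Am tA.
apply: H => // i iA; apply: IH; last exact: is_tree_subtree.
by have [A0 _ _ _] := tA; have := card_subtree i A0; lia.
Qed.

Lemma tree_root A : is_tree A -> [::] \in A. Proof. by case. Qed.

Lemma tree_head A i v : is_tree A -> i :: v \in A -> [:: i] \in A.
Proof.
move=> tA; elim/last_ind: v => [//|v j IH]; rewrite -rcons_cons => h.
by apply: IH; have [_ _ pre _] := tA; exact: pre h.
Qed.

Lemma nsons_eq A A' u u' : is_tree A -> is_tree A' ->
  (forall i, (rcons u i \in A) = (rcons u' i \in A')) -> nsons A u = nsons A' u'.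
Proof.
move=> tA tA' h.
have e i : (i \in iota 1 (nsons A u)) = (i \in iota 1 (nsons A' u')) by rewrite !nsonsP.
move: (e (nsons A u)) (e (nsons A' u')); rewrite !mem_iota; clear; lia.
Qed.

Lemma nsons_subtree A i u : is_tree A -> [:: i] \in A ->
  nsons (subtree i A) u = nsons A (i :: u).
Proof.
move=> tA iA; apply: nsons_eq => //; first exact: is_tree_subtree.
by move=> j; rewrite in_subtree -rcons_cons.
Qed.

Lemma in_leaves A u : (u \in leaves A) = (u \in A) && (nsons A u == 0%N).
Proof. by rewrite !inE. Qed.

Lemma in_leaves_subtree A i u : is_tree A -> [:: i] \in A ->
  (u \in leaves (subtree i A)) = (i :: u \in leaves A).
Proof. by move=> tA iA; rewrite !in_leaves in_subtree nsons_subtree. Qed.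

Lemma in_subleaves A L i u : (u \in subleaves i A L) = (i :: u \in A) && (i :: u \in L).
Proof. by rewrite !inE -in_subtree; congr andb; rewrite in_subtree. Qed.

Lemma subleaves0 A i : subleaves i A fset0 = fset0.
Proof. by apply/fsetP => u; rewrite in_subleaves !in_fset0 andbF. Qed.

Lemma subleaves_sub A L i : is_tree A -> [:: i] \in A -> (L `<=` leaves A)%fset ->
  (subleaves i A L `<=` leaves (subtree i A))%fset.
Proof.
move=> tA iA /fsubsetP LA; apply/fsubsetP => u; rewrite in_subleaves => /andP[_ uL].
by rewrite in_leaves_subtree //; exact: LA.
Qed.

Lemma leaf_root A : is_tree A -> [::] \in leaves A -> A = [fset [::]]%fset.
Proof.
move=> tA; rewrite in_leaves => /andP[A0 /eqP n0]; apply/fsetP => u; rewrite inE.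
apply/idP/eqP => [|-> //]; case: u => // i v /(tree_head tA) iA.
by have := nsonsP [::] i tA; rewrite n0 /= iA.
Qed.

Lemma root_inner A i : is_tree A -> [:: i] \in A -> inner_nodes A [::].
Proof.
move=> tA iA; rewrite /inner_nodes /= inE in_leaves tree_root // andbT /=.
have := nsonsP [::] i tA; rewrite /= iA mem_iota; clear; lia.
Qed.

Lemma inner_subtree A i u : is_tree A -> [:: i] \in A ->
  inner_nodes (subtree i A) u -> inner_nodes A (i :: u).
Proof.
by move=> tA iA; rewrite /inner_nodes /= !in_fsetD !in_leaves in_subtree nsons_subtree.
Qed.

(** The void tree of the definition of the grids occurs exactly when the tree is
    reduced to its root and this root is removed. *)
Lemma root_in_leafset A L : is_tree A -> (L `<=` leaves A)%fset ->
  (A `\` L == fset0)%fset = ([::] \in L).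
Proof.
move=> tA LA; apply/idP/idP => [|L0].
  rewrite fsetD_eq0 => /fsubsetP; apply; exact: tree_root.
have -> : A = [fset [::]]%fset by apply: leaf_root => //; exact: (fsubsetP LA).
by rewrite fsetD_eq0 fsub1set.
Qed.

End Trees.

(** * Random grids *)

Section Grid.
Context {R : realType}.
Variables (T : R) (n : nat).
Hypotheses (T0 : 0 < T) (n0 : (0 < n)%N).
Implicit Types (A L : {fset word}) (u v : word) (i j l : nat) (k : word -> seq nat).

Local Notation mesh := (mesh T n).
Local Notation grid := (grid T n).

Lemma mesh_gt0 l : 0 < mesh l.
Proof. by rewrite divr_gt0 // exprn_gt0 // ltr0n. Qed.

Lemma meshS l : n%:R * mesh l.+1 = mesh l.
Proof.
have nn : n%:R != 0 :> R by rewrite pnatr_eq0 -lt0n.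
have nl : n%:R ^+ l != 0 :> R by rewrite expf_neq0.
by rewrite /Defs.mesh exprS; field; rewrite nn nl.
Qed.

Definition label k i : R := (nth 0%N (k [::]) i.-1)%:R.
Definition shift_label k i : word -> seq nat := fun v => k (i :: v).

Lemma mem_grid l A L k t : is_tree A -> (A `\` L == fset0)%fset = false ->
  reflect ((exists2 q, (q <= n)%N & t = q%:R * mesh l.+1) \/
    (exists i, [/\ [:: i] \in A, [:: i] \notin L &
       t - label k i * mesh l.+1 \in grid l.+1 (subtree i A) (subleaves i A L) (shift_label k i)]))
    (t \in grid l A L k).
Proof.
move=> tA AL; rewrite gridE // AL; apply: (iffP idP).
  rewrite inE => /orP[/imfsetP[q qi ->]|].
    have : q \in iota 0 n.+1 by exact: qi.
    by rewrite mem_iota => /andP[_ qn]; left; exists q.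
  case/bigfcupP => i /andP[]; rewrite (nsonsP [::] _ tA) /= => iA iL /imfsetP[/= s sg ->].
  by right; exists i; split => //; rewrite addrAC subrr add0r.
rewrite inE => -[[q qn ->]|[i [iA iL h]]]; apply/orP; [left|right].
  by apply/imfsetP; exists q => //; rewrite [_ \in _]mem_iota.
apply/bigfcupP; exists i; first by rewrite (nsonsP [::] _ tA) iA.
apply/imfsetP; exists (t - label k i * mesh l.+1) => //=.
by rewrite addrC subrK.
Qed.

Lemma grid_void l A L k : is_tree A -> (A `\` L == fset0)%fset ->
  grid l A L k = [fset 0; mesh l]%fset.
Proof. by move=> tA AL; rewrite gridE // AL. Qed.

(** The measurability of Upsilon at fixed labels has to be known for every value of
    the labels, including those of probability zero. *)
Lemma grid_ge0 l A L k t : is_tree A -> t \in grid l A L k -> 0 <= t.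
Proof.
move=> tA; elim/tree_ind: A / tA l L k t => A tA IH l L k t.
have [AL|/negbTE AL] := boolP (A `\` L == fset0)%fset.
  rewrite grid_void // !inE => /orP[] /eqP -> //; exact/ltW/mesh_gt0.
move/(mem_grid _ _ _ tA AL) => [[q _ ->]|[i [iA _ /(IH _ iA) h]]].
  by rewrite mulr_ge0 // ltW // mesh_gt0.
have : 0 <= label k i * mesh l.+1 by rewrite mulr_ge0 // ltW // mesh_gt0.
by lra.
Qed.

Lemma grid_ends l A L k : is_tree A -> 0 \in grid l A L k /\ mesh l \in grid l A L k.
Proof.
move=> tA; have [AL|/negbTE AL] := boolP (A `\` L == fset0)%fset.
  by rewrite grid_void // !inE !eqxx orbT.
split; apply/(mem_grid _ _ _ tA AL); left; first by exists 0%N; rewrite ?mul0r.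
by exists n; rewrite ?meshS.
Qed.

Lemma eq_grid l A L k k' : is_tree A -> (forall u, inner_nodes A u -> k u = k' u) ->
  grid l A L k = grid l A L k'.
Proof.
move=> tA; elim/tree_ind: A / tA l L k k' => A tA IH l L k k' e.
rewrite !gridE //; case: ifP => // _; congr (_ `|` _)%fset.
rewrite big_seq_cond [RHS]big_seq_cond; apply: eq_bigr => i /andP[].
rewrite (nsonsP [::] _ tA) /= => iA _.
rewrite (e [::]); last exact: root_inner iA.
rewrite (IH i iA l.+1 _ (fun v => k (i :: v)) (fun v => k' (i :: v))) // => u uA.
by apply: e; exact: inner_subtree.
Qed.

Definition valid A k := forall u, inner_nodes A u -> label_set n (nsons A u) (k u).

Lemma valid_subtree A k i : is_tree A -> [:: i] \in A -> valid A k ->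
  valid (subtree i A) (shift_label k i).
Proof.
move=> tA iA vA u uA; rewrite nsons_subtree //; apply: vA; exact: inner_subtree.
Qed.

Lemma valid_label A k i : is_tree A -> valid A k -> [:: i] \in A ->
  (nth 0%N (k [::]) i.-1 < n)%N.
Proof.
move=> tA vA iA; have [sz /andP[_ /all_nthP]] := vA _ (root_inner tA iA); apply.
by rewrite sz; have := nsonsP [::] i tA; rewrite /= iA mem_iota; clear; lia.
Qed.

Lemma valid_label_lt A k i j : is_tree A -> valid A k -> [:: i] \in A -> [:: j] \in A ->
  (i < j)%N -> label k i + 1 <= label k j.
Proof.
move=> tA vA iA jA ij; have [sz /andP[so _]] := vA _ (root_inner tA iA).
have := nsonsP [::] i tA; have := nsonsP [::] j tA; rewrite /= iA jA !mem_iota => hj hi.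
have h : (nth 0%N (k [::]) i.-1 < nth 0%N (k [::]) j.-1)%N.
  apply: (sorted_ltn_nth ltn_trans) => //; rewrite ?inE ?sz; move: hi hj ij; clear; lia.
by rewrite /label natr1 ler_nat.
Qed.

(** The intervals of two sons of the root are distinct cells of the same mesh. *)
Lemma valid_label_sep A k i j : is_tree A -> valid A k -> [:: i] \in A -> [:: j] \in A ->
  i != j -> label k i + 1 <= label k j \/ label k j + 1 <= label k i.
Proof.
move=> tA vA iA jA; rewrite neq_ltn => /orP[] h; [left|right]; exact: (valid_label_lt tA).
Qed.

(** The interval of u: each son is sent to the cell given by its label in the
    interval of its father. *)
Fixpoint left_end l k u : R :=
  if u is i :: v then label k i * mesh l.+1 + left_end l.+1 (shift_label k i) v else 0.

Definition right_end l k u : R := left_end l k u + mesh (l + size u).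

Lemma right_end_cons l k i v : right_end l k (i :: v) =
  label k i * mesh l.+1 + right_end l.+1 (shift_label k i) v.
Proof. by rewrite /right_end /= addnS addSn addrA. Qed.

Lemma label_range A k i l : is_tree A -> valid A k -> [:: i] \in A ->
  0 <= label k i * mesh l.+1 /\ label k i * mesh l.+1 + mesh l.+1 <= mesh l.
Proof.
move=> tA vA iA; have m0 := mesh_gt0 l.+1.
split; first by rewrite mulr_ge0 // ltW.
rewrite -(meshS l) -[X in _ + X <= _]mul1r -mulrDl; apply: ler_wpM2r; first exact: ltW.
by rewrite /label natr1 ler_nat; exact: (valid_label tA vA).
Qed.

Lemma interval_range l A k u : is_tree A -> valid A k -> u \in A ->
  0 <= left_end l k u /\ right_end l k u <= mesh l.
Proof.
move=> tA; elim/tree_ind: A / tA l k u => A tA IH l k [|i v] vA.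
  by rewrite /right_end /= add0r addn0.
move=> uA; have iA := tree_head tA uA.
have [h1 h2] := label_range l tA vA iA.
have [h3 h4] := IH i iA l.+1 (shift_label k i) v (valid_subtree tA iA vA) (etrans (in_subtree _ _ _) uA).
by rewrite right_end_cons /=; split; lra.
Qed.

Lemma grid_range l A L k t : is_tree A -> valid A k -> t \in grid l A L k ->
  0 <= t <= mesh l.
Proof.
move=> tA; elim/tree_ind: A / tA l L k t => A tA IH l L k t vA.
have m0 := ltW (mesh_gt0 l).
have [AL|/negbTE AL] := boolP (A `\` L == fset0)%fset.
  by rewrite grid_void // !inE => /orP[] /eqP ->; rewrite lexx ?m0.
move/(mem_grid _ _ _ tA AL) => [[q qn ->]|[i [iA _ /(IH _ iA) h]]].
  rewrite mulr_ge0 ?(ltW (mesh_gt0 _)) //= -(meshS l).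
  by apply: ler_wpM2r; [exact/ltW/mesh_gt0|rewrite ler_nat].
have /andP[h1 h2] := h (valid_subtree tA iA vA).
by have [h3 h4] := label_range l tA vA iA; apply/andP; split; lra.
Qed.

Lemma interval_ends_in_grid l A k u : is_tree A -> u \in A ->
  left_end l k u \in grid l A fset0 k /\ right_end l k u \in grid l A fset0 k.
Proof.
move=> tA; elim/tree_ind: A / tA l k u => A tA IH l k [|i v].
  by move=> _; rewrite /right_end /= add0r addn0; exact: grid_ends.
move=> uA; have iA := tree_head tA uA.
have AL : (A `\` fset0 == fset0)%fset = false by rewrite root_in_leafset ?fsub0set // inE.
have [h1 h2] := IH i iA l.+1 (shift_label k i) v (etrans (in_subtree _ _ _) uA).
split; apply/(mem_grid _ _ _ tA AL); right; exists i; split; rewrite ?inE // subleaves0.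
  by rewrite /= addrAC subrr add0r.
by rewrite right_end_cons addrAC subrr add0r.
Qed.

(** The paths to two distinct leaves part at some node, neither leaf being above
    the other; there, they enter distinct cells. *)
Lemma leaf_intervals_sep l A k u v : is_tree A -> valid A k -> u \in leaves A ->
  v \in leaves A -> u != v -> right_end l k u <= left_end l k v \/ right_end l k v <= left_end l k u.
Proof.
move=> tA; elim/tree_ind: A / tA l k u v => A tA IH l k u v vA uA vvA uv.
have sub w : w \in leaves A -> w \in A by rewrite in_leaves => /andP[].
case: u uA uv => [|i u] uA uv.
  by have AE := leaf_root tA uA; have := sub _ vvA; rewrite AE inE eq_sym (negbTE uv).
case: v vvA uv => [|j v] vvA uv.
  by have AE := leaf_root tA vvA; have := sub _ uA; rewrite AE inE (negbTE uv).
have iA := tree_head tA (sub _ uA); have jA := tree_head tA (sub _ vvA).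
rewrite !right_end_cons /=.
have [ij|ij] := eqVneq i j.
  subst j; have uv' : u != v by apply: contraNneq uv => ->.
  have := IH i iA l.+1 (shift_label k i) u v (valid_subtree tA iA vA).
  rewrite !in_leaves_subtree // => /(_ uA vvA uv') [h|h]; [left|right]; lra.
have [r1 r2] := interval_range l.+1 (is_tree_subtree tA iA) (valid_subtree tA iA vA) (etrans (in_subtree _ _ _) (sub _ uA)).
have [r3 r4] := interval_range l.+1 (is_tree_subtree tA jA) (valid_subtree tA jA vA) (etrans (in_subtree _ _ _) (sub _ vvA)).
have m0 := ltW (mesh_gt0 l.+1).
have [h|h] := valid_label_sep tA vA iA jA ij; [left|right].
  by have := ler_wpM2r m0 h; rewrite mulrDl mul1r; lra.
by have := ler_wpM2r m0 h; rewrite mulrDl mul1r; lra.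
Qed.

(** Removing a leaf removes the points that only the splitting of its interval
    had created, and these are interior.  Other leaves do not contribute points
    there, because their intervals do not overlap with this one. *)
Lemma grid_coarsen l A L k t : is_tree A -> valid A k -> (L `<=` leaves A)%fset ->
  (t \in grid l A L k) <->
  (t \in grid l A fset0 k /\ forall u, u \in L -> ~ (left_end l k u < t < right_end l k u)).
Proof.
move=> tA; elim/tree_ind: A / tA l L k t => A tA IH l L k t vA LA.
have AL0 : (A `\` fset0 == fset0)%fset = false by rewrite root_in_leafset ?fsub0set // inE.
have m0 := mesh_gt0 l.+1.
have subA u : u \in L -> u \in A by move=> /(fsubsetP LA); rewrite in_leaves => /andP[].
have [L0|L0] := boolP ([::] \in L).
  have AL : (A `\` L == fset0)%fset by rewrite root_in_leafset.
  have AE := leaf_root tA (fsubsetP LA _ L0).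
  rewrite grid_void // !inE; split => [h|[tg nt]].
    split; first by have [g1 g2] := grid_ends l fset0 k tA; case/orP: h => /eqP ->.
    move=> u /subA; rewrite AE inE => /eqP ->; rewrite /right_end /= add0r addn0.
    by case/orP: h => /eqP ->; rewrite ltxx ?andbF.
  have /andP[t1 t2] := grid_range tA vA tg.
  have := nt _ L0; rewrite /right_end /= add0r addn0.
  move: t1 t2; rewrite !le_eqVlt => /predU1P[<-|t1]; first by rewrite eqxx.
  by move=> /predU1P[->|t2]; rewrite ?eqxx ?orbT // t1 t2 => /(_ isT).
have AL : (A `\` L == fset0)%fset = false by rewrite root_in_leafset // (negbTE L0).
have rng i v : i :: v \in A -> label k i * mesh l.+1 <= left_end l k (i :: v) /\
    right_end l k (i :: v) <= label k i * mesh l.+1 + mesh l.+1.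
  move=> ivA; have iA := tree_head tA ivA.
  have [r1 r2] := interval_range l.+1 (is_tree_subtree tA iA) (valid_subtree tA iA vA) (etrans (in_subtree _ _ _) ivA).
  by rewrite right_end_cons /=; split; lra.
split=> [/(mem_grid _ _ _ tA AL)[[q qn tq]|[i [iA iL h]]]|[]].
- split; first by apply/(mem_grid _ _ _ tA AL0); left; exists q.
  case=> [|i v] uL; first by rewrite uL in L0.
  have [r1 r2] := rng _ _ (subA _ uL).
  rewrite tq => /andP[h1 h2].
  have : label k i * mesh l.+1 < q%:R * mesh l.+1 by lra.
  have : q%:R * mesh l.+1 < (label k i + 1) * mesh l.+1 by lra.
  rewrite !ltr_pM2r // /label natr1 !ltr_nat; clear; lia.
- have := (IH i iA l.+1 _ _ (t - label k i * mesh l.+1) (valid_subtree tA iA vA) (subleaves_sub tA iA LA)).1 h.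
  move=> [h0 hL]; split.
    by apply/(mem_grid _ _ _ tA AL0); right; exists i; split; rewrite ?inE // subleaves0.
  case=> [|j v] uL; first by rewrite uL in L0.
  have jvA := subA _ uL; have jA := tree_head tA jvA.
  have [ji|ji] := eqVneq j i.
    subst j; have := hL v; rewrite in_subleaves jvA uL => /(_ isT) nt.
    rewrite right_end_cons /= => /andP[h1 h2]; apply: nt; apply/andP; split; lra.
  have [r1 r2] := rng _ _ jvA.
  have /andP[g1 g2] := grid_range (is_tree_subtree tA iA) (valid_subtree tA iA vA) h.
  have [hh|hh] := valid_label_sep tA vA jA iA ji; have := ler_wpM2r (ltW m0) hh;
    rewrite mulrDl mul1r => hm /andP[t1 t2]; lra.
- move=> /(mem_grid _ _ _ tA AL0)[[q qn tq]|[i [iA _ h]]] nt.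
    by apply/(mem_grid _ _ _ tA AL); left; exists q.
  rewrite subleaves0 in h; apply/(mem_grid _ _ _ tA AL).
  (* If the son i is itself a removed leaf, a point of its interval that is not
     strictly inside is an end of it, hence a multiple of the mesh. *)
  have [iL|iL] := boolP ([:: i] \in L).
    have /andP[g1 g2] := grid_range (is_tree_subtree tA iA) (valid_subtree tA iA vA) h.
    have lt_n := valid_label tA vA iA.
    left; have := nt _ iL; rewrite right_end_cons /right_end /= !addr0 add0r addn0.
    move: g1 g2; rewrite !le_eqVlt => /predU1P[e _ _|g1 /predU1P[e _|g2 nn]].
    + exists (nth 0%N (k [::]) i.-1); first exact: ltnW.
      by rewrite -/(label k i); lra.
    + exists (nth 0%N (k [::]) i.-1).+1 => //.
      by rewrite -addn1 natrD -/(label k i) mulrDl mul1r; lra.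
    + by exfalso; apply: nn; apply/andP; split; lra.
  right; exists i; split=> //.
  apply/(IH i iA) => //; [exact: valid_subtree|exact: subleaves_sub|].
  split=> // v; rewrite in_subleaves => /andP[ivA ivL] /andP[h1 h2].
  by apply: (nt _ ivL); rewrite right_end_cons /=; apply/andP; split; lra.
Qed.

End Grid.

(** * Coarse Euler schemes as frozen fine ones *)

Section EulerAsFrozenScheme.
Context {R : realType} {d : nat}.
Variables (sigma : 'I_d -> 'rV[R]_d -> 'rV[R]_d) (b : 'rV[R]_d -> 'rV[R]_d).

Lemma euler_from_rcons (w : 'I_d -> R -> R) (s t : R) ts y :
  euler_from sigma b w s (rcons ts t) y =
  euler_step sigma b w (last s ts) t (euler_from sigma b w s ts y).
Proof. by elim: ts s y => [//|t' ts IH] s y /=; rewrite IH. Qed.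

Lemma euler_step_id (w : 'I_d -> R -> R) (s : R) y : euler_step sigma b w s s y = y.
Proof.
rewrite /euler_step subrr scale0r addr0 big1 ?addr0 // => j _.
by rewrite subrr scale0r.
Qed.

Lemma euler_step_trans (w : 'I_d -> R -> R) (c s t : R) z :
  euler_step sigma b w c s z + \sum_j (w j t - w j s) *: sigma j z + (t - s) *: b z =
  euler_step sigma b w c t z.
Proof.
rewrite /euler_step.
have -> : \sum_j (w j t - w j c) *: sigma j z =
    \sum_j (w j s - w j c) *: sigma j z + \sum_j (w j t - w j s) *: sigma j z.
  by rewrite -big_split; apply: eq_bigr => j _ /=; rewrite -scalerDl; congr (_ *: _); ring.
have -> : (t - c) *: b z = (s - c) *: b z + (t - s) *: b z.
  by rewrite -scalerDl; congr (_ *: _); ring.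
by rewrite !addrA; congr (_ + _); rewrite -!addrA; congr (_ + (_ + _)); exact: addrC.
Qed.

Variables (w : 'I_d -> R -> R) (T : R) (ts : seq R) (keep : pred R).
Variables (K : choiceType) (lo hi : K -> nat) (L : {fset K}) (x : 'rV[R]_d).
Let tau (i : nat) : R := nth T (0 :: ts) i.
Hypothesis frozenE : forall i, (0 < i < (size ts).+1)%N -> frozen lo hi L i = ~~ keep (tau i).

Local Notation sch m := (scheme sigma b lo hi (fun j k => w j (tau k.+1) - w j (tau k))
  (fun k => tau k.+1 - tau k) L x m).

(** Invariant relating the scheme on the grid of kept points to the frozen scheme
    on all points: the frozen point is the value of the former at the last kept
    point, and the current point is one Euler step away from it. *)
Lemma scheme_euler m : (m <= size ts)%N ->
  let c := last 0 (seq.filter keep (take m ts)) in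
  let z := euler_from sigma b w 0 (seq.filter keep (take m ts)) x in
  sch m = (euler_step sigma b w c (tau m) z, z).
Proof.
elim: m => [|m IH] ms.
  by rewrite take0 /= euler_step_id.
have {}IH := IH (ltnW ms).
move: IH => /= IH; rewrite IH euler_step_trans.
have tE : nth T ts m = tau m.+1 by [].
rewrite (take_nth T ms) filter_rcons tE frozenE; last by rewrite /= ltnS.
case: (keep (tau m.+1)) => //=.
by rewrite last_rcons euler_from_rcons euler_step_id.
Qed.

(** As the last point is kept, the pending Euler step is empty at the end. *)
Lemma scheme_euler_end : keep (last 0 (0 :: ts)) ->
  (sch (size ts)).1 = euler_from sigma b w 0 (seq.filter keep ts) x.
Proof.
move=> kl; have := scheme_euler (leqnn _); rewrite take_size => /= ->.
rewrite /=; case/lastP: ts @tau kl frozenE => [|ts' t] tau' /= kl _.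
  by rewrite euler_step_id.
rewrite last_rcons in kl.
have -> : tau' (size (rcons ts' t)) = t.
  by rewrite /tau' size_rcons /= nth_rcons ltnn eqxx.
by rewrite filter_rcons kl last_rcons euler_step_id.
Qed.

End EulerAsFrozenScheme.

Section FixedLabels.
Context {R : realType}.
Variables (T : R) (n : nat).
Hypotheses (T0 : 0 < T) (n0 : (0 < n)%N).
Variables (A : {fset word}) (k : word -> seq nat).
Hypotheses (tA : is_tree A) (vA : valid n A k).

Local Notation lp := (left_end T n 0 k).
Local Notation rp := (right_end T n 0 k).

Definition finest : seq R := sort <=%R (grid T n 0 A fset0 k).
(** The default value T continues the finest grid by a constant, so that time
    remains nondecreasing and bounded by T for all indices. *)
Definition gtime (i : nat) : R := nth T finest i.
Definition leaf_lo (u : word) : nat := index (lp u) finest.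
Definition leaf_hi (u : word) : nat := index (rp u) finest.
(** The length of the interval of the leaf, in units of T. *)
Definition leaf_wgt (u : word) : R := (n%:R ^+ size u)^-1.

Lemma mesh0 : mesh T n 0 = T. Proof. by rewrite /mesh expr0 divr1. Qed.

Lemma mem_finest t : (t \in finest) = (t \in grid T n 0 A fset0 k).
Proof. by rewrite mem_sort. Qed.

Lemma finest_sorted : sorted <%R finest.
Proof. by rewrite sort_lt_sorted fset_uniq. Qed.

Lemma finest_range t : t \in finest -> 0 <= t <= T.
Proof. by rewrite mem_finest => /(grid_range T0 n0 tA vA); rewrite mesh0. Qed.

Lemma index_finest s t : s \in finest -> t \in finest ->
  (index s finest < index t finest)%N = (s < t).
Proof.
move=> sf tf.
have lt a c : a \in finest -> c \in finest -> (index a finest < index c finest)%N -> a < c.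
  move=> af cf h; rewrite -(nth_index T af) -(nth_index T cf).
  by apply: (sorted_ltn_nth lt_trans T finest_sorted) => //; rewrite inE index_mem.
apply/idP/idP; first exact: lt.
move=> st; rewrite ltnNge leq_eqVlt; apply/negP => /predU1P[e|/(lt _ _ tf sf)].
  have : s = t by rewrite -(nth_index T sf) -(nth_index T tf) e.
  by move=> e'; rewrite e' ltxx in st.
by move=> /(lt_trans st); rewrite ltxx.
Qed.

Lemma gtime_index t : t \in finest -> gtime (index t finest) = t.
Proof. exact: nth_index. Qed.

Lemma gtimeS i : gtime i <= gtime i.+1.
Proof.
have [h|h] := ltnP i.+1 (size finest); last first.
  rewrite /gtime [leRHS]nth_default //.
  have [h'|h'] := ltnP i (size finest); last by rewrite nth_default.
  by have /andP[] := finest_range (mem_nth T h').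
by apply/ltW/(sorted_ltn_nth lt_trans T finest_sorted); rewrite ?inE // ltnW.
Qed.

Lemma gtime_range i : 0 <= gtime i <= T.
Proof.
have [h|h] := ltnP i (size finest); first exact/finest_range/mem_nth.
by rewrite /gtime nth_default // ltW /=.
Qed.

Lemma leaf_ends u : u \in leaves A -> lp u \in finest /\ rp u \in finest.
Proof.
rewrite in_leaves => /andP[uA _]; rewrite !mem_finest.
exact: interval_ends_in_grid.
Qed.

Lemma mesh_wgt u : mesh T n (size u) = T * leaf_wgt u. Proof. by []. Qed.

Lemma index_finest_le s t : s \in finest -> t \in finest -> s <= t ->
  (index s finest <= index t finest)%N.
Proof. by move=> sf tf st; rewrite leqNgt index_finest // -leNgt. Qed.

Lemma leaf_subdivision : subdivision T (leaves A) leaf_lo leaf_hi gtime leaf_wgt.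
Proof.
split.
- by have /andP[] := gtime_range 0.
- exact: gtimeS.
- by move=> i; have /andP[] := gtime_range i.
- move=> u; rewrite invr_gt0 exprn_gt0 ?ltr0n //= invf_le1 ?exprn_gt0 ?ltr0n //.
  by rewrite exprn_ege1 // ler1n.
- move=> u uA; have [l r] := leaf_ends uA; apply: index_finest_le => //.
  by rewrite /right_end lerDl ltW // mesh_gt0.
- move=> u uA; have [l r] := leaf_ends uA.
  by rewrite !gtime_index // /right_end addrAC subrr add0r add0n mesh_wgt.
- move=> u v uA vvA uv; have [l r] := leaf_ends uA; have [l' r'] := leaf_ends vvA.
  by have [h|h] := leaf_intervals_sep T0 n0 0 tA vA uA vvA uv; [left|right]; exact: index_finest_le.
Qed.

Lemma finest_cons : exists ts, finest = 0 :: ts.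
Proof.
have [g0 _] := grid_ends T n0 0 fset0 k tA.
have f0 : 0 \in finest by rewrite mem_finest.
have so := finest_sorted; have rg := finest_range.
case E : finest f0 so rg => [//|s ts] f0 so rg; exists ts; congr (_ :: _).
move: f0; rewrite inE => /predU1P[//|f0].
have /andP[s0 _] := rg s (mem_head _ _).
have : s < 0 by apply: (allP (order_path_min lt_trans so)).
by move=> /lt_le_trans /(_ s0); rewrite ltxx.
Qed.

Variables (d : nat) (sigma : 'I_d -> 'rV[R]_d -> 'rV[R]_d) (b : 'rV[R]_d -> 'rV[R]_d).

(** By [grid_coarsen] the grid of L is obtained from the finest one by deleting the
    points strictly inside the intervals of L, where the scheme is frozen. *)
Lemma euler_grid_scheme (w : 'I_d -> R -> R) (L : {fset word}) x : (L `<=` leaves A)%fset ->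
  euler sigma b w (grid T n 0 A L k) x =
  (scheme sigma b leaf_lo leaf_hi (fun j i => w j (gtime i.+1) - w j (gtime i))
    (time_step gtime) L x (size finest).-1).1.
Proof.
move=> LA; have [ts fE] := finest_cons.
pose keep t := t \in grid T n 0 A L k.
have [g0 gT] := grid_ends T n0 0 L k tA.
have sE : sort <=%R (grid T n 0 A L k) = 0 :: seq.filter keep ts.
  have -> : 0 :: seq.filter keep ts = seq.filter keep finest by rewrite fE /= /keep g0.
  apply: (irr_sorted_eq lt_trans ltxx).
  - by rewrite sort_lt_sorted fset_uniq.
  - exact/(sorted_filter lt_trans)/finest_sorted.
  move=> t; rewrite mem_sort mem_filter mem_finest /keep.
  apply/idP/andP => [h|[]//]; split => //.
  by have [] := (grid_coarsen T0 n0 0 t tA vA LA).1 h.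
rewrite /euler sE.
have gE i : gtime i = nth T (0 :: ts) i by rewrite /gtime fE.
have -> : (size finest).-1 = size ts by rewrite fE.
rewrite -(@scheme_euler_end _ _ sigma b w T ts keep _ leaf_lo leaf_hi L x) //.
- rewrite (_ : (fun j i => w j (gtime i.+1) - w j (gtime i)) =
    (fun j i => w j (nth T (0 :: ts) i.+1) - w j (nth T (0 :: ts) i))); last first.
    by apply/funext => j; apply/funext => i; rewrite !gE.
  rewrite (_ : time_step gtime = (fun i => nth T (0 :: ts) i.+1 - nth T (0 :: ts) i)) //.
  by apply/funext => i; rewrite /time_step !gE.
- move=> i /andP[i0 isz]; rewrite -gE.
  have {}isz : (i < size finest)%N by rewrite fE.
  have gf : gtime i \in finest by exact: mem_nth.
  have ii : index (gtime i) finest = i.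
    by apply: index_uniq => //; exact: (sorted_uniq lt_trans ltxx finest_sorted).
  have LE u : u \in L -> (lp u < gtime i < rp u) = (leaf_lo u < i < leaf_hi u)%N.
    move=> /(fsubsetP LA) uA; have [l r] := leaf_ends uA.
    by rewrite -[in RHS]ii !index_finest.
  apply/hasP/negP => [[u uL h]|nk].
    move=> /(grid_coarsen T0 n0 0 _ tA vA LA)[_ /(_ u uL)]; apply.
    by rewrite LE.
  apply: contrapT => nh; apply: nk; apply/(grid_coarsen T0 n0 0 _ tA vA LA).
  split; first by rewrite -mem_finest.
  by move=> u uL; rewrite LE // => h; apply: nh; exists u.
- have -> : last 0 (0 :: ts) = T; last by move: gT; rewrite mesh0.
  rewrite -[0 :: ts]fE.
  have Tf : T \in finest.
    by rewrite mem_finest; have [_] := grid_ends T n0 0 fset0 k tA; rewrite mesh0.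
  have lf : last 0 finest \in finest by rewrite fE /= mem_last.
  apply/eqP; rewrite eq_le; have /andP[_ ->] /= := finest_range lf.
  rewrite leNgt -index_finest // -leqNgt.
  have szf : size finest = (size ts).+1 by rewrite fE.
  have -> : index (last 0 finest) finest = (size finest).-1.
    rewrite -nth_last index_uniq ?szf //.
    exact: (sorted_uniq lt_trans ltxx finest_sorted).
  by rewrite -ltnS szf /= -szf index_mem.
Qed.

End FixedLabels.

(** * The estimate for fixed labels *)

Section FixedLabelEstimate.
Context {R : realType} {d : nat}.
Variables (T : R) (T0 : 0 < T).
Variables (sigma : 'I_d -> 'rV[R]_d -> 'rV[R]_d) (b : 'rV[R]_d -> 'rV[R]_d).
Hypotheses (hsigma : forall j, smooth_bounded (sigma j)) (hb : smooth_bounded b).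
Variables (f : 'rV[R]_d -> R) (hf : smooth_bounded f).
Variables (A : {fset word}) (tA : is_tree A).

Local Notation Ups n w k x := (Upsilon T n sigma b f A w k x).
Local Notation depth := (\sum_(u <- leaves A) size u)%N.

Lemma Upsilon_mdiff (n : nat) (k : word -> seq nat) (w : 'I_d -> R -> R) x :
  (0 < n)%N -> valid n A k ->
  Ups n w k x = mdiff (leaves A) (fun L => f (scheme sigma b (leaf_lo T n A k) (leaf_hi T n A k)
    (fun j i => w j (gtime T n A k i.+1) - w j (gtime T n A k i)) (time_step (gtime T n A k)) L x
       (size (finest T n A k)).-1).1).
Proof.
move=> n0 vA; apply: eq_mdiff => L LA.
by rewrite (euler_grid_scheme T0 n0 tA vA sigma b w x LA).
Qed.

Lemma weight_leaves (n : nat) : weight (@leaf_wgt R n) (leaves A) = (n%:R ^+ depth)^-1.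
Proof. by rewrite /weight /leaf_wgt prodfV prodrXr. Qed.

(** [smooth_moment_bound] for the set of all leaves, whose weight is n to the power
    of minus the total depth. *)
Lemma fixed_labels_bound : exists2 C, 0 <= C &
  forall (n : nat) (k : word -> seq nat), (0 < n)%N -> valid n A k ->
  forall disp (Omega : measurableType disp) (P : probability Omega R)
    (W : 'I_d -> R -> Omega -> R), brownian_motion P W -> forall x,
  expect P (fun w => (Ups n (fun j t => W j t w) k x) ^+ 2) <= C / n%:R ^+ (2 * depth).
Proof.
have [C C0 HC] := @smooth_moment_bound (seq nat) R d sigma b hsigma hb T T0 #|` leaves A| f 0 hf.
exists C => // n k n0 vA disp Omega P W bmW x.
have := HC _ _ P W bmW (leaves A) _ _ _ _ (leaf_subdivision T0 n0 tA vA) x (leaves A)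
  (size (finest T n A k)).-1 (fsubset_refl _) (leqnn _).
rewrite weight_leaves muln1 exprVn -exprM (mulnC depth) => h.
apply: le_trans h; rewrite le_eqVlt; apply/orP; left; apply/eqP; congr (expect P _).
by apply/funext => w; rewrite (Upsilon_mdiff _ _ n0 vA).
Qed.

Lemma euler_coord_measurable d1 (T1 : measurableType d1) (W : 'I_d -> R -> T1 -> R)
    (s : R) (ts : seq R) (y : T1 -> 'rV[R]_d) :
  (forall j t, 0 <= t -> measurable_fun setT (W j t)) -> all (fun t => 0 <= t) (s :: ts) ->
  (forall i, measurable_fun setT (fun w => y w 0 i)) ->
  forall i, measurable_fun setT (fun w => euler_from sigma b (fun j t => W j t w) s ts (y w) 0 i).
Proof.
move=> mW; elim: ts s y => [|t ts IH] s y //= /and3P[s0 t0 ts0] my i.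
apply: (IH t (fun w => euler_step sigma b (fun j t => W j t w) s t (y w))) => [|i'].
  by rewrite /= t0.
have mg (g : 'rV[R]_d -> R) : smooth_bounded g -> measurable_fun setT (fun w => g (y w)).
  by move=> sg; apply: measurable_continuous_coord => //; exact: smooth_bounded_continuous.
have -> : (fun w => euler_step sigma b (fun j t => W j t w) s t (y w) 0 i') =
  (fun w => (y w 0 i' + \sum_j (W j t w - W j s w) * sigma j (y w) 0 i') +
      (t - s) * b (y w) 0 i').
  apply/funext => w; rewrite !mxE summxE; congr (_ + _ + _).
  by apply: eq_bigr => j _; rewrite mxE.
apply: measurable_funD; last first.
  by apply: measurable_funM; [exact: measurable_cst|exact: mg (smooth_bounded_coord i' hb)].
apply: measurable_funD; first exact: my.
apply: measurable_sum => j; apply: measurable_funM.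
  by apply: measurable_funB; exact: mW.
exact: mg (smooth_bounded_coord i' (hsigma j)).
Qed.

Lemma Upsilon_measurable d1 (T1 : measurableType d1) (W : 'I_d -> R -> T1 -> R) n k x :
  (0 < n)%N -> (forall j t, 0 <= t -> measurable_fun setT (W j t)) ->
  measurable_fun setT (fun w => Ups n (fun j t => W j t w) k x).
Proof.
move=> n0 mW; apply: measurable_sum => L; apply: measurable_funM; first exact: measurable_cst.
apply: measurable_continuous_coord; first exact: smooth_bounded_continuous.
move=> i; rewrite /euler; case E : (sort <=%R _) => [|s ts]; first exact: measurable_cst.
apply: euler_coord_measurable; [exact: mW| |by move=> i'; exact: measurable_cst].
by apply/allP => t; rewrite -E mem_sort; exact: (grid_ge0 T0 n0 tA).
Qed.

Lemma Upsilon_bounded : exists M, forall n k w x, `|Ups n w k x| <= M.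
Proof.
have [M M0 HM] := smooth_bounded_bound hf.
exists (\sum_(L <- fpowerset (leaves A)) M) => n k w x.
apply: le_trans (ler_norm_sum _ _ _) _; apply: ler_sum => L _.
by rewrite normrM normrX normrN1 expr1n mul1r.
Qed.

Lemma eq_Upsilon n k k' w x : (forall u, inner_nodes A u -> k u = k' u) ->
  Ups n w k x = Ups n w k' x.
Proof.
by move=> e; apply: eq_bigr => L _; rewrite (eq_grid T n 0 L tA e).
Qed.

End FixedLabelEstimate.

(** * Averaging over the labels *)

Section UniformLabels.
Context {disp : measure_display} {Omega : measurableType disp} {R : realType}.
Variable P : probability Omega R.

Lemma expect_indic F : measurable F -> expect P (\1_F) = fine (P F).
Proof. by move=> mF; rewrite /expect /Rintegral integral_indic // setIT. Qed.

Lemma mom_indic F : measurable F -> has_moments P (\1_F).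
Proof.
move=> mF; apply: (@mom_bounded _ _ _ P _ 1); first exact: measurable_indic.
by move=> w; rewrite indicE; case: (_ \in _); rewrite ?normr1 // normr0.
Qed.

(** The admissible values are binomial(n, j) in number, each with probability
    1 / binomial(n, j): they exhaust the mass. *)
Lemma invalid_label_null (n j : nat) (X : Omega -> seq nat) s : (j <= n)%N ->
  (forall s, measurable (X @^-1` [set s])) ->
  (forall s, label_set n j s -> P (X @^-1` [set s]) = ('C(n, j)%:R^-1)%:E) ->
  ~ label_set n j s -> P (X @^-1` [set s]) = 0%E.
Proof.
move=> jn mX PX ns.
pose D := [pred t : j.-tuple 'I_n | sorted ltn (map val t)].
have cardD : #|D| = 'C(n, j) by rewrite -card_ltn_sorted_tuples cardsE.
have vD t : t \in D -> label_set n j (map val t).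
  rewrite inE => so; split; first by rewrite size_map size_tuple.
  rewrite so /=; apply/allP => i /mapP[i' _ ->]; exact: ltn_ord.
pose F (t : j.-tuple 'I_n) := X @^-1` [set (map val t : seq nat)].
have mF t : measurable (F t) by exact: mX.
have le1 w : \sum_(t in D) \1_(F t) w + \1_(X @^-1` [set s]) w <= 1 :> R.
  have z (t : j.-tuple 'I_n) : X w <> map val t -> \1_(F t) w = 0 :> R.
    by move=> h; rewrite indicE memNset.
  have [Xs|Xs] := eqVneq (X w) s.
    rewrite big1 ?add0r; first by rewrite indicE; case: (_ \in _).
    by move=> t tD; apply: z => e; apply: ns; rewrite -Xs e; exact: vD.
  have -> : \1_(X @^-1` [set s]) w = 0 :> R.
    by rewrite indicE memNset // => e; rewrite e eqxx in Xs.
  rewrite addr0.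
  have [/existsP[t0 /andP[t0D /eqP e0]]|/existsPn nex] :=
      boolP [exists t : j.-tuple 'I_n, (t \in D) && (X w == map val t)].
    rewrite (bigD1 t0) //= big1 ?addr0; first by rewrite indicE; case: (_ \in _).
    move=> t /andP[_ tt0]; apply: z => e; move: tt0; apply/negP; rewrite negbK.
    apply/eqP/val_inj; apply: (inj_map val_inj); by rewrite -e e0.
  rewrite big1 // => t tD; apply: z => e; have := nex t; rewrite tD e eqxx //.
have mS : measurable (X @^-1` [set s]) by exact: mX.
have h : expect P (fun w => \sum_(t in D) \1_(F t) w + \1_(X @^-1` [set s]) w) <= 1.
  rewrite -(expect_cst P 1); apply: expect_le => //; last exact: mom_cst.
  apply: momD; last exact: mom_indic.
  by apply: (@mom_sum _ _ _ P _ _ (fun t => t \in D) (fun t => \1_(F t))) => t; exact: mom_indic.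
rewrite expectD in h; last 2 first.
- by apply: (@mom_sum _ _ _ P _ _ (fun t => t \in D) (fun t => \1_(F t))) => t; exact: mom_indic.
- exact: mom_indic.
rewrite (@expect_sum _ _ _ P _ _ (fun t => t \in D) (fun t => \1_(F t))) in h; last first.
  by move=> t; exact: mom_indic.
rewrite (eq_bigr (fun=> 'C(n, j)%:R^-1)) in h; last first.
  by move=> t tD; rewrite expect_indic // PX //; exact: vD.
rewrite sumr_const cardD -[X in X + _ <= _]mulr_natl divff in h; last first.
  by rewrite pnatr_eq0 -lt0n bin_gt0.
rewrite expect_indic // in h.
have p0 : 0 <= fine (P (X @^-1` [set s])) by exact: fine_ge0.
have pz : fine (P (X @^-1` [set s])) = 0 by apply/eqP; rewrite eq_le p0 andbT; lra.
by rewrite -(fineK (fin_num_measure P _ mS)) pz.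
Qed.

End UniformLabels.

Lemma measurable_label_list d1 (T1 : measurableType d1) (kappa : word -> T1 -> seq nat)
    (I : seq word) (s : seq (seq nat)) :
  (forall u a, u \in I -> measurable (kappa u @^-1` [set a])) ->
  measurable [set w | [seq kappa u w | u <- I] = s].
Proof.
elim: I s => [|u I IH] [|a s] mk.
- by rewrite (_ : [set _ | _] = setT) //; apply/seteqP; split.
- by rewrite (_ : [set _ | _] = set0) //; apply/seteqP; split => w.
- by rewrite (_ : [set _ | _] = set0) //; apply/seteqP; split => w.
have -> : [set w | [seq kappa v w | v <- u :: I] = a :: s] =
   (kappa u @^-1` [set a]) `&` [set w | [seq kappa v w | v <- I] = s].
  by apply/seteqP; split => w /= [-> ->].
apply: measurableI; first by apply: mk; rewrite mem_head.
by apply: IH => v c vI; apply: mk; rewrite inE vI orbT.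
Qed.

Section RandomLabels.
Context {R : realType} {d : nat}.
Variables (T : R) (T0 : 0 < T).
Variables (sigma : 'I_d -> 'rV[R]_d -> 'rV[R]_d) (b : 'rV[R]_d -> 'rV[R]_d).
Hypotheses (hsigma : forall j, smooth_bounded (sigma j)) (hb : smooth_bounded b).
Variables (f : 'rV[R]_d -> R) (hf : smooth_bounded f).
Variables (A : {fset word}) (tA : is_tree A).
Variables (n : nat) (n0 : (0 < n)%N) (nA : (\max_(u <- A) nsons A u <= n)%N).
Context {disp : measure_display} {Omega : measurableType disp}.
Variables (P : probability Omega R) (W : 'I_d -> R -> Omega -> R)
  (kappa : word -> Omega -> seq nat).
Hypotheses (bmW : brownian_motion P W) (uk : uniform_labels P n A kappa)
  (ind : independent_of_labels P W A kappa).
Variable x : 'rV[R]_d.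

Let Ups k w := Upsilon T n sigma b f A (fun j t => W j t w) k x.
Let Y w := Ups (fun u => kappa u w) w.
Let I : seq word := (A `\` leaves A)%fset.
Let lab (s : seq (seq nat)) (u : word) := nth [::] s (index u I).
Let F (s : seq (seq nat)) : set Omega := [set w | [seq kappa u w | u <- I] = s].
Let GW := \bigcup_j process_events (W j).
Let GL := \bigcup_(u in inner_nodes A) label_events (kappa u).

Let inI u : inner_nodes A u -> u \in I. Proof. by []. Qed.

Let Y_on_F s w : F s w -> Y w = Ups (lab s) w.
Proof.
move=> Fs; apply: eq_Upsilon => // u uA; rewrite /lab -[s]Fs.
by rewrite (nth_map [::]) ?index_mem ?inI // nth_index ?inI.
Qed.

Let measurable_F s : measurable (F s).
Proof.
apply: measurable_label_list => u a uI; have [h _ _] := uk.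
by apply: (h u uI); exists [set a] => //; rewrite setTI.
Qed.

Let F_labels s : <<s GL >> (F s).
Proof.
apply: (@measurable_label_list _ (g_sigma_algebraType GL)) => u a uI.
apply: sub_sigma_algebra; exists u; first exact: uI.
by exists [set a] => //; rewrite setTI.
Qed.

Let Ups_W s : measurable_fun (setT : set (g_sigma_algebraType GW)) (Ups (lab s)).
Proof.
apply: (@Upsilon_measurable R d T T0 sigma b hsigma hb f hf A tA _ (g_sigma_algebraType GW) W n _ x n0).
move=> j t t0 _ B mB; apply: sub_sigma_algebra; exists j => //.
by apply: sub_sigma_algebra; exists t => //; exists B.
Qed.

Let Ups_measurable s : measurable_fun setT (Ups (lab s)).
Proof.
apply: (@Upsilon_measurable R d T T0 sigma b hsigma hb f hf A tA _ Omega W n _ x n0).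
by move=> j t t0; have [/(_ j)[h _ _ _ _] _] := bmW; exact: h.
Qed.

Let Ups_mom s : has_moments P (Ups (lab s)).
Proof.
have [M HM] := @Upsilon_bounded R d T sigma b f hf A.
by apply: (@mom_bounded _ _ _ P _ M) => // w; exact: HM.
Qed.

Let Y_measurable : measurable_fun setT Y.
Proof.
move=> _ B mB; rewrite setTI.
have -> : Y @^-1` B = \bigcup_s (F s `&` Ups (lab s) @^-1` B).
  apply/seteqP; split => [w Bw|w [s _ [Fs]]] /=; last by rewrite (Y_on_F Fs).
  by exists [seq kappa u w | u <- I] => //; split => //=; rewrite -(@Y_on_F [seq kappa u w | u <- I]).
apply: countable_bigcupT_measurable; first exact: countableP.
move=> s; apply: measurableI => //.
by rewrite -[X in measurable X]setTI; apply: Ups_measurable.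
Qed.

Lemma Upsilon_mom : has_moments P Y.
Proof.
have [M HM] := @Upsilon_bounded R d T sigma b f hf A.
by apply: (@mom_bounded _ _ _ P _ M) => // w; exact: HM.
Qed.

Let F_null s : ~ valid n A (lab s) -> P (F s) = 0%E.
Proof.
move=> nv.
have [u [uA nu]] : exists u, inner_nodes A u /\ ~ label_set n (nsons A u) (lab s u).
  apply: contrapT => h; apply: nv => u uA; apply: contrapT => nu; apply: h.
  by exists u.
have [h1 h2 _] := uk.
have un : (nsons A u <= n)%N.
  apply: leq_trans nA.
  have uA' : u \in (A : seq word) by move: uA; rewrite /inner_nodes /= in_fsetD => /andP[].
  exact: (@leq_bigmax_seq _ _ xpredT (fun v => nsons A v) u uA' isT).
have mu a : measurable (kappa u @^-1` [set a]).
  by apply: (h1 u uA); exists [set a] => //; rewrite setTI.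
have z := invalid_label_null un mu (fun a => h2 u a uA) nu.
apply/eqP; rewrite eq_le measure_ge0 andbT -z; apply: le_measure; rewrite ?inE //.
move=> w Fw /=; rewrite /lab -[s]Fw.
by rewrite (nth_map [::]) ?index_mem ?inI // nth_index ?inI.
Qed.

(** Where the list of labels takes the value s, Y is Upsilon with the deterministic
    labels s; the indicator of this event is independent of W, so that the
    expectation factorises.  The events form a countable partition. *)
Lemma Upsilon_square_le c : 0 <= c ->
  (forall k, valid n A k -> expect P (fun w => Ups k w ^+ 2) <= c) ->
  expect P (fun w => Y w ^+ 2) <= c.
Proof.
move=> c0 Hc.
have mY2 : measurable_fun setT (fun w => (Y w ^+ 2)%:E).
  by apply/measurable_EFinP; exact: measurable_funX.
have step s : (\int[P]_(w in F s) (Y w ^+ 2)%:E <= c%:E * P (F s))%E.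
  have [v|/F_null nv] := pselect (valid n A (lab s)); last first.
    by rewrite nv mule0 null_set_integral //; exact: measurable_funTS.
  have mZ : has_moments P (fun w => Ups (lab s) w ^+ 2) by exact: momX.
  have mi : has_moments P (\1_(F s)) by exact: mom_indic.
  have -> : (\int[P]_(w in F s) (Y w ^+ 2)%:E =
      \int[P]_w (Ups (lab s) w ^+ 2 * \1_(F s) w)%:E)%E.
    rewrite integral_mkcond; apply: eq_integral => w _; rewrite patchE indicE.
    by case: ifPn => [/set_mem Fw|_]; rewrite ?mulr1 ?mulr0 // (Y_on_F Fw).
  rewrite expect_integral; last exact: momM.
  rewrite expect_indepM //; last first.
    move=> S1 S2 mS1 mS2; apply: ind.
      have mm : measurable_fun (setT : set (g_sigma_algebraType GW)) (fun w => Ups (lab s) w ^+ 2).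
        exact: measurable_funX.
      by have := mm measurableT _ mS1; rewrite setTI.
    have mm : measurable_fun (setT : set (g_sigma_algebraType GL)) (\1_(F s) : g_sigma_algebraType GL -> R).
      by apply: measurable_indic; exact: F_labels.
    by have := mm measurableT _ mS2; rewrite setTI.
  rewrite EFinM (expect_indic P (measurable_F s)) [(fine (P (F s)))%:E]fineK; last exact: (fin_num_measure P _ (measurable_F s)).
  by apply: lee_wpmul2r => //; rewrite lee_fin; exact: Hc.
(* The values of the list are numbered, to obtain a partition indexed by nat. *)
pose q w : seq (seq nat) := [seq kappa u w | u <- I].
pose G (m : nat) : set Omega := [set w | choice.pickle (q w) = m].
have GE m : G m = set0 \/ exists s, G m = F s.
  have [|/set0P[w0 Gw0]] := eqVneq (G m) set0; first by left.
  right; exists (q w0); rewrite -Gw0; apply/seteqP; split => w; last by move=> Fw; congr choice.pickle.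
  exact: (pcan_inj (@choice.pickleK (seq (seq nat)))).
have mG m : measurable (G m) by have [->|[s ->]] := GE m.
have tG : trivIset setT G.
  apply/trivIsetP => i j _ _ ij; apply/seteqP; split => // w [Gi Gj].
  have e1 : choice.pickle (q w) = i := Gi; have e2 : choice.pickle (q w) = j := Gj.
  by move: ij; rewrite -e1 -e2 eqxx.
have UG : \bigcup_m G m = setT.
  by apply/seteqP; split => // w _; exists (choice.pickle (q w)).
have stepG m : (\int[P]_(w in G m) (Y w ^+ 2)%:E <= c%:E * P (G m))%E.
  by have [->|[s ->]] := GE m; rewrite ?integral_set0 ?measure0 ?mule0.
rewrite -lee_fin -expect_integral; last by apply: momX; exact: Upsilon_mom.
have Y0 w : (0 <= (Y w ^+ 2)%:E)%E by rewrite lee_fin sqr_ge0.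
rewrite -UG ge0_integral_bigcup //; last by rewrite UG.
apply: (@le_trans _ _ (\sum_(m <oo) (c%:E * P (G m)))%E).
  by apply: lee_nneseries => // m _ _; apply: integral_ge0.
rewrite nneseriesZl //.
rewrite -measure_semi_bigcup //; last by rewrite UG.
by rewrite UG /= probability_setT mule1.
Qed.

End RandomLabels.

(** * Variance and the normalising coefficient *)

Lemma expectation_square {disp : measure_display} {Omega : measurableType disp}
  {R : realType} (P : probability Omega R) (X : Omega -> R) : has_moments P X ->
  ('E_P[fun w => (X w ^+ 2)%R] = (expect P (fun w => (X w ^+ 2)%R))%:E)%E.
Proof. by move=> mX; rewrite unlock expect_integral //; exact: momX. Qed.

Lemma variance_le_square {disp : measure_display} {Omega : measurableType disp}
  {R : realType} (P : probability Omega R) (X : Omega -> R) : has_moments P X ->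
  (variance P X <= (expect P (fun w => X w ^+ 2))%:E)%E.
Proof.
move=> mX.
have EX : ('E_P[X] = (expect P X)%:E)%E by rewrite unlock expect_integral.
set m := expect P X in EX.
rewrite /variance covariance.unlock EX /= unlock.
have -> : (\int[P]_w (((X \- cst m) * (X \- cst m))%R w)%:E =
   \int[P]_w (X w ^+ 2 + ((- (2 * m)) * X w + m ^+ 2))%:E)%E.
  by apply: eq_integral => w _; congr _%:E; transitivity ((X w - m) * (X w - m)); [by []|ring].
have m1 : has_moments P (fun w => - (2 * m) * X w + m ^+ 2).
  by apply: momD; [exact: momZ|exact: (mom_cst P (m ^+ 2))].
rewrite expect_integral; last by apply: momD => //; exact: momX.
rewrite expectD //; last exact: momX.
rewrite expectD; [|exact: momZ|exact: (mom_cst P (m ^+ 2))].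
rewrite expectZ // (expect_cst P (m ^+ 2)) -/m lee_fin.
by have := sqr_ge0 m; lra.
Qed.

Lemma node_above_leaf (A : {fset word}) (v : word) : is_tree A -> v \in A ->
  exists2 u, u \in leaves A & v = take (size v) u.
Proof.
move=> tA; elim/tree_ind: A / tA v => A tA IH [|i v] vA.
  have [n0|n0] := eqVneq (nsons A [::]) 0%N.
    by exists [::] => //; rewrite in_leaves vA n0.
  have A1 : [:: 1%N] \in A.
    by rewrite -[[:: _]]/(rcons [::] 1%N) -nsonsP // mem_iota; move: n0; clear; lia.
  have [u uA _] := IH _ A1 [::] (etrans (in_subtree _ _ _) A1).
  by exists (1%N :: u); rewrite ?take0 // -in_leaves_subtree.
have iA := tree_head tA vA.
have [u uA vE] := IH _ iA v (etrans (in_subtree _ _ _) vA).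
by exists (i :: u); rewrite /= -?vE // -in_leaves_subtree.
Qed.

(** Nodes other than the root inject into the pairs of a leaf and a length: each
    is a nonempty prefix of some leaf. *)
Lemma nsons_sum_le (A : {fset word}) : is_tree A ->
  (\sum_(u <- A) nsons A u <= \sum_(u <- leaves A) size u)%N.
Proof.
move=> tA.
pose sons := [seq rcons u i | u <- (A : seq word), i <- iota 1 (nsons A u)].
pose prefixes := [seq take m u | u <- (leaves A : seq word), m <- iota 1 (size u)].
have -> : (\sum_(u <- A) nsons A u)%N = size sons.
  rewrite size_allpairs_dep sumnE big_map; apply: eq_bigr => u _; by rewrite size_iota.
have -> : (\sum_(u <- leaves A) size u)%N = size prefixes.
  rewrite size_allpairs_dep sumnE big_map; apply: eq_bigr => u _; by rewrite size_iota.
apply: uniq_leq_size.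
  apply: allpairs_uniq_dep; first exact: fset_uniq.
    by move=> u _; exact: iota_uniq.
  by move=> [u i] [v j] _ _ /= /rcons_inj [-> ->].
move=> _ /allpairsPdep[u [i [_ iu ->]]].
have uiA : rcons u i \in A by rewrite -nsonsP.
have [v vA vE] := node_above_leaf tA uiA.
apply/allpairsPdep; exists v, (size (rcons u i)); split => //.
rewrite mem_iota size_rcons /= add1n ltnS.
have := congr1 size vE; rewrite size_take size_rcons.
by case: ltnP => [/ltnW -> _ //|_ <-]; rewrite leqnn.
Qed.

Lemma bin_le_exp n m : ('C(n, m) <= n ^ m)%N.
Proof.
have : ('C(n, m) <= n ^_ m)%N by rewrite -bin_ffact leq_pmulr // fact_gt0.
move=> /leq_trans; apply; elim: m => [|m IH] //.
by rewrite ffactnSr expnSr; apply: leq_mul => //; exact: leq_subr.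
Qed.

(** binomial(n, j) <= n^j, and the exponents add up to the number of sons. *)
Lemma tree_coef_le (n : nat) (A : {fset word}) : is_tree A -> (0 < n)%N ->
  (tree_coef n A <= n ^ \sum_(u <- leaves A) size u)%N.
Proof.
move=> tA n0; apply: (@leq_trans (n ^ \sum_(u <- A) nsons A u)); last first.
  by rewrite leq_pexp2l // nsons_sum_le.
by rewrite expn_sum; apply: leq_prod => u _; exact: bin_le_exp.
Qed.

Theorem theorem4p4 (R : realType) (T : R) (hT : 0 < T) (d : nat)
    (hd : (0 < d)%N)
    (sigma : 'I_d -> 'rV[R]_d -> 'rV[R]_d) (b : 'rV[R]_d -> 'rV[R]_d)
    (hsigma : forall j, smooth_bounded (sigma j)) (hb : smooth_bounded b)
    (A : {fset word}) (hA : is_tree A)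
    (f : 'rV[R]_d -> R) (hf : smooth_bounded f) :
  (exists C : R, forall (n : nat),
     (0 < n)%N -> (\max_(u <- A) nsons A u <= n)%N ->
     forall (disp : measure_display) (Omega : measurableType disp)
       (P : probability Omega R) (W : 'I_d -> R -> Omega -> R)
       (kappa : word -> Omega -> seq nat),
     brownian_motion P W -> uniform_labels P n A kappa ->
     independent_of_labels P W A kappa ->
     forall x : 'rV[R]_d,
     let Y := fun w : Omega =>
       Upsilon T n sigma b f A (fun j t => W j t w) (fun u => kappa u w) x in
     ('E_P[fun w => (Y w ^+ 2)%R]
        <= (C / n%:R ^+ (2 * \sum_(u <- leaves A) size u))%:E)%E)
  /\
  (exists C : R, forall (n : nat),
     (0 < n)%N -> (\max_(u <- A) nsons A u <= n)%N ->
     forall (disp : measure_display) (Omega : measurableType disp)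
       (P : probability Omega R) (W : 'I_d -> R -> Omega -> R)
       (kappa : word -> Omega -> seq nat),
     brownian_motion P W -> uniform_labels P n A kappa ->
     independent_of_labels P W A kappa ->
     forall x : 'rV[R]_d,
     let Y := fun w : Omega =>
       Upsilon T n sigma b f A (fun j t => W j t w) (fun u => kappa u w) x in
     ('E_P[fun w => (((tree_coef n A)%:R * Y w) ^+ 2)%R] <= C%:E)%E /\
     (variance P (fun w => ((tree_coef n A)%:R * Y w)%R) <= C%:E)%E).
Proof.
have [C C0 HC] := fixed_labels_bound hT hsigma hb hf hA.
have key n : (0 < n)%N -> (\max_(u <- A) nsons A u <= n)%N ->
  forall disp (Omega : measurableType disp) (P : probability Omega R)
    (W : 'I_d -> R -> Omega -> R) (kappa : word -> Omega -> seq nat),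
  brownian_motion P W -> uniform_labels P n A kappa ->
  independent_of_labels P W A kappa -> forall (x : 'rV[R]_d) (Y : Omega -> R),
  Y = (fun w => Upsilon T n sigma b f A (fun j t => W j t w) (fun u => kappa u w) x) ->
  has_moments P Y /\ expect P (fun w => Y w ^+ 2) <= C / n%:R ^+ (2 * \sum_(u <- leaves A) size u).
  move=> n0 nA disp Omega P W kappa bmW uk ind x Y ->; split.
    exact: (Upsilon_mom hT hsigma hb hf hA n0 bmW uk).
  apply: (Upsilon_square_le hT hsigma hb hf hA n0 nA bmW uk ind).
    by rewrite divr_ge0 // exprn_ge0.
  by move=> k vk; exact: HC.
split; exists C => n n0 nA disp Omega P W kappa bmW uk ind x.
  have [mY hY] := key n n0 nA _ _ P W kappa bmW uk ind x _ erefl.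
  by cbv zeta; rewrite expectation_square // lee_fin.
move=> Y; have [mY hY] := key n n0 nA _ _ P W kappa bmW uk ind x Y erefl.
have mcY : has_moments P (fun w => (tree_coef n A)%:R * Y w) by exact: momZ.
have hc : expect P (fun w => ((tree_coef n A)%:R * Y w) ^+ 2) <= C.
  have -> : (fun w => ((tree_coef n A)%:R * Y w) ^+ 2) =
      (fun w => (tree_coef n A)%:R ^+ 2 * Y w ^+ 2).
    by apply/funext => w; rewrite exprMn.
  rewrite expectZ; last exact: momX.
  set N := n%:R ^+ (2 * \sum_(u <- leaves A) size u) in hY.
  have N0 : 0 < N by rewrite exprn_gt0 // ltr0n.
  have cN : (tree_coef n A)%:R ^+ 2 <= N :> R.
    rewrite /N mulnC exprM; apply: lerXn2r; rewrite ?nnegrE // ?exprn_ge0 //.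
    by rewrite -natrX ler_nat; exact: tree_coef_le.
  apply: le_trans (ler_wpM2l (sqr_ge0 _) hY) _.
  by rewrite mulrCA ler_piMr // ler_pdivrMr // mul1r.
split; first by rewrite expectation_square // lee_fin.
by apply: le_trans (variance_le_square mcY) _; rewrite lee_fin.
Qed.
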